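(* Let $\nu,\tau>0$ and let $\omega\in\mathbb{R}$ be Diophantine of type $(\nu,\tau)$. Let $V$ be a trigonometric polynomial on $\mathbb{T}=\mathbb{R}/\mathbb{Z}$, let $\alpha\in\mathbb{N}$, $\alpha\ge 1$, and $\lambda(\varepsilon)=1-\varepsilon^\alpha$. For $\varepsilon,\mu\in\mathbb{C}$ consider the map $$f_{\varepsilon,\mu}(x,y)=\bigl(x+\lambda(\varepsilon)y+\mu-\varepsilon V'(x),\ \lambda(\varepsilon)y+\mu-\varepsilon V'(x)\bigr)$$ on $\mathbb{T}\times\mathbb{R}$ (and its complex extension). Let $K_0(\theta)=(\theta,\omega)$ and $\mu_0=0$, so that $f_{0,\mu_0}\circ K_0(\theta)=K_0(\theta+\omega)$. Then there exists $\rho_0>0$ such that the following holds. (A) There exist formal power series $K_\varepsilon^{[\infty]}=\sum_{j=0}^\infty K_j\varepsilon^j$ and $\mu_\varepsilon^{[\infty]}=\sum_{j=0}^\infty\mu_j\varepsilon^j$ (with zeroth-order terms $K_0(\theta)=(\theta,\omega)$ and $\mu_0=0$, with $\mu_j\in\mathbb{C}$, and with $K_j\in\mathcal{A}_{\rho_0}$, $\mathbb{C}^2$-valued, for $j\ge1$) satisfying $f_{\varepsilon,\mu_\varepsilon}\circ K_\varepsilon(\theta)=K_\varepsilon(\theta+\omega)$ in the sense of formal power series. More precisely, writing $K_\varepsilon^{[\le N]}=\sum_{j=0}^N K_j\varepsilon^j$, $\mu_\varepsilon^{[\le N]}=\sum_{j=0}^N\mu_j\varepsilon^j$ and $T_\omega(\theta)=\theta+\omega$,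 for every $N\in\mathbb{N}$ there is $C_N>0$ such that, for all sufficiently small $|\varepsilon|$, $$\bigl\|f_{\varepsilon,\mu_\varepsilon^{[\le N]}}\circ K_\varepsilon^{[\le N]}-K_\varepsilon^{[\le N]}\circ T_\omega\bigr\|_{\rho_0}\le C_N|\varepsilon|^{N+1}.$$ Moreover, if the $K_j$ satisfy the normalization condition $$\int_{\mathbb{T}}\bigl[M_0^{-1}(\theta)K_n(\theta)\bigr]_1\,d\theta=0\qquad\text{for all } n\ge1,$$ then the expansions $K_\varepsilon^{[\infty]},\mu_\varepsilon^{[\infty]}$ are unique. (B) The unique formal power series $K^{[\infty]}_\varepsilon,\mu^{[\infty]}_\varepsilon$ satisfying the estimates of (A) for all $N$ and the normalization condition are Gevrey of exponent $2\tau/\alpha$: there exist constants $L,F,N_0$ such that $$\|K_n\|_{\rho_0}\le LF^n n^{(2\tau/\alpha)n}\quad\text{and}\quad |\mu_n|\le LF^n n^{(2\tau/\alpha)n}\qquad\text{for all } n>N_0.$$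
   Context: Diophantine: $\omega\in\mathbb{R}$ is Diophantine of type $(\nu,\tau)$ if $|e^{2\pi i k\omega}-1|\ge\nu|k|^{-\tau}$ for all $k\in\mathbb{Z}\setminus\{0\}$. Spaces: for $\rho>0$, $\mathbb{T}_\rho=\{z\in\mathbb{C}/\mathbb{Z}: |\mathrm{Im}(z)|\le\rho\}$; $\mathcal{A}_\rho$ is the space of functions analytic in the interior of $\mathbb{T}_\rho$ and continuous up to the boundary, with norm $\|g\|_\rho=\sup_{\theta\in\mathbb{T}_\rho}|g(\theta)|$. For a vector-valued $g=(g_1,g_2)$, $\|g\|_\rho=\sqrt{\|g_1\|_\rho^2+\|g_2\|_\rho^2}$. An equation holds in the sense of formal power series if the coefficients of $\varepsilon^n$ on both sides agree for all $n$. Normalization matrix: the symplectic form is $dx\wedge dy$, with matrix $J=\begin{pmatrix}0&1\\-1&0\end{pmatrix}$; $M_0(\theta)=\bigl[DK_0(\theta)\,|\,J^{-1}DK_0(\theta)\mathcal{N}_0(\theta)\bigr]$ is the $2\times2$ matrix with these two columns, where $\mathcal{N}_0=(DK_0^\top DK_0)^{-1}$ (for $K_0(\theta)=(\theta,\omega)$ one gets $M_0=\mathrm{Id}$). $[\cdot]_1$ denotes the first component. *)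

(* Defs.v *)
(* The topology and the complex derivative on R[i] are those of the regular
   module R[i]^o. *)
From HB Require Import structures.
From mathcomp Require Import all_boot all_order all_algebra.
From mathcomp Require Import all_classical all_reals all_analysis.

Set Implicit Arguments.
Unset Strict Implicit.
Unset Printing Implicit Defensive.

Import Order.TTheory GRing.Theory Num.Theory numFieldNormedType.Exports.
From mathcomp Require Import complex.
Import ComplexField.Normc.

Local Open Scope classical_set_scope.
Local Open Scope ring_scope.
Local Open Scope complex_scope.

Section Defs.
Context {R : realType}.
Implicit Types (rho nu tau omega : R) (z eps : R[i]).

(* The modulus |z| is [normc z : R]; the norm `|z| of R[i] has values in R[i]. *)

Definition cexp z : R[i] :=
  (expR (Re z))%:C * (cos (Im z) +i* sin (Im z)).

Definition fourier (k : int) z : R[i] := cexp ((0 +i* (2 * pi * k%:~R)) * z).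

Definition diophantine nu tau omega : Prop :=
  forall k : int, k != 0 ->
    nu * (`|k|%N%:R : R) `^ (- tau) <= normc (fourier k omega%:C - 1).

(* The entire extension of a trigonometric polynomial on R / Z. *)
Definition trigonometric_polynomial (V : R[i] -> R[i]) : Prop :=
  exists s : seq (int * R[i]),
    forall z, V z = \sum_(p <- s) p.2 * fourier p.1 z.

Definition cderive (g : R[i] -> R[i]) : R[i] -> R[i] :=
  derive1 (g : R[i]^o -> R[i]^o).

(* Functions on C / Z are 1-periodic functions on C; T_rho is lifted to the
   strip |Im z| <= rho, and values outside of the strip are irrelevant. *)
Definition strip rho : set R[i] := [set z | `|Im z| <= rho].

Definition analytic_at (g : R[i] -> R[i]) z : Prop :=
  exists a : nat -> R[i], \forall w \near (z : R[i]^o),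
    (fun N : nat => \sum_(0 <= n < N) a n * (w - z) ^+ n : R[i]^o)
      @ \oo --> (g w : R[i]^o).

Definition analytic_strip rho (g : R[i] -> R[i]) : Prop :=
  [/\ forall z, strip rho z -> g (z + 1) = g z,
      forall z, `|Im z| < rho -> analytic_at g z &
      {within (strip rho : set R[i]^o), continuous (g : R[i]^o -> R[i]^o)}].

(* An extended real, so that no boundedness of g is presupposed. *)
Definition strip_norm rho (g : R[i] -> R[i]) : \bar R :=
  ereal_sup [set (normc (g z))%:E | z in strip rho].

Definition strip_norm2 rho (g : R[i] -> 'cV[R[i]]_2) : \bar R :=
  let norm_i i := strip_norm rho (fun z => g z i 0) in
  sqrte (norm_i 0%R ^+ 2 + norm_i 1%R ^+ 2)%E.

Definition vec2 (x y : R[i]) : 'cV[R[i]]_2 := \col_i (if i == 0 then x else y).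

Definition lambda (alpha : nat) eps : R[i] := 1 - eps ^+ alpha.

(* The lift to C x C of the map f_(eps, mu) *)
Definition dissipative_map (alpha : nat) (V : R[i] -> R[i]) eps (mu : R[i])
    (p : 'cV[R[i]]_2) : 'cV[R[i]]_2 :=
  let x := p 0 0 in let y := p 1 0 in
  vec2 (x + lambda alpha eps * y + mu - eps * cderive V x)
       (lambda alpha eps * y + mu - eps * cderive V x).

Definition K0 omega (theta : R[i]) : 'cV[R[i]]_2 := vec2 theta omega%:C.

(* A formal power series in eps is the sequence of its coefficients. *)
Definition fps_mul (a b : nat -> R[i]) (n : nat) : R[i] :=
  \sum_(i < n.+1) a i * b (n - i)%N.

Definition fps_pow (a : nat -> R[i]) (m : nat) : nat -> R[i] :=
  iter m (fps_mul a) (fun n => (n == 0%N)%:R).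

(* g (a_0 + u) = sum_m g^(m)(a_0) / m! u^m, where u = sum_(j >= 1) a_j eps^j;
   as u has no constant term, u^m only contributes to orders n >= m. *)
Definition fps_comp (g : R[i] -> R[i]) (a : nat -> R[i]) (n : nat) : R[i] :=
  \sum_(m < n.+1) iter m cderive g (a 0%N) / (m`!)%:R
     * fps_pow (fun j => if j is 0%N then 0 else a j) m n.

Definition fps_eps (n : nat) : R[i] := (n == 1%N)%:R.

Definition fps_lambda (alpha n : nat) : R[i] :=
  (n == 0%N)%:R - (n == alpha)%:R.

Definition fps_dissipative_map (alpha : nat) (V : R[i] -> R[i]) (mu : nat -> R[i])
    (p : nat -> 'cV[R[i]]_2) (n : nat) : 'cV[R[i]]_2 :=
  let x := fun j => p j 0 0 in let y := fun j => p j 1 0 in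
  let dV := fps_comp (cderive V) x in
  vec2 (x n + fps_mul (fps_lambda alpha) y n + mu n - fps_mul fps_eps dV n)
       (fps_mul (fps_lambda alpha) y n + mu n - fps_mul fps_eps dV n).

Definition is_expansion omega rho
    (K : nat -> R[i] -> 'cV[R[i]]_2) (mu : nat -> R[i]) : Prop :=
  [/\ K 0%N = K0 omega, mu 0%N = 0 &
      forall j, (0 < j)%N -> forall i, analytic_strip rho (fun z => K j z i 0)].

Definition formal_solution alpha V omega rho
    (K : nat -> R[i] -> 'cV[R[i]]_2) (mu : nat -> R[i]) : Prop :=
  forall (n : nat) z, strip rho z ->
    fps_dissipative_map alpha V mu (fun j => K j z) n = K n (z + omega%:C).

Definition trunc_K (K : nat -> R[i] -> 'cV[R[i]]_2) (N : nat) eps z :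
  'cV[R[i]]_2 := \sum_(j < N.+1) eps ^+ j *: K j z.

Definition trunc_mu (mu : nat -> R[i]) (N : nat) eps : R[i] :=
  \sum_(j < N.+1) mu j * eps ^+ j.

Definition invariance_error alpha V omega (K : nat -> R[i] -> 'cV[R[i]]_2)
    (mu : nat -> R[i]) (N : nat) eps z : 'cV[R[i]]_2 :=
  dissipative_map alpha V eps (trunc_mu mu N eps) (trunc_K K N eps z)
  - trunc_K K N eps (z + omega%:C).

Definition asymptotic_solution alpha V omega rho
    (K : nat -> R[i] -> 'cV[R[i]]_2) (mu : nat -> R[i]) : Prop :=
  forall N : nat, exists2 C : R, 0 < C &
    \forall eps \near (0 : R[i]^o),
      (strip_norm2 rho (invariance_error alpha V omega K mu N eps)
        <= (C * normc eps ^+ N.+1)%:E)%E.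

Definition J : 'M[R[i]]_2 :=
  \matrix_(i < 2, j < 2) ((i < j)%N%:R - (j < i)%N%:R).

Definition DK0 omega (theta : R[i]) : 'cV[R[i]]_2 :=
  \col_i cderive (fun z => K0 omega z i 0) theta.

Definition calN0 omega (theta : R[i]) : 'M[R[i]]_1 :=
  invmx ((DK0 omega theta)^T *m DK0 omega theta).

Definition M0 omega (theta : R[i]) : 'M[R[i]]_2 :=
  row_mx (DK0 omega theta) (invmx J *m DK0 omega theta *m calN0 omega theta).

(* Integral over R / Z of the restriction of g to the real line *)
Definition circle_integral (g : R[i] -> R[i]) : R[i] :=
  (\int[lebesgue_measure]_(t in `[0, 1]) Re (g t%:C))
  +i* (\int[lebesgue_measure]_(t in `[0, 1]) Im (g t%:C)).

Definition normalized omega (K : nat -> R[i] -> 'cV[R[i]]_2) : Prop :=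
  forall n, (0 < n)%N ->
    circle_integral (fun theta => (invmx (M0 omega theta) *m K n theta) 0 0) = 0.

Definition same_expansion rho (K K' : nat -> R[i] -> 'cV[R[i]]_2)
    (mu mu' : nat -> R[i]) : Prop :=
  forall n, mu n = mu' n /\ forall z, strip rho z -> K n z = K' n z.

Definition gevrey_bounds rho (s : R) (K : nat -> R[i] -> 'cV[R[i]]_2)
    (mu : nat -> R[i]) : Prop :=
  exists (L F : R) (N0 : nat), forall n, (N0 < n)%N ->
    (strip_norm2 rho (K n) <= (L * F ^+ n * n%:R `^ (s * n%:R))%:E)%E
    /\ normc (mu n) <= L * F ^+ n * n%:R `^ (s * n%:R).

End Defs.

(* Main.v *)
Require Import Defs.
From mathcomp Require Import all_boot all_order all_algebra.
From mathcomp Require Import all_classical all_reals all_analysis.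
From mathcomp Require Import ring lra zify.
Set Implicit Arguments.
Unset Strict Implicit.
Unset Printing Implicit Defensive.
Import Order.TTheory GRing.Theory Num.Theory numFieldNormedType.Exports.
From mathcomp Require Import complex.
Import ComplexField.Normc.
Local Open Scope classical_set_scope.
Local Open Scope ring_scope.
Local Open Scope complex_scope.

(** Write x = theta + u for the first component of the invariant circle and
y = x - x(. - omega) for the second. The first component of the invariance
equation then follows from the second, which becomes one scalar equation
<<
  u(. + omega) - (1 + lam) u + lam u(. - omega)
      + eps^alpha omega + eps V'(theta + u) = mu,      lam = 1 - eps^alpha.
>>
At leading order the left-hand side is the discrete Laplacian of u, which is
invertible on functions of mean zero, while mu is free to match the mean. So the
series exists order by order with u of mean zero ([lindstedt],
[lindstedt_solves], [formal_solution_Kser]); the normalization only says that u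
has mean zero, because M_0 is the identity.

Gevrey bounds. As V has frequencies at most d, order n of u only has frequencies
|k| <= d n, so a small divisor met at order n costs a power n^tau. Solving one
order at a time would multiply these costs. Instead the orders are treated in
dyadic blocks: the block v of the orders M, ..., 2M - 1 solves the linearised
equation at the truncation of u below M, exactly modulo eps^(2M). The
linearisation is reducible: l = 1 + d_theta u, the derivative of theta + u, solves
it up to terms of order M, so the Wronskian of l and v, and then v / l, are
obtained by two first-order difference equations, with one small divisor each
([block_estimate]). The dissipation enters only through 1 - lam = eps^alpha, and
is absorbed as soon as the radius r in eps satisfies K r^alpha <= 1/4, with K the
inverse of the smallest divisor in use; for orders up to N it is enough that r be
a small multiple of N^(-2 tau / alpha). A block starting at order M gains x^M
when the radius is multiplied by x < 1. Along the radii r (1 + (3/4)^m) with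
M = 2^m, this gain is doubly exponentially small in m, while the divisors and the
derivative only cost a factor exponential in m ([dyadic_step],
[shrink_factor_decay]). Hence u stays small at radius r = kappa N^(-2 tau / alpha)
up to order N, uniformly in N ([lindstedt_jacobian]). Reading off the coefficient
of order N bounds it by r^(-N) = kappa^(-N) N^((2 tau / alpha) N) ([Kser_gevrey]).
The passage to the strip of width rho costs exp(2 pi rho d) per order, so any
rho is possible.

Formal and asymptotic solutions. At fixed theta the invariance error is a
polynomial in eps plus eps times a Taylor remainder of V', of order N + 2 in all.
A polynomial that is O(eps^(N+1)) has no coefficients up to N ([poly_order]), so
the estimates and the formal equation imply each other ([asymptotic_formal],
[formal_asymptotic]).

Uniqueness. At the first order where two solutions differ, the differences X, Y,
m of the components and of mu satisfy Y(. + omega) = Y + m and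
X(. + omega) = X + Y + m. Small return times of the rotation forbid any drift, so
m = 0 and Y = 0; then X is constant on horizontal lines since omega is
irrational, and constant by analyticity ([strip_cohomology]); the normalization
makes it zero ([formal_unique]). *)

(** * Formal Fourier series graded by the order in eps *)

Section Bigraded.
Context {R : realType} (d : nat).
Local Notation bpoly := {poly {poly R[i]}}.
Implicit Types (a b : bpoly) (s t : int -> R[i]) (r : R).

Lemma normc_ge0 (z : R[i]) : 0 <= normc z.
Proof. by case: z => x y /=; rewrite sqrtr_ge0. Qed.

Lemma normc_sum (I : Type) (l : seq I) (P : pred I) (F : I -> R[i]) :
  normc (\sum_(i <- l | P i) F i) <= \sum_(i <- l | P i) normc (F i).
Proof.
elim/big_rec2: _ => [|i x y _ le_xy]; first by rewrite normc0.
by rewrite (le_trans (le_normcD _ _)) // lerD2l.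
Qed.

Lemma normcX (z : R[i]) n : normc (z ^+ n) = normc z ^+ n.
Proof. by elim: n => [|n IH]; rewrite ?expr0 ?normc1 // !exprS normcM IH. Qed.

(** A coefficient [a`_n`_j] of a polynomial in two variables stands for
    eps^n exp(2 pi i k theta) with k = j - d n. All the series in use have
    |k| <= d n, so that this shift makes the exponents nonnegative, and the
    product of polynomials is the product of the series. *)
Definition freq (n j : nat) : int := j%:Z - (d * n)%:Z.

Lemma freqD n n' j j' : freq (n + n') (j + j') = freq n j + freq n' j'.
Proof. by rewrite /freq mulnDr !PoszD; ring. Qed.

Lemma freq00 : freq 0 0 = 0. Proof. by rewrite /freq muln0 subrr. Qed.

Lemma freq_bound n j M : (j <= 2 * d * n)%N -> (n <= M)%N ->
  (`|freq n j| <= d * M)%N.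
Proof.
move=> jn nM; have := leq_mul (leqnn d) nM; move: jn; rewrite /freq -mulnA.
by move: (d * n)%N (d * M)%N => x y; lia.
Qed.

Lemma bpolyP a b : (forall n j, a`_n`_j = b`_n`_j) <-> a = b.
Proof.
by split=> [ab|-> //]; apply/polyP => n; apply/polyP => j; exact: ab.
Qed.

(** The Fourier multiplier of symbol s: translations of theta, the derivative,
    the mean and the division by small divisors are all of this form. *)
Definition fmult s a : bpoly :=
  \poly_(n < size a) \poly_(j < size a`_n) (s (freq n j) * a`_n`_j).

Lemma coef_fmult s a n j : (fmult s a)`_n`_j = s (freq n j) * a`_n`_j.
Proof.
rewrite coef_poly; case: ltnP => [_|le_n]; last first.
  by rewrite (nth_default 0 le_n) !coef0 mulr0.
rewrite coef_poly; case: ltnP => // le_j.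
by rewrite (nth_default 0 le_j) mulr0.
Qed.

Lemma coefBM a b n j : (a * b)`_n`_j =
  \sum_(i < n.+1) \sum_(k < j.+1) a`_i`_k * b`_(n - i)`_(j - k).
Proof. by rewrite coefM coef_sum; apply: eq_bigr => i _; rewrite coefM. Qed.

Lemma fmultD s : {morph fmult s : a b / a + b}.
Proof. by move=> a b; apply/bpolyP => n j; rewrite !(coef_fmult, coefD) mulrDr. Qed.

Lemma fmultN s : {morph fmult s : a / - a}.
Proof. by move=> a; apply/bpolyP => n j; rewrite !(coef_fmult, coefN) mulrN. Qed.

Lemma fmultB s : {morph fmult s : a b / a - b}.
Proof. by move=> a b; rewrite fmultD fmultN. Qed.

Lemma fmult0 s : fmult s 0 = 0.
Proof. by apply/bpolyP => n j; rewrite coef_fmult !coef0 mulr0. Qed.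

Lemma fmult_sum s (I : Type) (l : seq I) (P : pred I) (F : I -> bpoly) :
  fmult s (\sum_(i <- l | P i) F i) = \sum_(i <- l | P i) fmult s (F i).
Proof. exact: (big_morph _ (fmultD s) (fmult0 s)). Qed.

Lemma fmult_comp s t a : fmult s (fmult t a) = fmult (fun k => s k * t k) a.
Proof. by apply/bpolyP => n j; rewrite !coef_fmult mulrA. Qed.

Lemma eq_fmult s t a : s =1 t -> fmult s a = fmult t a.
Proof. by move=> st; apply/bpolyP => n j; rewrite !coef_fmult st. Qed.

(** A multiplier acts on products through the action of its symbol on sums of
    frequencies. The two-term form covers both translations, whose symbols are
    multiplicative, and the derivative, whose symbol is additive. *)
Lemma fmultM_gen s s1 s2 s3 s4 a b :
  (forall k l, s (k + l) = s1 k * s2 l + s3 k * s4 l) ->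
  fmult s (a * b) = fmult s1 a * fmult s2 b + fmult s3 a * fmult s4 b.
Proof.
move=> sD; apply/bpolyP => n j.
rewrite !coefD coef_fmult !coefBM mulr_sumr -big_split /=.
apply: eq_bigr => i _; rewrite mulr_sumr -big_split /=.
apply: eq_bigr => k _; rewrite !coef_fmult.
have -> : freq n j = freq i k + freq (n - i) (j - k).
  by rewrite -freqD !subnKC // -ltnS.
by rewrite sD; ring.
Qed.

Lemma fmultM s a b : (forall k l, s (k + l) = s k * s l) ->
  fmult s (a * b) = fmult s a * fmult s b.
Proof.
move=> sM; rewrite (@fmultM_gen s s s (fun=> 0) (fun=> 0)) => [|k l].
  have z x : fmult (fun=> 0) x = 0.
    by apply/bpolyP => n j; rewrite coef_fmult !coef0 mul0r.
  by rewrite !z mulr0 addr0.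
by rewrite sM mulr0 addr0.
Qed.

Lemma fmult_id a : fmult (fun=> 1) a = a.
Proof. by apply/bpolyP => n j; rewrite coef_fmult mul1r. Qed.

Lemma fmult_leibniz s a b : (forall k l, s (k + l) = s k + s l) ->
  fmult s (a * b) = fmult s a * b + a * fmult s b.
Proof.
move=> sD; rewrite (@fmultM_gen s s (fun=> 1) (fun=> 1) s) => [|k l].
  by rewrite !fmult_id.
by rewrite sD mulr1 mul1r.
Qed.

(** The mean over theta, order by order; [osc] is the oscillating part. *)
Definition avg := fmult (fun k => (k == 0)%:R).
Definition osc := fmult (fun k => (k != 0)%:R).

Lemma avg_osc a : a = avg a + osc a.
Proof.
apply/bpolyP => n j; rewrite !coefD !coef_fmult -mulrDl.
by case: eqP; rewrite /= ?addr0 ?add0r mul1r.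
Qed.

Lemma avg_avg a : avg (avg a) = avg a.
Proof.
rewrite /avg fmult_comp; apply: eq_fmult => k.
by case: eqP; rewrite /= ?mul1r ?mul0r.
Qed.

Lemma avg_oscE a : avg (osc a) = 0.
Proof.
rewrite /osc /avg fmult_comp; apply/bpolyP => n j; rewrite coef_fmult !coef0.
by case: eqP; rewrite /= ?mul0r ?mulr0 ?mul0r.
Qed.

Lemma avg_fmult s a : s 0 = 1 -> avg (fmult s a) = avg a.
Proof.
move=> s0; rewrite /avg fmult_comp; apply: eq_fmult => k.
by case: eqP => [->|_]; rewrite ?s0 ?mulr1 ?mul0r.
Qed.

Lemma fmult_avg s a : s 0 = 1 -> fmult s (avg a) = avg a.
Proof.
move=> s0; rewrite /avg fmult_comp; apply: eq_fmult => k.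
by case: eqP => [->|_]; rewrite ?s0 ?mulr1 ?mulr0.
Qed.

Lemma avg_fmult0 s a : s 0 = 0 -> avg (fmult s a) = 0.
Proof.
move=> s0; rewrite /avg fmult_comp; apply/bpolyP => n j.
rewrite coef_fmult !coef0.
by case: eqP => [->|_]; rewrite ?s0 ?mulr0 ?mul0r.
Qed.

Lemma fmult0_avg s a : s 0 = 0 -> fmult s (avg a) = 0.
Proof.
move=> s0; rewrite /avg fmult_comp; apply/bpolyP => n j.
rewrite coef_fmult !coef0.
by case: eqP => [->|_]; rewrite ?s0 ?mul0r ?mulr0 ?mul0r.
Qed.

Lemma avgMl a b : avg (avg a * b) = avg a * avg b.
Proof.
apply/bpolyP => n j.
rewrite coef_fmult !coefBM mulr_sumr; apply: eq_bigr => i _.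
rewrite mulr_sumr; apply: eq_bigr => k _; rewrite !coef_fmult.
have -> : freq n j = freq i k + freq (n - i) (j - k).
  by rewrite -freqD !subnKC // -ltnS.
case: (freq i k =P 0) => [->|_]; last by rewrite !mul0r mulr0.
by rewrite add0r; ring.
Qed.

(** ** Congruences modulo powers of eps *)
Definition vanishes (M : nat) a := forall n, (n < M)%N -> a`_n = 0.

Lemma vanishesD M a b : vanishes M a -> vanishes M b -> vanishes M (a + b).
Proof. by move=> a0 b0 n nM; rewrite coefD a0 // b0 // addr0. Qed.

Lemma vanishesN M a : vanishes M a -> vanishes M (- a).
Proof. by move=> a0 n nM; rewrite coefN a0 // oppr0. Qed.

Lemma vanishesB M a b : vanishes M a -> vanishes M b -> vanishes M (a - b).
Proof. by move=> a0 b0; apply/vanishesD/vanishesN. Qed.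

Lemma vanishes0 M : vanishes M 0.
Proof. by move=> n _; rewrite coef0. Qed.

Lemma vanishesW M N a : (M <= N)%N -> vanishes N a -> vanishes M a.
Proof. by move=> MN a0 n nM; rewrite a0 // (leq_trans nM). Qed.

Lemma vanishesM M N a b :
  vanishes M a -> vanishes N b -> vanishes (M + N) (a * b).
Proof.
move=> a0 b0 n nMN; rewrite coefM big1 // => i _.
case: (ltnP i M) => [iM|Mi]; first by rewrite a0 ?mul0r.
by rewrite b0 ?mulr0 //; have := ltn_ord i; lia.
Qed.

Lemma vanishesMl M a b : vanishes M b -> vanishes M (a * b).
Proof. by move=> b0; rewrite -(add0n M); apply: vanishesM. Qed.

Lemma vanishesMr M a b : vanishes M a -> vanishes M (a * b).
Proof. by rewrite mulrC; exact: vanishesMl. Qed.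

Lemma vanishesX M n a : vanishes M a -> vanishes (M * n) (a ^+ n).
Proof.
move=> a0; elim: n => [|n IH]; first by rewrite muln0.
by rewrite mulnS exprS; apply: vanishesM.
Qed.

Lemma vanishes_sum M (I : Type) (l : seq I) (P : pred I) (F : I -> bpoly) :
  (forall i, P i -> vanishes M (F i)) -> vanishes M (\sum_(i <- l | P i) F i).
Proof.
by move=> F0; elim/big_ind: _ => //; [exact: vanishes0 | exact: vanishesD].
Qed.

Lemma vanishes_fmult M s a : vanishes M a -> vanishes M (fmult s a).
Proof.
by move=> a0 n nM; apply/polyP => j; rewrite coef_fmult a0 // !coef0 mulr0.
Qed.

(** ** Frequencies bounded by the order *)
(** This is the bound k <= d n on frequencies; the bound k >= - d n holds by the
    encoding. *)
Definition cone a := forall n j, (2 * d * n < j)%N -> a`_n`_j = 0.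

Lemma coneD a b : cone a -> cone b -> cone (a + b).
Proof. by move=> a0 b0 n j nj; rewrite !coefD a0 // b0 // addr0. Qed.

Lemma coneN a : cone a -> cone (- a).
Proof. by move=> a0 n j nj; rewrite !coefN a0 // oppr0. Qed.

Lemma coneB a b : cone a -> cone b -> cone (a - b).
Proof. by move=> a0 b0; apply/coneD/coneN. Qed.

Lemma coneM a b : cone a -> cone b -> cone (a * b).
Proof.
move=> a0 b0 n j nj; rewrite coefBM big1 // => i _; rewrite big1 // => k _.
case: (ltnP (2 * d * i) k) => [ik|ki]; first by rewrite a0 // mul0r.
rewrite b0 ?mulr0 // mulnBr ltn_subRL.
have := leq_mul (leqnn (2 * d)%N) (leq_ord i); move: nj ki.
by move: (2 * d * n)%N (2 * d * i)%N => x y; lia.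
Qed.

Lemma cone0 : cone 0. Proof. by move=> n j _; rewrite !coef0. Qed.

Lemma cone_sum (I : Type) (l : seq I) (P : pred I) (F : I -> bpoly) :
  (forall i, P i -> cone (F i)) -> cone (\sum_(i <- l | P i) F i).
Proof.
by move=> F0; elim/big_ind: _ => //; [exact: cone0 | exact: coneD].
Qed.

Lemma cone_fmult s a : cone a -> cone (fmult s a).
Proof. by move=> a0 n j nj; rewrite coef_fmult a0 // mulr0. Qed.

Definition bcst (c : R[i]) : bpoly := c%:P%:P.

Lemma coef_bcst c n j : (bcst c)`_n`_j = c *+ ((n == 0) && (j == 0))%N.
Proof. by rewrite /bcst coefC; case: n => [|n] /=; rewrite ?coef0 // coefC; case: j. Qed.

Lemma coef_bcstM c a n j : (bcst c * a)`_n`_j = c * a`_n`_j.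
Proof. by rewrite coefCM coefCM. Qed.

Lemma cone_bcst c : cone (bcst c).
Proof. move=> n j nj; rewrite coef_bcst; case: n j nj => [|n] [|j] //. Qed.

Lemma cone1 : cone 1.
Proof. exact: (cone_bcst 1). Qed.

Lemma coneX a n : cone a -> cone (a ^+ n).
Proof.
by move=> a0; elim: n => [|n IH]; [exact: cone1 | rewrite exprS; exact: coneM].
Qed.

Lemma fmult_bcst s c : fmult s (bcst c) = bcst (s 0 * c).
Proof.
apply/bpolyP => n j; rewrite coef_fmult !coef_bcst.
by case: n => [|n] //=; case: j => [|j] //=; rewrite ?freq00 ?mulr0n ?mulr0.
Qed.

Lemma fmult_bcstM s c a : fmult s (bcst c * a) = bcst c * fmult s a.
Proof. by apply/bpolyP => n j; rewrite !(coef_fmult, coef_bcstM); ring. Qed.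

(** For |k| <= d this encodes eps exp(2 pi i k theta) as [mono 1 (d + k)], and
    eps^m as [mono m (d * m)]. *)
Definition mono (n j : nat) : bpoly := ('X^j)%:P * 'X^n.

Lemma coef_monoM n j a n' j' :
  (mono n j * a)`_n'`_j' = if (n <= n')%N && (j <= j')%N
    then a`_(n' - n)`_(j' - j) else 0.
Proof.
rewrite /mono -mulrA coefCM (coefXnM (R := {poly R[i]})) coefXnM.
by case: (ltnP n' n); case: (ltnP j' j) => //=; rewrite coef0.
Qed.

(** ** Weighted Wiener norms *)
(** The pairs of indices with sum less than n form a part of the square
    of side n. *)
Lemma sum_conv_le (f g h : nat -> R) n :
  (forall i, 0 <= f i) -> (forall i, 0 <= g i) ->
  (forall k, h k <= \sum_(i < k.+1) f i * g (k - i)%N) ->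
  \sum_(k < n) h k <= (\sum_(i < n) f i) * (\sum_(j < n) g j).
Proof.
move=> f0 g0 hle.
pose F k i := if (i <= k)%N then f i * g (k - i)%N else 0.
have F0 k i : 0 <= F k i by rewrite /F; case: ifP => // _; rewrite mulr_ge0.
have -> : (\sum_(i < n) f i) * (\sum_(j < n) g j) =
    \sum_(i < n) \sum_(j < n) f i * g j.
  by rewrite mulr_suml; apply: eq_bigr => i _; rewrite mulr_sumr.
apply: (@le_trans _ _ (\sum_(k < n) \sum_(i < n) F k i)).
  apply: ler_sum => k _; apply: le_trans (hle k) _.
  rewrite [leRHS](bigID (fun i : 'I_n => (i < k.+1)%N)) /= ler_wpDr //.
    by apply: sumr_ge0 => i _; exact: F0.
  rewrite (big_ord_widen _ (fun i => f i * g (k - i)%N) (ltn_ord k)).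
  by apply: ler_sum => i ik; rewrite /F -ltnS ik.
rewrite exchange_big; apply: ler_sum => i _ /=.
rewrite (bigID (fun k : 'I_n => (i <= k)%N)) /= [X in _ + X]big1 ?addr0; last first.
  by move=> k /negbTE ki; rewrite /F ki.
have -> : \sum_(k < n | (i <= k)%N) F k i = \sum_(i <= k < n) F k i.
  rewrite big_nat_cond [RHS]big_mkcond /= -big_mkcond.
  by rewrite -(big_mkord (fun k => (i <= k)%N) (fun k => F k i)) big_nat_cond;
    rewrite [RHS](big_nat_widenl _ 0) //; apply: eq_bigl => k; lia.
rewrite -{1}(add0n i) big_addn.
have -> : \sum_(0 <= k < n - i) F (k + i)%N i = \sum_(0 <= j < n - i) f i * g j.
  by apply: eq_bigr => k _; rewrite /F leq_addl addnK.
rewrite big_mkord (big_ord_widen n (fun j => f i * g j)) ?leq_subr //.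
by rewrite [leRHS](bigID (fun j : 'I_n => (j < n - i)%N)) /= ler_wpDr //
  sumr_ge0 // => j _; rewrite mulr_ge0.
Qed.

(** The Wiener norm, which is submultiplicative and on which multipliers with
    bounded symbols act by bounded operators. *)
Definition pnrm (p : {poly R[i]}) : R := \sum_(j < size p) normc p`_j.

Lemma pnrmE (p : {poly R[i]}) k : (size p <= k)%N ->
  \sum_(j < k) normc p`_j = pnrm p.
Proof.
move=> pk; rewrite /pnrm (big_ord_widen k (fun j => normc p`_j) pk).
rewrite [RHS]big_mkcond; apply: eq_bigr => j _; case: ltnP => // pj.
by rewrite nth_default ?normc0.
Qed.

Lemma pnrm_sum_le (p : {poly R[i]}) k : \sum_(j < k) normc p`_j <= pnrm p.
Proof.
rewrite -(pnrmE (leq_maxr k _)).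
rewrite (big_ord_widen (maxn k (size p)) (fun j => normc p`_j)) ?leq_maxl //.
rewrite [leRHS](bigID (fun j : 'I_(maxn k (size p)) => (j < k)%N)) /= ler_wpDr //.
by rewrite sumr_ge0 // => j _; exact: normc_ge0.
Qed.

Lemma pnrm_ge0 (p : {poly R[i]}) : 0 <= pnrm p.
Proof. by rewrite sumr_ge0 // => j _; exact: normc_ge0. Qed.

Lemma normc_coef_le (p : {poly R[i]}) j : normc p`_j <= pnrm p.
Proof.
apply: le_trans (pnrm_sum_le p j.+1).
by rewrite big_ord_recr /= ler_wpDl // sumr_ge0 // => i _; exact: normc_ge0.
Qed.

Lemma le_pnrm (B : R) (p q : {poly R[i]}) :
  (forall j, normc p`_j <= B * normc q`_j) -> pnrm p <= B * pnrm q.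
Proof.
move=> pq; set k := maxn (size p) (size q).
rewrite -(pnrmE (leq_maxl _ _ : (_ <= k)%N)) -(pnrmE (leq_maxr _ _ : (_ <= k)%N)).
by rewrite mulr_sumr; apply: ler_sum.
Qed.

Lemma pnrmD (p q : {poly R[i]}) : pnrm (p + q) <= pnrm p + pnrm q.
Proof.
set k := maxn (size p) (size q).
rewrite -(pnrmE (leq_maxl _ _ : (_ <= k)%N)) -(pnrmE (leq_maxr _ _ : (_ <= k)%N)).
rewrite -(pnrmE (size_polyD p q)) -big_split /=.
by apply: ler_sum => j _; rewrite coefD le_normcD.
Qed.

Lemma pnrmM (p q : {poly R[i]}) : pnrm (p * q) <= pnrm p * pnrm q.
Proof.
set k := size (p * q).
apply: (@le_trans _ _ ((\sum_(j < k) normc p`_j) * (\sum_(j < k) normc q`_j))).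
  apply: (@sum_conv_le (fun i => normc p`_i) (fun i => normc q`_i)
    (fun i => normc (p * q)`_i)) => [i|i|m]; rewrite ?normc_ge0 //.
  rewrite coefM (le_trans (normc_sum _ _ _)) //.
  by apply: ler_sum => i _; rewrite normcM.
by rewrite ler_pM ?pnrm_sum_le // sumr_ge0 // => j _; exact: normc_ge0.
Qed.

Lemma pnrm0 : pnrm 0 = 0.
Proof. by rewrite /pnrm size_poly0 big_ord0. Qed.

Lemma pnrm_sum (I : Type) (l : seq I) (P : pred I) (F : I -> {poly R[i]}) :
  pnrm (\sum_(i <- l | P i) F i) <= \sum_(i <- l | P i) pnrm (F i).
Proof.
elim/big_rec2: _ => [|i x y _ le_xy]; first by rewrite pnrm0.
by rewrite (le_trans (pnrmD _ _)) // lerD2l.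
Qed.

(** Only the orders less than M are counted: the small divisors are under control
    at these orders only, and congruences modulo eps^M become equalities of
    norms. *)
Definition nrm r M a : R := \sum_(n < M) pnrm a`_n * r ^+ n.

Lemma nrm_ge0 r M a : 0 <= r -> 0 <= nrm r M a.
Proof.
by move=> r0; rewrite sumr_ge0 // => n _; rewrite mulr_ge0 ?pnrm_ge0 ?exprn_ge0.
Qed.

Lemma nrmD r M a b : 0 <= r -> nrm r M (a + b) <= nrm r M a + nrm r M b.
Proof.
move=> r0; rewrite -big_split; apply: ler_sum => n _ /=.
by rewrite coefD -mulrDl ler_wpM2r ?exprn_ge0 ?pnrmD.
Qed.

Lemma nrm_leM (B : R) r M a b : 0 <= r ->
  (forall n j, (n < M)%N -> normc a`_n`_j <= B * normc b`_n`_j) ->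
  nrm r M a <= B * nrm r M b.
Proof.
move=> r0 ab; rewrite mulr_sumr; apply: ler_sum => n _ /=.
by rewrite mulrA ler_wpM2r ?exprn_ge0 // le_pnrm // => j; exact: ab.
Qed.

Lemma nrm_fmult (B : R) r M s a : 0 <= r ->
  (forall n j, (n < M)%N -> a`_n`_j != 0 -> normc (s (freq n j)) <= B) ->
  nrm r M (fmult s a) <= B * nrm r M a.
Proof.
move=> r0 sB; apply: nrm_leM => // n j nM; rewrite coef_fmult normcM.
have [->|aN0] := eqVneq a`_n`_j 0; first by rewrite normc0 !mulr0.
by rewrite ler_wpM2r ?normc_ge0 ?sB.
Qed.

Lemma nrm_fmult1 r M s a : 0 <= r -> (forall k, normc (s k) <= 1) ->
  nrm r M (fmult s a) <= nrm r M a.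
Proof. by move=> r0 s1; rewrite -[leRHS]mul1r nrm_fmult. Qed.

Lemma nrm_avg r M a : 0 <= r -> nrm r M (avg a) <= nrm r M a.
Proof.
by move=> r0; apply: nrm_fmult1 => // k; case: eqP => _; rewrite ?normc1 ?normc0.
Qed.

Lemma nrm_osc r M a : 0 <= r -> nrm r M (osc a) <= nrm r M a.
Proof.
by move=> r0; apply: nrm_fmult1 => // k; case: eqP => _; rewrite ?normc1 ?normc0.
Qed.

Lemma eq_nrm r M a b : vanishes M (a - b) -> nrm r M a = nrm r M b.
Proof.
move=> ab; apply: eq_bigr => n _; congr (pnrm _ * _).
by apply/eqP; rewrite -subr_eq0 -coefB ab.
Qed.

Lemma nrmN r M a : nrm r M (- a) = nrm r M a.
Proof.
apply: eq_bigr => n _; rewrite coefN /pnrm size_polyN; congr (_ * _).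
by apply: eq_bigr => j _; rewrite coefN normcN.
Qed.

Lemma nrmB r M a b : 0 <= r -> nrm r M (a - b) <= nrm r M a + nrm r M b.
Proof. by move=> r0; rewrite -(nrmN r M b) nrmD. Qed.

Lemma nrm0 r M : nrm r M 0 = 0.
Proof. by rewrite /nrm big1 // => n _; rewrite coef0 pnrm0 mul0r. Qed.

Lemma nrm_sum r M (I : Type) (l : seq I) (P : pred I) (F : I -> bpoly) : 0 <= r ->
  nrm r M (\sum_(i <- l | P i) F i) <= \sum_(i <- l | P i) nrm r M (F i).
Proof.
move=> r0; elim/big_rec2: _ => [|i x y _ le_xy]; first by rewrite nrm0.
by rewrite (le_trans (nrmD _ _ _ r0)) // lerD2l.
Qed.

(** The low orders of a product only involve the low orders of the factors. *)
Lemma nrmM r M a b : 0 <= r -> nrm r M (a * b) <= nrm r M a * nrm r M b.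
Proof.
move=> r0; apply: (@sum_conv_le (fun i => pnrm a`_i * r ^+ i)
  (fun i => pnrm b`_i * r ^+ i) (fun i => pnrm (a * b)`_i * r ^+ i)) => [i|i|k].
- by rewrite mulr_ge0 ?pnrm_ge0 ?exprn_ge0.
- by rewrite mulr_ge0 ?pnrm_ge0 ?exprn_ge0.
rewrite coefM (le_trans (ler_wpM2r _ (pnrm_sum _ _ _))) ?exprn_ge0 //.
rewrite mulr_suml; apply: ler_sum => i _.
by rewrite mulrACA -exprD subnKC ?leq_ord // ler_wpM2r ?exprn_ge0 ?pnrmM.
Qed.

Lemma nrm_coef r M a n : 0 <= r -> (n < M)%N -> pnrm a`_n * r ^+ n <= nrm r M a.
Proof.
move=> r0 nM; rewrite /nrm (bigD1 (Ordinal nM)) //= ler_wpDr // sumr_ge0 // => i _.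
by rewrite mulr_ge0 ?pnrm_ge0 ?exprn_ge0.
Qed.

Lemma nrmWr r r' M a : 0 <= r -> r <= r' -> nrm r M a <= nrm r' M a.
Proof.
move=> r0 rr'; apply: ler_sum => n _; rewrite ler_wpM2l ?pnrm_ge0 //.
by rewrite lerXn2r ?nnegrE // (le_trans r0).
Qed.

Lemma nrmWM r M M' a : 0 <= r -> (M <= M')%N -> nrm r M a <= nrm r M' a.
Proof.
move=> r0 MM'; rewrite /nrm (big_ord_widen M' (fun n => pnrm a`_n * r ^+ n)) //.
rewrite [leRHS](bigID (fun j : 'I_M' => (j < M)%N)) /= ler_wpDr //.
by rewrite sumr_ge0 // => j _; rewrite mulr_ge0 ?pnrm_ge0 ?exprn_ge0.
Qed.

(** A term of order n gains x^n when the radius is multiplied by x. This gain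
    is what pays for the small divisors. *)
Lemma nrm_shrink (x r : R) M L a : 0 <= x <= 1 -> 0 <= r -> vanishes L a ->
  nrm (x * r) M a <= x ^+ L * nrm r M a.
Proof.
move=> /andP[x0 x1] r0 a0; rewrite mulr_sumr; apply: ler_sum => n _.
case: (ltnP n L) => [nL|Ln]; first by rewrite a0 // pnrm0 !(mul0r, mulr0).
rewrite exprMn mulrCA ler_wpM2r ?mulr_ge0 ?pnrm_ge0 ?exprn_ge0 //.
by rewrite -(subnKC Ln) exprD ler_piMr ?exprn_ge0 ?exprn_ile1.
Qed.

Lemma pnrmC c : pnrm c%:P = normc c.
Proof.
rewrite -(pnrmE (size_polyC_leq1 c)) big_ord1.
by rewrite coefC.
Qed.

Lemma nrm_bcst r M c : 0 <= r -> nrm r M (bcst c) <= normc c.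
Proof.
move=> r0; have -> : normc c = nrm r 1 (bcst c).
  by rewrite /nrm big_ord1 coefC pnrmC expr0 mulr1.
have -> : nrm r M (bcst c) = \sum_(n < M | (n < 1)%N) pnrm (bcst c)`_n * r ^+ n.
  rewrite /nrm [LHS](bigID (fun n : 'I_M => (n < 1)%N)) /= [X in _ + X]big1 ?addr0 //.
  move=> [[|n] nM] //= _; by rewrite coefC /= pnrm0 mul0r.
case: M => [|M]; first by rewrite big_ord0 nrm_ge0.
by rewrite /nrm -(big_ord_widen M.+1 (fun n => pnrm (bcst c)`_n * r ^+ n)).
Qed.

Lemma nrm1 r M : 0 <= r -> nrm r M 1 <= 1.
Proof. by move=> r0; rewrite (le_trans (nrm_bcst _ 1 r0)) // normc1. Qed.

Lemma nrm_bcstM r M c a : 0 <= r -> nrm r M (bcst c * a) <= normc c * nrm r M a.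
Proof.
by move=> r0; apply: nrm_leM => // n j _; rewrite coef_bcstM normcM.
Qed.

Lemma nrmX r M a n : 0 <= r -> nrm r M (a ^+ n) <= nrm r M a ^+ n.
Proof.
move=> r0; elim: n => [|n IH]; first by rewrite !expr0 nrm1.
by rewrite !exprS (le_trans (nrmM _ _ _ r0)) // ler_wpM2l ?nrm_ge0.
Qed.

Lemma nrm_monoM r M n j a : 0 <= r -> nrm r M (mono n j * a) <= r ^+ n * nrm r M a.
Proof.
move=> r0; apply: (@le_trans _ _ (nrm r M (mono n j) * nrm r M a)).
  exact: nrmM.
rewrite ler_wpM2r ?nrm_ge0 //.
have X1 : pnrm 'X^j = 1.
  rewrite /pnrm size_polyXn big_ord_recr /= coefXn eqxx normc1 big1 ?add0r // => i _.
  by rewrite coefXn ltn_eqF // normc0.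
have E k : (mono n j)`_k = if k == n then 'X^j else 0.
  by rewrite /mono coefCM coefXn; case: eqP => _; rewrite ?mulr1 ?mulr0.
case: (ltnP n M) => nM; last first.
  rewrite /nrm big1 ?exprn_ge0 // => i _; rewrite E ltn_eqF ?pnrm0 ?mul0r //.
  exact: leq_trans (ltn_ord i) nM.
rewrite /nrm (bigD1 (Ordinal nM)) //= big1 ?addr0 => [|i iN].
  by rewrite E eqxx X1 mul1r.
by rewrite E -[_ == n]/(i == Ordinal nM) (negbTE iN) pnrm0 mul0r.
Qed.

Lemma vanishes_mono n j a M : vanishes M a -> vanishes (n + M) (mono n j * a).
Proof.
move=> a0 k kn; apply/polyP => i; rewrite coef_monoM coef0.
by case: ifP => // /andP[nk _]; rewrite a0 ?coef0 // ltn_subLR.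
Qed.

Lemma cone_mono n j a : (j <= 2 * d * n)%N -> cone a -> cone (mono n j * a).
Proof.
move=> jn a0 k i ki; rewrite coef_monoM; case: ifP => // /andP[nk ji].
by rewrite a0 // mulnBr; have := leq_mul (leqnn (2 * d)) nk; move: jn ki;
  move: (2 * d * n)%N (2 * d * k)%N => x y; lia.
Qed.

(** A monomial carries a single frequency. *)
Lemma fmult_mono s n j : fmult s (mono n j) = bcst (s (freq n j)) * mono n j.
Proof.
apply/bpolyP => k i; rewrite coef_fmult coef_bcstM.
rewrite -(mulr1 (mono n j)) coef_monoM.
case: ifP => [|_]; last by rewrite !mulr0.
case/andP=> nk ji; have -> : (1 : bpoly)`_(k - n)`_(i - j) =
    1 *+ ((k - n == 0) && (i - j == 0))%N by exact: (coef_bcst 1).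
case: (posnP (k - n)) => [|kn]; last by rewrite !mulr0.
case: (posnP (i - j)) => [|ij]; last by rewrite andbF !mulr0.
move=> ij kn; have -> : i = j by lia.
by have -> : k = n by lia.
Qed.

End Bigraded.

(** * The characters of the circle *)

Section ComplexExponential.
Context {R : realType}.
Implicit Types (z w : R[i]) (k l : int).

Lemma cexpD z w : cexp (z + w) = cexp z * cexp w.
Proof.
case: z w => [a b] [c e]; rewrite /cexp /= expRD cosD sinD.
by apply/eqP; rewrite eq_complex /=; apply/andP; split; apply/eqP; ring.
Qed.

Lemma cexp0 : cexp 0 = 1 :> R[i].
Proof. by rewrite /cexp /= expR0 cos0 sin0; apply/eqP; rewrite eq_complex /= !mul1r !mul0r subr0 addr0 !eqxx. Qed.

Lemma normc_cexp z : normc (cexp z) = expR (Re z).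
Proof.
case: z => a b; rewrite /cexp normcM /= expr0n addr0 sqrtr_sqr cos2Dsin2 sqrtr1.
by rewrite mulr1 ger0_norm ?expR_ge0.
Qed.

Definition wavenumber k : R[i] := 0 +i* (2 * pi * k%:~R).

Lemma fourierE k z : fourier k z = cexp (wavenumber k * z).
Proof. by []. Qed.

Lemma wavenumberD k l : wavenumber (k + l) = wavenumber k + wavenumber l.
Proof.
by apply/eqP; rewrite eq_complex /= addr0 intrD mulrDr !eqxx.
Qed.

Lemma wavenumber0 : wavenumber 0 = 0.
Proof. by apply/eqP; rewrite eq_complex /= mulr0 !eqxx. Qed.

Lemma wavenumberN k : wavenumber (- k) = - wavenumber k.
Proof.
by apply/eqP; rewrite -subr_eq0 opprK -wavenumberD addNr wavenumber0.
Qed.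

Lemma fourierDl k l z : fourier (k + l) z = fourier k z * fourier l z.
Proof. by rewrite !fourierE wavenumberD mulrDl cexpD. Qed.

Lemma fourier0 z : fourier 0 z = 1.
Proof. by rewrite fourierE wavenumber0 mul0r cexp0. Qed.

Lemma fourierDr k z w : fourier k (z + w) = fourier k z * fourier k w.
Proof. by rewrite !fourierE mulrDr cexpD. Qed.

Lemma fourierN k z : fourier (- k) z * fourier k z = 1.
Proof. by rewrite -fourierDl addNr fourier0. Qed.

Lemma fourier_oppr k z : fourier k (- z) = fourier (- k) z.
Proof. by rewrite !fourierE wavenumberN mulNr mulrN. Qed.

Lemma normc_fourier k z : normc (fourier k z) = expR (- (2 * pi * k%:~R * Im z)).
Proof. by rewrite fourierE normc_cexp; case: z => a b /=; rewrite mul0r sub0r. Qed.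

Lemma normc_fourier_real k (x : R) : normc (fourier k x%:C) = 1.
Proof. by rewrite normc_fourier /= mulr0 oppr0 expR0. Qed.

Lemma normc_wavenumber k : normc (wavenumber k) = 2 * pi * (`|k|%N%:R : R).
Proof.
rewrite /= expr0n add0r sqrtr_sqr !normrM ger0_norm // ger0_norm ?pi_ge0 //.
by rewrite -intr_norm -abszE.
Qed.

End ComplexExponential.

(** * The invariance equation and its linearisation *)

Section Operators.
Context {R : realType} (d alpha : nat) (omega : R) (s : seq (int * R[i])).
Local Notation bpoly := {poly {poly R[i]}}.
Implicit Types (a b u v x y : bpoly) (r : R) (c : R[i]).

Hypothesis s_le_d : all (fun p => (`|p.1| <= d)%N) s.

Definition advance := fmult d (fun k => fourier k omega%:C).
Definition retreat := fmult d (fun k => fourier (- k) omega%:C).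
Definition dtheta := fmult d (@wavenumber R).

Lemma advanceM a b : advance (a * b) = advance a * advance b.
Proof. by apply: fmultM => k l; rewrite fourierDl. Qed.

Lemma retreatM a b : retreat (a * b) = retreat a * retreat b.
Proof. by apply: fmultM => k l; rewrite opprD fourierDl. Qed.

Lemma advanceK a : advance (retreat a) = a.
Proof.
rewrite /advance /retreat fmult_comp -[RHS](fmult_id d); apply: eq_fmult => k.
by rewrite mulrC fourierN.
Qed.

Lemma dthetaM a b : dtheta (a * b) = dtheta a * b + a * dtheta b.
Proof. by apply: fmult_leibniz => k l; rewrite wavenumberD. Qed.

Lemma fmultC t1 t2 a : fmult d t1 (fmult d t2 a) = fmult d t2 (fmult d t1 a).
Proof. by rewrite !fmult_comp; apply: eq_fmult => k; rewrite mulrC. Qed.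

Definition epspow : bpoly := mono alpha (d * alpha).
Definition lam : bpoly := 1 - epspow.

Lemma lamE : lam = 1 - epspow. Proof. by []. Qed.

Lemma freq_epspow : freq d alpha (d * alpha) = 0.
Proof. by rewrite /freq subrr. Qed.

Lemma fmult_epspow t : t 0 = 1 -> fmult d t epspow = epspow.
Proof.
by move=> t0; rewrite /epspow fmult_mono freq_epspow t0 /bcst !polyC1 mul1r.
Qed.

Lemma fmult_one t : t 0 = 1 -> fmult d t 1 = 1 :> bpoly.
Proof.
by move=> t0; rewrite -[1 in LHS]/(bcst 1) fmult_bcst t0 mulr1 /bcst !polyC1.
Qed.

Lemma avg_epspow : avg d epspow = epspow.
Proof. exact: fmult_epspow. Qed.

Lemma avg1 : avg d 1 = 1 :> bpoly.
Proof. exact: fmult_one. Qed.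

Lemma avg_lam : avg d lam = lam.
Proof. by rewrite /lam /avg fmultB -/(avg d) avg_epspow avg1. Qed.

Lemma advance_avg a : advance (avg d a) = avg d a.
Proof. by apply: fmult_avg; exact: fourier0. Qed.

Lemma retreat_avg a : retreat (avg d a) = avg d a.
Proof. by apply: fmult_avg; rewrite oppr0; exact: fourier0. Qed.

Lemma avg_advance a : avg d (advance a) = avg d a.
Proof. by apply: avg_fmult; exact: fourier0. Qed.

Lemma avg_retreat a : avg d (retreat a) = avg d a.
Proof. by apply: avg_fmult; rewrite oppr0; exact: fourier0. Qed.

Lemma avg_dtheta a : avg d (dtheta a) = 0.
Proof. by apply: avg_fmult0; exact: wavenumber0. Qed.

Lemma dtheta_avg a : dtheta (avg d a) = 0.
Proof. by apply: fmult0_avg; exact: wavenumber0. Qed.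

Lemma advance1 : advance 1 = 1 :> bpoly.
Proof. by rewrite -avg1 advance_avg. Qed.

Lemma retreat1 : retreat 1 = 1 :> bpoly.
Proof. by rewrite -avg1 retreat_avg. Qed.

Lemma dtheta_lamM a : dtheta (lam * a) = lam * dtheta a.
Proof. by rewrite dthetaM -{1}avg_lam dtheta_avg mul0r add0r. Qed.

Lemma cone_epspow : cone d epspow.
Proof.
rewrite -[epspow]mulr1; apply: cone_mono; last exact: cone1.
by rewrite -mulnA leq_pmull.
Qed.

Lemma cone_lam : cone d lam.
Proof. by apply: coneB; [exact: cone1 | exact: cone_epspow]. Qed.

(** A truncated exponential keeps all objects polynomial; on a series without
    constant term it is exact modulo eps^m. *)
Definition texp (m : nat) (c : R[i]) u : bpoly :=
  \sum_(i < m) bcst (c ^+ i / (i`!)%:R) * u ^+ i.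

Lemma taylor1_pow u v i : exists q,
  (u + v) ^+ i.+1 = u ^+ i.+1 + bcst i.+1%:R * u ^+ i * v + v ^+ 2 * q.
Proof.
elim: i => [|i [q IH]].
  by exists 0; rewrite /bcst !polyC1 !expr1 expr0; ring.
exists (bcst i.+1%:R * u ^+ i + (u + v) * q).
rewrite exprS IH [in RHS]exprS (exprS u i).
have -> : bcst i.+2%:R = bcst i.+1%:R + 1 :> bpoly.
  by rewrite -[i.+2]addn1 natrD /bcst !polyCD !polyC1.
ring.
Qed.

Lemma texp_coef c i :
  c * (c ^+ i / (i`!)%:R) = c ^+ i.+1 / (i.+1`!)%:R * i.+1%:R.
Proof.
have h1 : (i.+1%:R : R[i]) != 0 by rewrite pnatr_eq0.
have h2 : ((i`!)%:R : R[i]) != 0 by rewrite pnatr_eq0 -lt0n fact_gt0.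
by rewrite factS natrM exprS; field; rewrite h2 nat1r h1.
Qed.

(** The remainder is quadratic in v, hence of order 2 M. *)
Lemma texp_taylor M m c u v : vanishes M v ->
  vanishes (M + M) (texp m.+1 c (u + v) - texp m.+1 c u - bcst c * texp m c u * v).
Proof.
move=> v0.
have -> : texp m.+1 c (u + v) - texp m.+1 c u - bcst c * texp m c u * v =
  \sum_(i < m) bcst (c ^+ i.+1 / (i.+1`!)%:R) *
     ((u + v) ^+ i.+1 - u ^+ i.+1 - bcst i.+1%:R * u ^+ i * v).
  rewrite /texp !big_ord_recl /= !expr0 !mulr1.
  set A := bcst _; set B := \sum__ _; set D := \sum__ _.
  rewrite (_ : A + B - _ = B - D); last by ring.
  rewrite {}/B {}/D.
  rewrite mulr_sumr mulr_suml -!sumrB; apply: eq_bigr => i _.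
  have -> : bcst c * (bcst (c ^+ i / (i`!)%:R) * u ^+ i) * v =
    bcst (c ^+ i.+1 / (i.+1`!)%:R) * (bcst i.+1%:R * u ^+ i * v).
    rewrite !mulrA; congr (_ * _ * _); rewrite /bcst -!polyCM; congr (_%:P%:P).
    exact: texp_coef.
  by rewrite /bump leq0n add1n; ring.
apply: vanishes_sum => i _; have [q ->] := taylor1_pow u v i.
rewrite [X in bcst _ * X](_ : _ = v ^+ 2 * q); last by ring.
by apply: vanishesMl; apply: vanishesMr; rewrite expr2; exact: vanishesM.
Qed.

Lemma dtheta_texp m c u :
  dtheta (texp m.+1 c u) = bcst c * texp m c u * dtheta u.
Proof.
have dX i : dtheta (u ^+ i.+1) = bcst i.+1%:R * u ^+ i * dtheta u.
  elim: i => [|i IH]; first by rewrite expr1 expr0 /bcst !polyC1 !mul1r.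
  rewrite exprS dthetaM IH.
  have -> : bcst i.+2%:R = bcst i.+1%:R + 1 :> bpoly.
    by rewrite -[i.+2]addn1 natrD /bcst !polyCD !polyC1.
  by rewrite (exprS u i); ring.
have d1 : dtheta 1 = 0 by rewrite -avg1 dtheta_avg.
rewrite /texp big_ord_recl expr0 mulr1 /dtheta fmultD fmult_sum.
rewrite fmult_bcst wavenumber0 mul0r {1}/bcst !raddf0 add0r mulr_sumr mulr_suml.
apply: eq_bigr => i _; rewrite fmult_bcstM -/dtheta dX.
rewrite /= -[bump 0 i]/(i.+1) !mulrA; congr (_ * _ * _).
rewrite /bcst -!polyCM; congr (_%:P%:P).
exact/esym/texp_coef.
Qed.

Lemma texp_cong M m c u v : vanishes M (u - v) ->
  vanishes M (texp m c u - texp m c v).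
Proof.
move=> uv; rewrite /texp -sumrB; apply: vanishes_sum => i _.
rewrite -mulrBr subrXX; apply: vanishesMl; exact: vanishesMr.
Qed.

Lemma texp_trunc m m' c u : (m <= m')%N -> vanishes 1 u ->
  vanishes m (texp m' c u - texp m c u).
Proof.
move=> mm' u0; rewrite /texp -(subnKC mm') big_split_ord /= addrAC subrr add0r.
apply: vanishes_sum => i _; apply: vanishesMl.
apply: (@vanishesW _ _ (1 * rshift m i)) => /=; last exact: vanishesX.
by rewrite mul1n leq_addr.
Qed.

Lemma cone_texp m c u : cone d u -> cone d (texp m c u).
Proof.
move=> u0; apply: cone_sum => i _; apply: coneM; first exact: cone_bcst.
exact: coneX.
Qed.

Lemma normc_nat n : normc (n%:R : R[i]) = n%:R.
Proof.
by rewrite -(rmorph_nat (real_complex R)) /= expr0n addr0 sqrtr_sqr ger0_norm.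
Qed.

Lemma sum_exp_le (x : R) m : 0 <= x -> \sum_(i < m) x ^+ i / (i`!)%:R <= expR x.
Proof.
move=> x0; have -> : \sum_(i < m) x ^+ i / (i`!)%:R = series (exp_coeff x) m.
  by rewrite /series /= big_mkord; apply: eq_bigr => i _; rewrite exp_coeffE mulrC.
apply: nondecreasing_cvgn_le; last exact: is_cvg_series_exp_coeff.
by apply/nondecreasing_series => i _ _; rewrite /exp_coeff /= divr_ge0 ?exprn_ge0.
Qed.

Lemma nrm_texp r M m c u : 0 <= r -> nrm r M u <= 1 ->
  nrm r M (texp m c u) <= expR (normc c).
Proof.
move=> r0 u1; apply: le_trans (nrm_sum _ _ _ _ r0) _.
apply: le_trans (sum_exp_le m (normc_ge0 c)).
apply: ler_sum => i _; apply: le_trans (nrm_bcstM _ _ _ r0) _.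
rewrite normcM normcX normcV normc_nat -[leRHS]mulr1 ler_wpM2l //.
  by rewrite divr_ge0 ?exprn_ge0 ?normc_ge0.
by rewrite (le_trans (nrmX _ _ _ r0)) // exprn_ile1 ?nrm_ge0.
Qed.

(** The series eps V^(j)(theta + u), where each mode k of V contributes a multiple
    of eps exp(2 pi i k theta) exp(2 pi i k u). *)
Definition forcing (j m : nat) u : bpoly :=
  \sum_(p <- s) mono 1 (absz (d%:Z + p.1)) *
    (bcst (p.2 * wavenumber p.1 ^+ j) * texp m (wavenumber p.1) u).

Definition forcing_bound (j : nat) : R :=
  \sum_(p <- s) normc (p.2 * wavenumber p.1 ^+ j) * expR (normc (wavenumber p.1 : R[i])).

Lemma freq_forcing p : p \in s -> freq d 1 (absz (d%:Z + p.1)) = p.1.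
Proof. by move=> ps; have := allP s_le_d p ps; rewrite /freq /=; lia. Qed.

Lemma le_forcing p : p \in s -> (absz (d%:Z + p.1)%R <= 2 * d * 1)%N.
Proof. by move=> ps; have := allP s_le_d p ps => /=; lia. Qed.

Lemma cone_forcing j m u : cone d u -> cone d (forcing j m u).
Proof.
move=> u0; rewrite /forcing big_seq; apply: cone_sum => p ps.
apply: cone_mono; first exact: le_forcing.
by apply: coneM; [exact: cone_bcst | exact: cone_texp].
Qed.

Lemma forcing_taylor M m u v : vanishes M v ->
  vanishes (M + M) (forcing 1 m.+1 (u + v) - forcing 1 m.+1 u - forcing 2 m u * v).
Proof.
move=> v0; rewrite /forcing mulr_suml -!sumrB; apply: vanishes_sum => p _.
set X := mono _ _.
rewrite (_ : _ - _ = X * (bcst (p.2 * wavenumber p.1) *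
  (texp m.+1 (wavenumber p.1) (u + v) - texp m.+1 (wavenumber p.1) u
   - bcst (wavenumber p.1) * texp m (wavenumber p.1) u * v))); last first.
  have -> : bcst (p.2 * wavenumber p.1 ^+ 2) =
      bcst (p.2 * wavenumber p.1) * bcst (wavenumber p.1) :> bpoly.
    by rewrite /bcst -!polyCM expr2 mulrA.
  by rewrite expr1; ring.
by apply: vanishesMl; apply: vanishesMl; exact: texp_taylor.
Qed.

(** The chain rule. The loss of one order of truncation comes from the
    derivative of the truncated exponential. *)
Lemma dtheta_forcing m u : vanishes 1 u ->
  vanishes m (dtheta (forcing 1 m.+1 u) - forcing 2 m u * (1 + dtheta u)).
Proof.
move=> u0; rewrite /forcing /dtheta fmult_sum -/dtheta mulr_suml -sumrB big_seq.
apply: vanishes_sum => p ps.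
set X := mono _ _; set K := wavenumber _.
have -> : bcst (p.2 * K ^+ 2) = bcst (p.2 * K) * bcst K :> bpoly.
  by rewrite /bcst -!polyCM expr2 mulrA.
have dX : dtheta X = bcst K * X by rewrite /dtheta fmult_mono freq_forcing.
rewrite -/dtheta dthetaM dX [dtheta (bcst _ * _)]fmult_bcstM -/dtheta.
rewrite dtheta_texp expr1.
rewrite (_ : _ - _ = X * (bcst (p.2 * K) * (bcst K *
   (texp m.+1 K u - texp m K u)))); last by ring.
by do 3!apply: vanishesMl; exact: texp_trunc.
Qed.

Lemma forcing_cong M j m u v : vanishes M (u - v) ->
  vanishes M.+1 (forcing j m u - forcing j m v).
Proof.
move=> uv; rewrite /forcing -sumrB; apply: vanishes_sum => p _.
rewrite -mulrBr -mulrBr -add1n; apply: vanishes_mono.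
by apply: vanishesMl; exact: texp_cong.
Qed.

Lemma forcing_trunc j m m' u : (m <= m')%N -> vanishes 1 u ->
  vanishes m.+1 (forcing j m' u - forcing j m u).
Proof.
move=> mm' u0; rewrite /forcing -sumrB; apply: vanishes_sum => p _.
rewrite -mulrBr -mulrBr -add1n; apply: vanishes_mono.
by apply: vanishesMl; exact: texp_trunc.
Qed.

Lemma nrm_forcing r M j m u : 0 <= r -> nrm r M u <= 1 ->
  nrm r M (forcing j m u) <= r * forcing_bound j.
Proof.
move=> r0 u1; apply: le_trans (nrm_sum _ _ _ _ r0) _.
rewrite mulr_sumr; apply: ler_sum => p _.
apply: le_trans (nrm_monoM _ _ _ _ r0) _; rewrite expr1 ler_wpM2l //.
apply: le_trans (nrm_bcstM _ _ _ r0) _.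
by rewrite ler_wpM2l ?normc_ge0 // nrm_texp.
Qed.

(** The left-hand side of the scalar invariance equation: with x = theta + u and
    y = x - x(. - omega), the second component of the invariance equation says that
    this is the constant mu. The term in omega is (1 - lam) omega. *)
Definition inveq (m : nat) u : bpoly :=
  advance u - (1 + lam) * u + lam * retreat u + bcst omega%:C * epspow + forcing 1 m u.

Lemma inveqE m u : inveq m u = advance u - (1 + lam) * u + lam * retreat u
  + bcst omega%:C * epspow + forcing 1 m u.
Proof. by []. Qed.

Lemma advanceD a b : advance (a + b) = advance a + advance b.
Proof. exact: fmultD. Qed.
Lemma advanceB a b : advance (a - b) = advance a - advance b.
Proof. exact: fmultB. Qed.
Lemma retreatD a b : retreat (a + b) = retreat a + retreat b.
Proof. exact: fmultD. Qed.
Lemma retreatB a b : retreat (a - b) = retreat a - retreat b.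
Proof. exact: fmultB. Qed.
Lemma avgD a b : avg d (a + b) = avg d a + avg d b.
Proof. exact: fmultD. Qed.
Lemma avgB a b : avg d (a - b) = avg d a - avg d b.
Proof. exact: fmultB. Qed.
Lemma dthetaD a b : dtheta (a + b) = dtheta a + dtheta b.
Proof. exact: fmultD. Qed.
Lemma dthetaB a b : dtheta (a - b) = dtheta a - dtheta b.
Proof. exact: fmultB. Qed.

Lemma cone_inveq m u : cone d u -> cone d (inveq m u).
Proof.
move=> u0; rewrite /inveq; apply: coneD; last exact: cone_forcing.
apply: coneD; last by apply: coneM; [exact: cone_bcst | exact: cone_epspow].
apply: coneD; last by apply: coneM; [exact: cone_lam | exact: cone_fmult].
apply: coneB; first exact: cone_fmult.
by apply: coneM => //; apply: coneD; [exact: cone1 | exact: cone_lam].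
Qed.

(** The linearisation of [inveq] at u, applied to v. *)
Definition dinveq (m : nat) u v : bpoly :=
  advance v - (1 + lam) * v + lam * retreat v + forcing 2 m u * v.

Lemma dinveqE m u v : dinveq m u v =
  advance v - (1 + lam) * v + lam * retreat v + forcing 2 m u * v.
Proof. by []. Qed.

(** The nonlinearity is only seen at order 2 M, so a block of orders from M to
    2 M - 1 satisfies a linear equation exactly. *)
Lemma inveq_taylor M m u v : vanishes M v ->
  vanishes (M + M) (inveq m.+1 (u + v) - inveq m.+1 u - dinveq m u v).
Proof.
move=> v0; have := forcing_taylor m u v0.
by congr (vanishes _ _); rewrite /inveq /dinveq advanceD retreatD; ring.
Qed.

(** Differentiating the equation in theta: 1 + d_theta u is in the kernel of
    the linearisation up to the derivative of the error. This tangent direction is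
    what reduces the second-order linear equation to first-order ones. *)
Lemma dtheta_inveq m u : vanishes 1 u ->
  vanishes m (dtheta (inveq m.+1 u) - dinveq m u (1 + dtheta u)).
Proof.
move=> u0; have := @dtheta_forcing m u u0; congr (vanishes _ _).
have dl2 : dtheta ((1 + lam) * u) = (1 + lam) * dtheta u.
  by rewrite (mulrDl 1 lam u) (mulrDl 1 lam) !mul1r dthetaD dtheta_lamM.
have dw : dtheta (bcst omega%:C * epspow) = 0.
  by rewrite /dtheta fmult_bcstM -/dtheta -avg_epspow dtheta_avg mulr0.
have dr : dtheta (advance u) = advance (dtheta u) by exact: fmultC.
have drV : dtheta (retreat u) = retreat (dtheta u) by exact: fmultC.
rewrite /inveq /dinveq 3!dthetaD dthetaB dl2 dtheta_lamM dw dr drV.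
by rewrite advanceD retreatD advance1 retreat1; ring.
Qed.

End Operators.

(** * Estimate of one block of orders *)

Section Block.
Context {R : realType} (d alpha : nat) (omega : R) (s : seq (int * R[i])).
Local Notation bpoly := {poly {poly R[i]}}.
Implicit Types (a b u v x y : bpoly) (r : R) (c : R[i]).

Hypothesis s_le_d : all (fun p => (`|p.1| <= d)%N) s.

Local Notation advance := (advance d omega).
Local Notation retreat := (retreat d omega).
Local Notation dtheta := (dtheta d).
Local Notation epspow := (@epspow R d alpha).
Local Notation lam := (@lam R d alpha).
Local Notation inveq := (inveq d alpha omega s).
Local Notation dinveq := (dinveq d alpha omega s).

(** At orders less than M, frequencies are at most d M, so that K bounds
    the inverses of the small divisors at these orders. *)
Definition divisor_bound (K : R) (M : nat) := forall k : int, k != 0 ->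
  (`|k| <= d * M)%N -> 1 <= K * normc (fourier k omega%:C - 1).

Lemma nrm_divisor r K M a : 0 <= r -> 0 <= K -> divisor_bound K M -> cone d a ->
  nrm r M (osc d a) <= K * nrm r M (advance a - a).
Proof.
move=> r0 K0 HK a0; apply: nrm_leM => // n j nM.
case: (ltnP (2 * d * n) j) => [nj|jn].
  by rewrite !coefB !coef_fmult a0 // !mulr0 subrr normc0 mulr0.
rewrite !coefB !coef_fmult -[X in _ * normc (_ - X)]mul1r -mulrBl !normcM.
case: eqP => [_|/eqP kN0].
  by rewrite normc0 mul0r mulr_ge0 ?mulr_ge0 ?normc_ge0.
rewrite normc1 mul1r mulrA ler_peMl ?normc_ge0 //; apply: HK => //.
exact: freq_bound (ltnW nM).
Qed.

(** The product of the constants of [block_arith]: 4 * 2 * 9 * 6. *)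
Definition block_cst : R := 432%:R.

Lemma block_cst_ge0 : 0 <= block_cst. Proof. exact: ler0n. Qed.

(** The linear system of inequalities solved in [block_estimate]. The terms
    that contain the dissipation carry a factor K ra <= 1/4, so they can be moved to
    the left: the oscillating part of the Wronskian is then at most 6 K e. *)
Lemma block_arith (K ra e Pt Pb sg wt v : R) :
  1 <= K -> K * ra <= 1 / 4 -> 0 <= ra -> 0 <= Pt -> 0 <= Pb -> 0 <= sg ->
  Pt <= K * (1 / 12 * sg + 13 / 12 * e + ra * Pt) ->
  sg <= ra * Pb + 13 / 12 * e ->
  Pb <= 8 * Pt ->
  wt <= K * (2 * (Pt + Pb)) ->
  v <= 4 * wt ->
  v <= block_cst * K ^+ 2 * e.
Proof.
move=> K1 Kra ra0 Pt0 Pb0 sg0 H1 H2 H3 H4 H5.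
have K0 : 0 <= K by lra.
have H2' : K * sg <= K * (ra * Pb + 13 / 12 * e) by rewrite ler_wpM2l.
have xPb : (K * ra) * Pb <= 1 / 4 * Pb by rewrite ler_wpM2r.
have xPt : (K * ra) * Pt <= 1 / 4 * Pt by rewrite ler_wpM2r.
have Pt6 : Pt <= 6 * (K * e) by lra.
have wt1 : wt <= K * (18 * Pt) by apply: le_trans H4 _; rewrite ler_wpM2l //; lra.
have wt2 : K * (18 * Pt) <= K * (108 * (K * e)) by rewrite ler_wpM2l //; lra.
by rewrite /block_cst expr2 -!mulrA; lra.
Qed.

Lemma dtheta_osc a : dtheta (osc d a) = dtheta a.
Proof. by rewrite [in RHS](avg_osc d a) dthetaD dtheta_avg add0r. Qed.

Lemma avg_scale b a : avg d b = b -> avg d (b * a) = b * avg d a.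
Proof. by move=> bb; rewrite -{1}bb avgMl bb. Qed.

Lemma avg_jacobian a : avg d (1 + dtheta a) = 1.
Proof. by rewrite avgD avg_dtheta addr0 avg1. Qed.

Lemma neumann_inverse L (h : bpoly) : vanishes 1 h ->
  vanishes L ((1 + h) * (\sum_(i < L) (- h) ^+ i) - 1).
Proof.
move=> h0; have -> : (1 + h) * (\sum_(i < L) (- h) ^+ i) - 1 = - (- h) ^+ L.
  have -> : 1 + h = - (- h - 1) by rewrite opprB opprK.
  by rewrite mulNr -subrX1 opprB addrAC subrr add0r.
by apply: vanishesN; rewrite -{1}(mul1n L); apply/vanishesX/vanishesN.
Qed.

(** Modulo eps^(2M), the block v solves the linearised equation
    dinveq u v = sg - e, where e is the oscillating part of the error of u and sg a
    change of its mean. On the other hand l = 1 + d_theta u solves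
    dinveq u l = d_theta e, and v d_theta e has order 2 M. So the Wronskian
    P = l(. - omega) v - v(. - omega) l solves the first-order equation
    P(. + omega) - lam P = l (sg - e), and w = v / l solves
    w - w(. - omega) = P / (l l(. - omega)). Each equation determines an oscillating
    part, at the cost of one small divisor. The mean of the first equation gives sg,
    the mean of the second one gives the mean of P, and the mean of v gives the mean
    of w. The error e enters linearly, and no smallness is asked of it. *)
Lemma block_estimate M m u v K r : (0 < M)%N -> (M + M <= m)%N ->
  vanishes 1 u -> cone d u -> cone d v -> vanishes M v -> avg d v = 0 ->
  vanishes M (osc d (inveq m.+1 u)) ->
  vanishes (M + M) (osc d (inveq m.+1 (u + v))) ->
  divisor_bound K (M + M) -> 1 <= K -> 0 <= r -> K * r ^+ alpha <= 1 / 4 ->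
  nrm r (M + M) (dtheta u) <= 1 / 12 ->
  nrm r (M + M) v <= block_cst * K ^+ 2 * nrm r (M + M) (osc d (inveq m.+1 u)).
Proof.
move=> M0 Lm u0 cu cv v0 av eM eL HK K1 r0 Kra h12.
have K0 : 0 <= K by lra.
set L := (M + M)%N in Lm eL HK h12 *; set n := nrm r L.
have n1 : n 1 <= 1 by exact: nrm1.
have n0 x : 0 <= n x by exact: nrm_ge0.
have nD x y : n (x + y) <= n x + n y by exact: nrmD.
have nB x y : n (x - y) <= n x + n y by exact: nrmB.
have nM x y : n (x * y) <= n x * n y by exact: nrmM.
have navg x : n (avg d x) <= n x by exact: nrm_avg.
have nosc x : n (osc d x) <= n x by exact: nrm_osc.
have nretreat x : n (retreat x) <= n x.
  by apply: nrm_fmult1 => // k; rewrite normc_fourier_real.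
have nadvance x : n (advance x) <= n x.
  by apply: nrm_fmult1 => // k; rewrite normc_fourier_real.
have neps x : n (epspow * x) <= r ^+ alpha * n x by exact: nrm_monoM.
have M_L : (M <= L)%N by exact: leq_addr.
set e := osc d (inveq m.+1 u) in eM *.
set h := dtheta u in h12 *; set l : bpoly := 1 + h.
have vh : vanishes 1 h by exact: vanishes_fmult.
have nl x : n (l * x) <= 13 / 12 * n x.
  apply: le_trans (nM _ _) _; rewrite ler_wpM2r //.
  by apply: le_trans (nD _ _) _; have : n h <= 1 / 12 by []; lra.
set sg := avg d (inveq m.+1 (u + v)) - avg d (inveq m.+1 u).
have asg : avg d sg = sg by rewrite /sg avgB !avg_avg.
have al : avg d l = 1 by exact: avg_jacobian.
have E1 : vanishes L (dinveq m u v - (sg - e)).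
  have T := inveq_taylor d alpha omega s m u v0.
  have := vanishesB eL T; congr (vanishes _ _).
  rewrite /sg /e; have := avg_osc d (inveq m.+1 (u + v)).
  have := avg_osc d (inveq m.+1 u).
  move: (inveq _ _) (inveq _ _) => F1 F0; move: (avg d F1) (osc d F1).
  by move: (avg d F0) (osc d F0) => a0 o0 a1 o1 -> ->; ring.
(* the tangent direction l solves the homogeneous equation up to terms of
order M, and v has order M *)
have E2 : vanishes L (v * dinveq m u l).
  apply: vanishesM => //.
  have D := @dtheta_inveq _ _ alpha omega _ s_le_d m u u0.
  rewrite -(subKr (dtheta (inveq m.+1 u)) (dinveq m u l)).
  apply: vanishesB; last by apply: vanishesW D; exact: leq_trans Lm.
  by rewrite -dtheta_osc; exact: vanishes_fmult.
set P := retreat l * v - retreat v * l.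
have rP : advance P = l * advance v - v * advance l by rewrite /P advanceB !advanceM !advanceK.
have E4 : vanishes L (advance P - lam * P - l * (sg - e)).
  have := vanishesB (vanishesMl l E1) E2; congr (vanishes _ _).
  by rewrite rP /P !dinveqE; ring.
(* the dissipation acts on the mean and on the oscillating part of P alike;
since l has mean 1, the mean of the equation determines sg *)
set Pb := avg d P; set Pt := osc d P.
have PE : P = Pb + Pt by exact: avg_osc.
have E5 : vanishes L (epspow * Pb - sg + avg d (l * e)).
  have := vanishes_fmult d (fun k => (k == 0)%:R) E4; congr (vanishes _ _).
  have a1 : avg d (lam * P) = lam * Pb by exact/avg_scale/avg_lam.
  have a2 : avg d (l * (sg - e)) = sg - avg d (l * e).
    by rewrite (mulrBr l sg e) avgB (mulrC l sg) (avg_scale l asg) al mulr1.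
  by rewrite -/(avg d _) !avgB avg_advance a1 a2 -/Pb lamE; ring.
have E6 : vanishes L (advance Pt - Pt - (h * sg - osc d (l * e) - epspow * Pt)).
  have := vanishesB E4 E5; congr (vanishes _ _).
  rewrite [in advance P]PE [in lam * P]PE advanceD advance_avg.
  rewrite (mulrBr l sg e); have := avg_osc d (l * e).
  move: (avg d (l * e)) (osc d (l * e)) => A O ->.
  by rewrite -/Pb /l lamE; ring.
have cl : cone d l by apply: coneD; [exact: cone1 | exact: cone_fmult].
have cP : cone d P by apply: coneB; apply: coneM => //; exact: cone_fmult.
have N1 : n Pt <= K * (1 / 12 * n sg + 13 / 12 * n e + r ^+ alpha * n Pt).
  have : n (osc d Pt) <= K * n (advance Pt - Pt) by apply: nrm_divisor => //; exact: cone_fmult.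
  have -> : osc d Pt = Pt by rewrite [RHS](avg_osc d) /Pt avg_oscE add0r.
  move=> H; apply: le_trans H _; rewrite ler_wpM2l ?(le_trans ler01) //.
  rewrite /n (eq_nrm r E6) -/n; apply: le_trans (nB _ _) _.
  rewrite lerD // (le_trans (nB _ _)) // lerD //.
    by apply: le_trans (nM _ _) _; rewrite ler_wpM2r.
  by apply: le_trans (nosc _) _.
have N2 : n sg <= r ^+ alpha * n Pb + 13 / 12 * n e.
  have E5' : vanishes L (sg - (epspow * Pb + avg d (l * e))).
    by have := vanishesN E5; congr (vanishes _ _); ring.
  rewrite /n (eq_nrm r E5') -/n; apply: le_trans (nD _ _) _.
  by rewrite lerD // (le_trans (navg _)).
set li : bpoly := \sum_(i < L) (- h) ^+ i.
have lli : vanishes L (l * li - 1) by exact: neumann_inverse.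
have nli1 : n (li - 1) <= 1 / 12 * n li.
  have E : vanishes L (li - 1 - (- (h * li))) by move: lli; congr (vanishes _ _); rewrite /l; ring.
  rewrite /n (eq_nrm r E) nrmN -/n; apply: le_trans (nM _ _) _; rewrite ler_wpM2r //.
have nli : n li <= 12 / 11.
  have := nD (li - 1) 1; rewrite subrK; lra.
set B := li * retreat li.
have nBB : n B <= 2.
  apply: le_trans (nM _ _) _; apply: (@le_trans _ _ (12 / 11 * (12 / 11))); last by lra.
  by apply: ler_pM => //; apply: le_trans nli.
have nB1 : n (B - 1) <= 1 / 2.
  have -> : B - 1 = (li - 1) * retreat li + retreat (li - 1) by rewrite /B retreatB retreat1; ring.
  apply: le_trans (nD _ _) _.
  have h1 : n ((li - 1) * retreat li) <= 1 / 11 * (12 / 11).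
    apply: le_trans (nM _ _) _; apply: ler_pM => //; first by lra.
    by apply: le_trans nli.
  by have h2 := nretreat (li - 1); lra.
set w := li * v.
have E7 : vanishes L (l * w - v).
  by have := vanishesMr v lli; congr (vanishes _ _); rewrite /w; ring.
have E8 : vanishes L (B * P - (w - retreat w)).
  have := vanishesB (vanishesMr w (vanishes_fmult d (fun k => fourier (- k) omega%:C) lli))
     (vanishesMr (retreat w) lli).
  congr (vanishes _ _); rewrite -/retreat retreatB retreat1 retreatM /B /P /w retreatM; ring.
(* the left-hand side w - w(. - omega) has mean zero, and B is close to 1, so that
the mean of P is bounded by its oscillating part *)
have E9 : vanishes L (Pb - (- (avg d (B * Pt)) - Pb * avg d (B - 1))).
  have := vanishes_fmult d (fun k => (k == 0)%:R) E8; congr (vanishes _ _).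
  rewrite -/(avg d) !avgB avg_retreat subrr subr0 PE mulrDr avgD (mulrC B Pb).
  by rewrite /Pb avgMl avg1; ring.
have N3 : n Pb <= 8 * n Pt.
  have h1 : n (avg d (B * Pt)) <= 2 * n Pt.
    by apply: le_trans (navg _) _; apply: le_trans (nM _ _) _; rewrite ler_wpM2r.
  have h2 : n (Pb * avg d (B - 1)) <= n Pb * (1 / 2).
    apply: le_trans (nM _ _) _; rewrite ler_wpM2l //; exact: le_trans nB1.
  have h3 : n Pb <= n (avg d (B * Pt)) + n (Pb * avg d (B - 1)).
    rewrite {1}/n (eq_nrm r E9) -/n; apply: le_trans (nB _ _) _.
    by rewrite {1}/n nrmN -/n.
  have := n0 Pt; lra.
set wt := osc d w; set wb := avg d w.
have cw : cone d w.
  apply: coneM => //; apply: cone_sum => i _; apply/coneX/coneN; exact: cone_fmult.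
have N4 : n wt <= K * (2 * (n Pt + n Pb)).
  apply: le_trans (nrm_divisor r0 K0 HK cw) _; rewrite ler_wpM2l ?(le_trans ler01) //.
  have -> : advance w - w = advance (w - retreat w) by rewrite advanceB advanceK.
  rewrite -/n; apply: le_trans (nadvance _) _; rewrite {1}/n -(eq_nrm r E8) -/n.
  apply: le_trans (nM _ _) _; apply: ler_pM => //.
  by rewrite PE addrC; exact: nD.
(* v = l w has mean zero and l has mean 1, which gives the mean of w *)
have N5 : n wb <= 13 / 12 * n wt.
  have E : vanishes L (wb - (- avg d (l * wt))).
    have := vanishes_fmult d (fun k => (k == 0)%:R) E7; congr (vanishes _ _).
    rewrite -/(avg d) avgB av subr0 [in LHS](avg_osc d w) -/wb -/wt mulrDr avgD.
    by rewrite (mulrC l wb) /wb avgMl al; ring.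
  rewrite /n (eq_nrm r E) nrmN -/n; apply: le_trans (navg _) _; exact: nl.
have N6 : n v <= 4 * n wt.
  rewrite {1}/n -(eq_nrm r E7) -/n; apply: le_trans (nl _) _.
  have := nD wb wt; rewrite -(avg_osc d w).
  have := n0 wt; lra.
apply: (block_arith K1 Kra _ (n0 Pt) (n0 Pb) (n0 sg) N1 N2 N3 N4 N6).
exact: exprn_ge0.
Qed.

End Block.

(** * The Lindstedt recursion *)

Section Recursion.
Context {R : realType} (d alpha : nat) (omega : R) (s : seq (int * R[i])).
Local Notation bpoly := {poly {poly R[i]}}.
Implicit Types (a b u v x y : bpoly) (r : R) (c : R[i]).

Hypothesis s_le_d : all (fun p => (`|p.1| <= d)%N) s.
Hypothesis alpha_gt0 : (0 < alpha)%N.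
Hypothesis irrational : forall k : int, k != 0 -> fourier k omega%:C != 1.

Local Notation advance := (advance d omega).
Local Notation retreat := (retreat d omega).
Local Notation dtheta := (dtheta d).
Local Notation epspow := (@epspow R d alpha).
Local Notation lam := (@lam R d alpha).
Local Notation inveq := (inveq d alpha omega s).

(** The leading part of the equation is u(. + omega) - 2 u + u(. - omega), whose
    symbol vanishes at k = 0 only. The value 0 there keeps u of mean zero. *)
Definition laplacian_inv (k : int) : R[i] :=
  if k == 0 then 0 else (fourier k omega%:C - 2 + fourier (- k) omega%:C)^-1.

(** The orders less than n of the solution. Truncating exponentials at n' is
    enough to compute order n', since the forcing carries a factor eps. *)
Fixpoint lindstedt (n : nat) : bpoly :=
  if n is n'.+1 then
    lindstedt n' - ((fmult d laplacian_inv (inveq n' (lindstedt n')))`_n')%:P * 'X^n'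
  else 0.

Lemma laplacian_invE k : k != 0 ->
  (fourier k omega%:C - 2 + fourier (- k) omega%:C) * laplacian_inv k = 1.
Proof.
move=> k0; rewrite /laplacian_inv (negbTE k0) mulfV //.
have f := fourierN k omega%:C.
have -> : fourier k omega%:C - 2 + fourier (- k) omega%:C =
   fourier (- k) omega%:C * (fourier k omega%:C - 1) ^+ 2.
  by rewrite sqrrB1 !(mulrDr, mulrBr) expr2 mulrA f; ring: f.
rewrite mulf_neq0 ?expf_neq0 ?subr_eq0 ?irrational //.
by apply: contra_eq_neq f => ->; rewrite mul0r eq_sym oner_eq0.
Qed.

Lemma vanishes_epspow n a : vanishes n a -> vanishes n.+1 (epspow * a).
Proof.
by move=> a0; apply: (@vanishesW _ _ (alpha + n)); [lia | exact: vanishes_mono].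
Qed.

(** The part of order n of the equation is the discrete Laplacian of the part of
    order n of the unknown, plus terms that only involve lower orders: both the
    forcing and the dissipation carry a factor eps. *)
Lemma inveq_cong n m u v : vanishes n (u - v) ->
  vanishes n.+1 (inveq m u - inveq m v
    - fmult d (fun k => fourier k omega%:C - 2 + fourier (- k) omega%:C) (u - v)).
Proof.
move=> uv; set w := u - v in uv *.
have -> : fmult d (fun k => fourier k omega%:C - 2 + fourier (- k) omega%:C) w =
    advance w - (1 + 1) * w + retreat w.
  clear uv; clearbody w; apply/bpolyP => i j.
  rewrite coef_fmult (_ : _ - _ + _ = advance w - w - w + retreat w); last by ring.
  rewrite !(coefD, coefN) !coef_fmult. ring.
have -> : inveq m u - inveq m v - (advance w - (1 + 1) * w + retreat w) =
    (forcing d s 1 m u - forcing d s 1 m v) + epspow * (w - retreat w).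
  by rewrite !inveqE /w advanceB retreatB lamE; ring.
apply: vanishesD; first exact: forcing_cong.
by apply/vanishes_epspow/vanishesB => //; exact: vanishes_fmult.
Qed.

Lemma vanishes_inveq m u : vanishes 1 u -> vanishes 1 (inveq m u).
Proof.
move=> u0; apply: vanishesD.
  have e0 : vanishes 1 epspow by rewrite -[epspow]mulr1; exact: vanishes_epspow.
  apply: vanishesD; last exact: vanishesMl.
  apply: vanishesD; last by apply/vanishesMl/vanishes_fmult.
  by apply: vanishesB; [exact: vanishes_fmult | exact: vanishesMl].
apply: vanishes_sum => p _; rewrite -[1%N]addn0; exact: vanishes_mono.
Qed.

Lemma lindstedt_step n : vanishes n (lindstedt n.+1 - lindstedt n).
Proof.
move=> i ni; rewrite /= addrAC subrr add0r coefN coefCM coefXn ltn_eqF //.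
by rewrite mulr0 oppr0.
Qed.

Lemma lindstedt_stable n N : (n <= N)%N -> vanishes n (lindstedt N - lindstedt n).
Proof.
move=> nN; rewrite -(subnKC nN); elim: (N - n)%N => [|k IH].
  by rewrite addn0 subrr; exact: vanishes0.
rewrite addnS -(subrK (lindstedt (n + k)) (lindstedt _.+1)) -addrA; apply: vanishesD => //.
by apply: (@vanishesW _ _ (n + k)); [rewrite leq_addr | exact: lindstedt_step].
Qed.

Lemma lindstedt_high n i : (n <= i)%N -> (lindstedt n)`_i = 0.
Proof.
elim: n => [|n IH] ni; first by rewrite coef0.
rewrite /= coefB IH ?(ltnW ni) // coefCM coefXn gtn_eqF //.
by rewrite mulr0 subr0.
Qed.

Lemma vanishes1_lindstedt n : vanishes 1 (lindstedt n).
Proof.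
case: n => [|n]; first exact: vanishes0.
have -> : lindstedt n.+1 = (lindstedt n.+1 - lindstedt 1) + lindstedt 1 by rewrite subrK.
apply: vanishesD; first exact: lindstedt_stable.
move=> [|//] _; rewrite /= sub0r coefN coefCM coefXn eqxx mulr1.
apply/eqP; rewrite oppr_eq0; apply/eqP.
exact: (vanishes_fmult d _ (vanishes_inveq 0 (@vanishes0 R 1)) (ltn0Sn 0)).
Qed.

Lemma cone_lindstedt n : cone d (lindstedt n).
Proof.
elim: n => [|n IH] /=; first exact: cone0.
apply: coneB => // i j ij; rewrite coefCM coefXn.
case: eqP => [E|_]; last by rewrite mulr0 coef0.
by rewrite mulr1 E in ij *; apply: cone_fmult => //; exact: cone_inveq.
Qed.

Lemma avg_lindstedt n : avg d (lindstedt n) = 0.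
Proof.
elim: n => [|n IH] /=; first exact: fmult0.
rewrite avgB IH sub0r; apply/eqP; rewrite oppr_eq0; apply/eqP/bpolyP => i j.
rewrite coef_fmult !coefCM coefXn !coef0.
case: (i =P n) => [->|_]; last by rewrite mulr0 coef0 mulr0.
rewrite mulr1 coef_fmult /laplacian_inv.
by case: eqP; rewrite ?mul0r ?mulr0.
Qed.

Lemma lindstedt_solves n m : (n <= m)%N -> vanishes n (osc d (inveq m (lindstedt n))).
Proof.
elim: n m => [//|n IH] m nm.
set c := fmult d laplacian_inv (inveq n (lindstedt n)).
have D := inveq_cong m (@lindstedt_step n).
have T : vanishes n.+1 (inveq m (lindstedt n) - inveq n (lindstedt n)).
  have := @forcing_trunc _ d s 1 n m _ (ltnW nm) (@vanishes1_lindstedt n).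
  by congr (vanishes _ _); rewrite !inveqE; ring.
move=> i ni.
have -> : osc d (inveq m (lindstedt n.+1)) =
   osc d (inveq m (lindstedt n.+1) - inveq m (lindstedt n) -
       fmult d (fun k => fourier k omega%:C - 2 + fourier (- k) omega%:C)
         (lindstedt n.+1 - lindstedt n)) + osc d (inveq m (lindstedt n) - inveq n (lindstedt n))
   + (osc d (inveq n (lindstedt n)) + osc d (fmult d (fun k =>
       fourier k omega%:C - 2 + fourier (- k) omega%:C) (lindstedt n.+1 - lindstedt n))).
  by rewrite -!fmultD; congr (osc _ _); ring.
rewrite !coefD (vanishes_fmult _ _ D) // (vanishes_fmult _ _ T) // !add0r.
move: ni; rewrite ltnS leq_eqVlt => /orP[/eqP->|ni]; last first.
  rewrite IH // add0r.
  exact: (vanishes_fmult _ _ (vanishes_fmult _ _ (@lindstedt_step n)) ni).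
apply/polyP => j; rewrite coefD !coef_fmult coef0 /= (addrAC (lindstedt n)) subrr add0r.
rewrite coefN coefCM coefXn eqxx mulr1 coefN coef_fmult.
case: eqP => [_|/eqP k0]; first by rewrite !mul0r addr0.
by rewrite !mul1r mulrN mulrA laplacian_invE // mul1r subrr.
Qed.

End Recursion.

(** * Shrinking radii *)

Section Decay.
Context {R : realType}.
Implicit Types (A B x z : R).

(** The k-th power of z/k <= exp(z/k). *)
Lemma expRN_le_pow z k : 0 < z -> expR (- z) * z ^+ k <= k%:R ^+ k.
Proof.
move=> z0; case: k => [|k]; first by rewrite !expr0 mulr1 -expR0 ler_expR oppr_le0 ltW.
have -> : expR (- z) = expR (- (z / k.+1%:R)) ^+ k.+1.
  by rewrite -expRM_natl; congr expR; rewrite mulrN mulrC divfK // pnatr_eq0.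
rewrite -exprMn; apply: lerXn2r; rewrite ?nnegrE ?mulr_ge0 ?expR_ge0 ?(ltW z0) //.
rewrite expRN mulrC ler_pdivrMr ?expR_gt0 // mulrC -ler_pdivrMr ?ltr0n //.
by rewrite (le_trans _ (expR_ge1Dx _)) // lerDr.
Qed.

(** These factors decrease to 1, so that radii are at most halved in
    all. The ratio 3/4 is larger than 1/2, so that (3/4)^m 2^m still grows. *)
Definition radius_factor (m : nat) : R := 1 + (3 / 4) ^+ m.

Definition shrink_factor (m : nat) : R := radius_factor m.+1 / radius_factor m.

Lemma radius_factor_bounds m : 1 <= radius_factor m <= 2.
Proof.
have h : 0 <= (3 / 4 : R) ^+ m <= 1 by rewrite exprn_ge0 ?exprn_ile1 //; lra.
by rewrite /radius_factor; lra.
Qed.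

Lemma shrink_factor_bounds m : 0 <= shrink_factor m <= 1.
Proof.
have /andP[a1 a2] := radius_factor_bounds m.
have /andP[b1 b2] := radius_factor_bounds m.+1.
rewrite /shrink_factor divr_ge0 ?ler_pdivrMr; [|lra..].
rewrite mul1r /radius_factor exprS lerD2l ler_piMl ?exprn_ge0 //; lra.
Qed.

Lemma shrink_factor_le m : shrink_factor m <= expR (- ((3 / 4) ^+ m / 8)).
Proof.
apply: le_trans (expR_ge1Dx _).
have /andP[a1 a2] := radius_factor_bounds m.
rewrite /shrink_factor ler_pdivrMr; last by lra.
have h : 0 <= (3 / 4 : R) ^+ m <= 1 by rewrite exprn_ge0 ?exprn_ile1 //; lra.
rewrite /radius_factor exprS; move: ((3 / 4) ^+ m) h => y /andP[y0 y1].
have : y * y <= y by rewrite ler_piMl.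
lra.
Qed.

Lemma le_2expn (n : nat) : n%:R <= 2 ^+ n :> R.
Proof. by rewrite -natrX ler_nat ltnW // ltn_expl. Qed.

Lemma nat_above x : exists n : nat, x <= n%:R.
Proof.
exists (Num.bound x); have [x0|x0] := leP 0 x.
  by apply: ltW; exact: archi_boundP.
by rewrite (le_trans (ltW x0)).
Qed.

(** The left-hand power is at most exp(- (3/2)^m / 8), doubly
    exponentially small, and beats any loss that is exponential in m, that is,
    polynomial in the order 2^m. *)
Lemma shrink_factor_decay A B : 0 <= A -> 0 < B -> exists m0 : nat, forall m,
  (m0 <= m)%N -> A * B ^+ m * shrink_factor m ^+ (2 ^ m) <= 2^-1 ^+ m / 48.
Proof.
move=> A0 B0; have [j jB] := nat_above (4 * B).
set k := (2 * j)%N.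
have kB : 4 * B <= (3 / 2) ^+ k.
  rewrite /k exprM; apply: le_trans jB _; apply: le_trans (le_2expn j) _.
  by rewrite lerXn2r ?nnegrE //; lra.
have [m0 m0P] := nat_above (48 * A * (8 * k%:R) ^+ k).
exists m0 => m m0m.
have X0 : shrink_factor m ^+ (2 ^ m) <= expR (- ((3 / 2) ^+ m / 8)).
  have -> : expR (- ((3 / 2) ^+ m / 8)) = expR (- ((3 / 4) ^+ m / 8)) ^+ (2 ^ m) :> R.
    rewrite -expRM_natl; congr expR; rewrite mulrN mulrA natrX -exprMn.
    by congr (- (_ ^+ m / 8)); field.
  rewrite lerXn2r ?nnegrE ?expR_ge0 ?shrink_factor_le //.
  by case/andP: (shrink_factor_bounds m).
have z0 : 0 < (3 / 2 : R) ^+ m / 8 by rewrite divr_gt0 ?exprn_gt0 //; lra.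
have X1 := expRN_le_pow k z0.
have X2 : expR (- ((3 / 2) ^+ m / 8)) * (4 * B) ^+ m <= (8 * k%:R) ^+ k.
  have h : (4 * B) ^+ m <= 8 ^+ k * ((3 / 2) ^+ m / 8) ^+ k.
    rewrite -exprMn mulrCA mulfV ?mulr1 // -exprM mulnC exprM.
    by apply: lerXn2r; rewrite ?nnegrE ?exprn_ge0 ?mulr_ge0 ?(ltW B0) //; lra.
  apply: le_trans (ler_wpM2l (expR_ge0 _) h) _.
  by rewrite mulrCA [leRHS]exprMn ler_wpM2l ?exprn_ge0.
have B4 : 0 < (4 * B) ^+ m by rewrite exprn_gt0 // mulr_gt0.
have X3 : shrink_factor m ^+ (2 ^ m) <= (8 * k%:R) ^+ k / (4 * B) ^+ m.
  by apply: le_trans X0 _; rewrite ler_pdivlMr.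
apply: (@le_trans _ _ (A * B ^+ m * ((8 * k%:R) ^+ k / (4 * B) ^+ m))).
  by rewrite ler_wpM2l // mulr_ge0 // exprn_ge0 // ltW.
have -> : A * B ^+ m * ((8 * k%:R) ^+ k / (4 * B) ^+ m) =
   (48 * A * (8 * k%:R) ^+ k) / 2 ^+ m * (2^-1 ^+ m / 48).
  rewrite exprMn (_ : 4 = 2 * 2) ?exprMn ?exprVn; last by ring.
  by field; rewrite !expf_neq0 ?gt_eqF.
rewrite ler_piMl ?divr_ge0 ?exprn_ge0 ?invr_ge0 // ler_pdivrMr ?exprn_gt0 // mul1r.
apply: le_trans m0P _; apply: le_trans (le_2expn m0) _.
by rewrite ler_eXn2l // ltr1n.
Qed.

End Decay.

(** * The dyadic scheme up to a given order *)

Section Gevrey.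
Context {R : realType} (d alpha : nat) (omega nu tau : R) (s : seq (int * R[i])).
Local Notation bpoly := {poly {poly R[i]}}.
Implicit Types (a b u v : bpoly) (r x : R) (c : R[i]).

Hypothesis s_le_d : all (fun p => (`|p.1| <= d)%N) s.
Hypothesis d_gt0 : (0 < d)%N.
Hypothesis alpha_gt0 : (0 < alpha)%N.
Hypothesis nu_gt0 : 0 < nu.
Hypothesis tau_gt0 : 0 < tau.
Hypothesis omega_dioph : diophantine nu tau omega.

Local Notation dtheta := (dtheta d).
Local Notation inveq := (inveq d alpha omega s).
Local Notation lindstedt := (lindstedt d alpha omega s).

Lemma diophantine_irrational (k : int) : k != 0 -> fourier k omega%:C != 1.
Proof.
move=> k0; apply: contraTneq (omega_dioph k0) => ->.
rewrite subrr normc0 -ltNge mulr_gt0 // powR_gt0 // ltr0n absz_gt0 //.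
Qed.

Let nu1 := Num.min nu 1.
Let nu1_gt0 : 0 < nu1. Proof. by rewrite lt_min nu_gt0 ltr01. Qed.

(** The inverse of the Diophantine lower bound at the frequency d M. The minimum
    of nu and 1 makes it at least 1. *)
Definition divisor_cst (M : nat) : R := (d * M)%:R `^ tau / nu1.

Lemma divisor_cst_ge1 M : (0 < M)%N -> 1 <= divisor_cst M.
Proof.
move=> M0; rewrite /divisor_cst ler_pdivlMr // mul1r.
apply: (@le_trans _ _ 1); first by rewrite ge_min lexx orbT.
have := @ler_powR R (d * M)%:R _ _ _ (ltW tau_gt0); rewrite powRr0; apply.
by rewrite ler1n muln_gt0 d_gt0.
Qed.

Lemma diophantine_divisor M : divisor_bound d omega (divisor_cst M) M.
Proof.
move=> k k0 kM; have k1 : (0 < `|k|)%N by rewrite absz_gt0.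
have dM : 0 < (d * M)%:R `^ tau by rewrite powR_gt0 // ltr0n (leq_trans k1).
have kt : 0 < (`|k|%N%:R : R) `^ tau by rewrite powR_gt0 // ltr0n.
apply: (@le_trans _ _ (divisor_cst M * (nu1 * (d * M)%:R `^ (- tau)))).
  rewrite /divisor_cst powRN (_ : _ * _ = 1) //.
  by field; rewrite !gt_eqF.
rewrite ler_wpM2l ?divr_ge0 ?powR_ge0 ?(ltW nu1_gt0) //.
apply: le_trans (omega_dioph k0); apply: ler_pM; rewrite ?powR_ge0 ?(ltW nu1_gt0) //.
  by rewrite ge_min lexx.
rewrite !powRN lef_pV2 ?posrE // ge0_ler_powR ?nnegrE ?ler_nat // ltW //.
Qed.

(** The linear part contributes 6 = 1 + 3 + 2, one bound for each of its terms. *)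
Definition inveq_bound : R := 6 + `|omega| + forcing_bound s 1.

(** The symbol of d_theta is at least 2 pi at nonzero frequencies. *)
Lemma nrm_le_dtheta r M u : 0 <= r -> avg d u = 0 -> nrm r M u <= nrm r M (dtheta u).
Proof.
move=> r0 u0; rewrite -[leRHS]mul1r; apply: nrm_leM => // n j _.
rewrite mul1r coef_fmult normcM.
case: (freq d n j =P 0) => [k0|/eqP k0].
  have /bpolyP/(_ n j) := u0; rewrite coef_fmult k0 eqxx !coef0 mul1r => ->.
  by rewrite normc0 mulr0.
rewrite ler_peMl ?normc_ge0 // normc_wavenumber.
have : 1 <= (`|freq d n j|%N%:R : R) by rewrite ler1n absz_gt0.
by move=> k1; apply: mulr_ege1 => //; have := pi_ge2 R; lra.
Qed.

Lemma nrm_inveq r M m u : 0 <= r <= 1 -> avg d u = 0 ->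
  nrm r M (dtheta u) <= 1 -> nrm r M (inveq m u) <= inveq_bound.
Proof.
move=> /andP[r0 r1] au u1.
have n1 : nrm r M u <= 1 by apply: le_trans u1; exact: nrm_le_dtheta.
have eps a : nrm r M (epspow d alpha * a) <= nrm r M a.
  by apply: le_trans (nrm_monoM _ _ _ _ r0) _; rewrite ler_piMl ?nrm_ge0 ?exprn_ile1.
have lamn a : nrm r M (lam d alpha * a) <= 2 * nrm r M a.
  rewrite /lam mulrBl mul1r; apply: le_trans (nrmB _ _ _ r0) _.
  by have := eps a; lra.
have adv : nrm r M (advance d omega u) <= nrm r M u.
  by apply: nrm_fmult1 => // k; rewrite normc_fourier_real.
have ret : nrm r M (retreat d omega u) <= nrm r M u.
  by apply: nrm_fmult1 => // k; rewrite normc_fourier_real.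
have f1 : nrm r M (forcing d s 1 m u) <= forcing_bound s 1.
  apply: le_trans (nrm_forcing _ _ _ _ r0 n1) _; rewrite ler_piMl //.
  by rewrite sumr_ge0 // => p _; rewrite mulr_ge0 ?normc_ge0 ?expR_ge0.
have o1 : nrm r M (bcst omega%:C * epspow d alpha) <= `|omega|.
  apply: le_trans (nrm_bcstM _ _ _ r0) _; rewrite /= expr0n addr0 sqrtr_sqr.
  rewrite ler_piMr // -[epspow _ _]mulr1; apply: le_trans (eps _) _; exact: nrm1.
have l1 := lamn u; have l2 := lamn (retreat d omega u).
rewrite !inveqE /inveq_bound; apply: le_trans (nrmD _ _ _ r0) _; apply: lerD => //.
apply: le_trans (nrmD _ _ _ r0) _; apply: lerD => //.
apply: le_trans (nrmD _ _ _ r0) _.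
have : nrm r M (advance d omega u - (1 + lam d alpha) * u) <= 4.
  apply: le_trans (nrmB _ _ _ r0) _.
  by rewrite mulrDl mul1r; have := nrmD M u (lam d alpha * u) r0; lra.
lra.
Qed.

(** The error of the truncation below M has order at least M, so it is multiplied
    by at most x^M when the radius goes from r to x r. By [block_estimate], the
    next block is bounded by a multiple of this error; the derivative costs a factor
    proportional to the largest frequency. *)
Lemma dyadic_step M r x : (0 < M)%N -> 0 <= r <= 1 -> 0 <= x <= 1 ->
  divisor_cst (M + M) * (x * r) ^+ alpha <= 1 / 4 ->
  nrm r M (dtheta (lindstedt M)) <= 1 / 12 ->
  nrm (x * r) (M + M) (dtheta (lindstedt (M + M))) <=
    nrm r M (dtheta (lindstedt M)) +
    block_cst * divisor_cst (M + M) ^+ 2 * (2 * pi * (d * (M + M))%:R) * inveq_bound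
      * x ^+ M.
Proof.
move=> M0 /andP[r0 r1] /andP[x0 x1] Kr h12.
have xr0 : 0 <= x * r by rewrite mulr_ge0.
have xr1 : x * r <= r by rewrite ler_piMl.
set L := (M + M)%N in Kr *; set u := lindstedt M in h12 *.
have low : nrm r L (dtheta u) = nrm r M (dtheta u).
  rewrite /L /nrm big_split_ord /= [X in _ + X]big1 ?addr0 // => i _.
  rewrite [X in pnrm X](_ : _ = 0) ?pnrm0 ?mul0r //.
  by apply/polyP => j; rewrite coef_fmult lindstedt_high ?leq_addr // !coef0 mulr0.
set v := lindstedt L - u.
have irr := diophantine_irrational.
have ML : (M <= L.+1)%N by rewrite leqW ?leq_addr.
have sol : vanishes M (osc d (inveq L.+1 u)) by exact: lindstedt_solves.
have E : lindstedt L = u + v by rewrite addrC subrK.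
have B : nrm (x * r) L v <= block_cst * divisor_cst L ^+ 2 *
    nrm (x * r) L (osc d (inveq L.+1 u)).
  apply: (block_estimate s_le_d (alpha := alpha) (omega := omega) (M := M) (m := L)) => //.
  - exact: vanishes1_lindstedt.
  - exact: cone_lindstedt.
  - by apply: coneB; exact: cone_lindstedt.
  - by apply: lindstedt_stable; exact: leq_addr.
  - by rewrite avgB !avg_lindstedt subrr.
  - by rewrite -E; apply: lindstedt_solves.
  - exact: diophantine_divisor.
  - by apply: divisor_cst_ge1; rewrite /L; lia.
  - by apply: le_trans (nrmWr _ _ xr0 xr1) _; rewrite low.
have e : nrm (x * r) L (osc d (inveq L.+1 u)) <= x ^+ M * inveq_bound.
  have x01 : 0 <= x <= 1 by rewrite x0.
  apply: le_trans (nrm_shrink L x01 r0 sol) _.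
  rewrite ler_wpM2l ?exprn_ge0 //; apply: le_trans (nrm_osc _ _ _ r0) _.
  apply: nrm_inveq; rewrite ?r0 //; first exact: avg_lindstedt.
  by rewrite low; lra.
have dv : nrm (x * r) L (dtheta v) <= 2 * pi * (d * L)%:R * nrm (x * r) L v.
  apply: nrm_fmult => // n j nL vN0; rewrite normc_wavenumber.
  rewrite ler_wpM2l ?mulr_ge0 ?pi_ge0 // ler_nat.
  have [jn|nj] := leqP j (2 * d * n); last first.
    have cv : cone d v by apply: coneB; exact: cone_lindstedt.
    by rewrite cv ?eqxx in vN0.
  exact: freq_bound (ltnW nL).
rewrite E dthetaD; apply: le_trans (nrmD _ _ _ xr0) _; apply: lerD.
  by apply: le_trans (nrmWr _ _ xr0 xr1) _; rewrite low.
apply: le_trans dv _; set W := 2 * pi * _.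
have W0 : 0 <= W by rewrite !mulr_ge0 ?pi_ge0.
apply: le_trans (ler_wpM2l W0 B) _.
have K0 : 0 <= block_cst * divisor_cst L ^+ 2 :> R by rewrite mulr_ge0 ?sqr_ge0 ?block_cst_ge0.
apply: le_trans (ler_wpM2l W0 (ler_wpM2l K0 e)) _.
by rewrite le_eqVlt; apply/orP; left; apply/eqP; ring.
Qed.

Lemma divisor_cst_le (T M : nat) : tau <= T%:R -> (0 < M)%N ->
  divisor_cst M <= (d * M)%:R ^+ T / nu1.
Proof.
move=> tT M0; rewrite ler_wpM2r ?invr_ge0 ?(ltW nu1_gt0) //.
rewrite -powR_mulrn // ler_powR //.
by rewrite ler1n muln_gt0 d_gt0.
Qed.

Lemma inveq_bound_ge0 : 0 <= inveq_bound.
Proof.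
rewrite /inveq_bound !addr_ge0 // sumr_ge0 // => p _.
by rewrite mulr_ge0 ?normc_ge0 ?expR_ge0.
Qed.

(** The increments of [dyadic_step] are summable: their coefficients are
    polynomial in 2^m, so [shrink_factor_decay] applies. *)
Lemma step_decay : exists m0 : nat, forall m, (m0 <= m)%N ->
  block_cst * divisor_cst (2 ^ m + 2 ^ m) ^+ 2 * (2 * pi * (d * (2 ^ m + 2 ^ m))%:R)
    * inveq_bound * shrink_factor m ^+ (2 ^ m) <= 2^-1 ^+ m / 48.
Proof.
have [T tT] := nat_above tau; set D := (2 * T).+1.
set A : R := block_cst * nu1^-1 ^+ 2 * (2 * pi) * inveq_bound * (2 * d%:R) ^+ D.
have A0 : 0 <= A.
  by rewrite !mulr_ge0 ?exprn_ge0 ?mulr_ge0 ?pi_ge0 ?inveq_bound_ge0 ?invr_ge0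
    ?block_cst_ge0 ?(ltW nu1_gt0).
have B0 : 0 < 2 ^+ D :> R by rewrite exprn_gt0.
have [m0 m0P] := shrink_factor_decay A0 B0.
exists m0 => m m0m; apply: le_trans (m0P m m0m).
have /andP[x0 _] := shrink_factor_bounds (R := R) m.
rewrite ler_wpM2r ?exprn_ge0 //.
have M0 : (0 < 2 ^ m + 2 ^ m)%N by rewrite addn_gt0 expn_gt0.
have K := divisor_cst_le tT M0.
set L := (d * (2 ^ m + 2 ^ m))%:R in K *.
have LE : L = 2 * d%:R * 2 ^+ m :> R by rewrite /L natrM natrD natrX; ring.
have L0 : 0 <= L :> R by rewrite /L.
have K2 : divisor_cst (2 ^ m + 2 ^ m) ^+ 2 <= (L ^+ T / nu1) ^+ 2.
  apply: lerXn2r => //; rewrite nnegrE ?divr_ge0 ?powR_ge0 ?exprn_ge0 ?(ltW nu1_gt0) //.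
apply: (@le_trans _ _ (block_cst * (L ^+ T / nu1) ^+ 2 * (2 * pi * L) * inveq_bound)).
  apply: ler_wpM2r; first exact: inveq_bound_ge0.
  apply: ler_wpM2r; first by rewrite mulr_ge0 // mulr_ge0 ?pi_ge0.
  by apply: ler_wpM2l; first exact: block_cst_ge0.
rewrite le_eqVlt; apply/orP; left; apply/eqP.
have -> : (L ^+ T / nu1) ^+ 2 = nu1^-1 ^+ 2 * L ^+ (2 * T).
  by rewrite exprMn mulrC -exprM mulnC.
rewrite /A (_ : (2 * d%:R) ^+ D = (2 * d%:R) ^+ D * 1) ?mulr1 //.
have -> : block_cst * (nu1^-1 ^+ 2 * L ^+ (2 * T)) * (2 * pi * L) * inveq_bound =
   block_cst * nu1^-1 ^+ 2 * (2 * pi) * inveq_bound * L ^+ D by rewrite /D (exprS L); ring.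
by rewrite LE exprMn -[(2 ^+ m) ^+ D]exprM mulnC [2 ^+ (D * m)]exprM; ring.
Qed.

(** At this radius, eps^alpha is at most kappa^alpha N^(-2 tau), which is below the small
    divisors met up to order N once kappa is small. *)
Definition gevrey_radius (kappa : R) (N : nat) : R :=
  kappa * N%:R `^ (- (2 * tau / alpha%:R)).

Lemma gevrey_radius_bounds (kappa : R) N : 0 < kappa -> (0 < N)%N ->
  0 < gevrey_radius kappa N <= kappa.
Proof.
move=> c0 N0; rewrite /gevrey_radius mulr_gt0 ?powR_gt0 ?ltr0n //=.
rewrite ler_piMr ?(ltW c0) // powRN invf_le1 ?powR_gt0 ?ltr0n //.
have := @ler_powR R N%:R _ 0 (2 * tau / alpha%:R); rewrite powRr0; apply.
  by rewrite ler1n.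
by rewrite !mulr_ge0 ?invr_ge0 ?(ltW tau_gt0).
Qed.

Lemma gevrey_radius_divisor (kappa : R) N M (y : R) : 0 < kappa <= 1 -> 0 <= y <= 2 ->
  kappa * ((2 * d)%:R `^ tau * 2 ^+ alpha) <= nu1 / 4 ->
  (0 < N)%N -> (0 < M <= 2 * N)%N ->
  divisor_cst M * (gevrey_radius kappa N * y) ^+ alpha <= 1 / 4.
Proof.
move=> /andP[c0 c1] /andP[y0 y2] cle N0 /andP[M0 MN].
have /andP[g0 g1] := gevrey_radius_bounds c0 N0.
have n0 : 0 < N%:R :> R by rewrite ltr0n.
have gE : gevrey_radius kappa N ^+ alpha = kappa ^+ alpha * (N%:R `^ tau) ^- 2.
  rewrite /gevrey_radius exprMn -(powR_mulrn alpha (powR_ge0 N%:R _)) -powRrM.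
  congr (_ * _); rewrite mulNr divfK ?pnatr_eq0 -?lt0n // powRN; congr (_^-1).
  by rewrite mulrC powRrM powR_mulrn ?powR_ge0.
have dM : (d * M)%:R `^ tau <= (2 * d)%:R `^ tau * N%:R `^ tau.
  rewrite -powRM ?ler0n // ge0_ler_powR ?nnegrE ?mulr_ge0 ?ler0n ?(ltW tau_gt0) //.
  by rewrite -natrM ler_nat (mulnC 2%N d) -mulnA leq_mul2l MN orbT.
set t := N%:R `^ tau in gE dM.
have t0 : 0 < t by rewrite powR_gt0.
have t1 : 1 <= t.
  have := @ler_powR R N%:R _ 0 tau; rewrite powRr0; apply; rewrite ?ler1n //.
  exact: ltW.
have ca : kappa ^+ alpha <= kappa.
  by rewrite -[leRHS]expr1 ler_wiXn2l ?(ltW c0).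
set D := (2 * d)%:R `^ tau in cle dM.
have D0 : 0 <= D by rewrite powR_ge0.
have y2a : y ^+ alpha <= 2 ^+ alpha by apply: lerXn2r; rewrite ?nnegrE.
rewrite exprMn gE /divisor_cst.
apply: (@le_trans _ _ (D * t / nu1 * (kappa * t ^- 2 * 2 ^+ alpha))).
  apply: ler_pM; rewrite ?divr_ge0 ?powR_ge0 ?mulr_ge0 ?invr_ge0 ?exprn_ge0 ?(ltW c0)
    ?(ltW nu1_gt0) ?(ltW t0) //.
    by rewrite ler_wpM2r ?invr_ge0 ?(ltW nu1_gt0).
  apply: ler_pM; rewrite ?mulr_ge0 ?invr_ge0 ?exprn_ge0 ?(ltW c0) ?(ltW t0) //.
  by rewrite ler_wpM2r ?invr_ge0 ?exprn_ge0 ?(ltW t0).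
have -> : D * t / nu1 * (kappa * t ^- 2 * 2 ^+ alpha) =
    (kappa * (D * 2 ^+ alpha) / nu1) * t^-1.
  by field; rewrite !gt_eqF.
apply: (@le_trans _ _ (1 / 4 * 1)); last by rewrite mulr1.
apply: ler_pM; rewrite ?invr_ge0 ?(ltW t0) //.
- by rewrite !mulr_ge0 ?invr_ge0 ?exprn_ge0 ?(ltW c0) ?(ltW nu1_gt0).
- by rewrite ler_pdivrMr // mulrC mul1r in cle *; lra.
- by rewrite invf_le1.
Qed.

(** The dyadic scheme runs from a fixed level m0, where the gain starts
    to beat the losses, to the first power of 2 above N. The constant kappa is chosen
    small enough for the finitely many orders less than 2^m0, and for the dissipation
    to be absorbed at all the levels. The point is that kappa does not depend
    on N. *)
Lemma lindstedt_jacobian : exists (kappa : R) (N0 : nat), 0 < kappa <= 1 /\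
  forall N, (N0 <= N)%N -> (0 < N)%N /\
    nrm (gevrey_radius kappa N) N.+1 (dtheta (lindstedt N.+1)) <= 1 / 12.
Proof.
have irr := diophantine_irrational.
have [m0 m0P] := step_decay.
(* the second term of the minimum below bounds the orders less than 2^m0 by 1/24,
since each carries at least one factor of the radius; the third one absorbs the
dissipation *)
set X0 := nrm 1 (2 ^ m0) (dtheta (lindstedt (2 ^ m0))).
have X00 : 0 <= X0 by exact: nrm_ge0.
set Y := (2 * d)%:R `^ tau * 2 ^+ alpha.
have Y0 : 0 < Y by rewrite mulr_gt0 ?powR_gt0 ?exprn_gt0 // ltr0n muln_gt0.
set kappa := Num.min (1 / 2) (Num.min (1 / (48 * (X0 + 1))) (nu1 / (4 * Y))).
have X1 : 0 < 48 * (X0 + 1) by lra.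
have c0 : 0 < kappa.
  rewrite !lt_min; apply/and3P; split; first by lra.
    by rewrite divr_gt0.
  by apply: divr_gt0; [exact: nu1_gt0 | rewrite mulr_gt0].
have cle1 : kappa <= 1 / 2 by rewrite ge_min lexx.
have cle2 : kappa <= 1 / (48 * (X0 + 1)) by rewrite !ge_min lexx orbT.
have cle3 : kappa * Y <= nu1 / 4.
  have : kappa <= nu1 / (4 * Y) by rewrite !ge_min lexx !orbT.
  by rewrite invfM mulrA ler_pdivlMr.
exists kappa, (2 ^ m0)%N; split=> [|N N0]; first by rewrite c0 /=; lra.
have Ngt0 : (0 < N)%N by rewrite (leq_trans _ N0) // expn_gt0.
split=> //; set r := gevrey_radius kappa N.
have /andP[] := gevrey_radius_bounds c0 Ngt0; rewrite -/r => r0 r1.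
(* the margin in 2^-m leaves room for the increments 2^-m / 48 of [step_decay] *)
have H i : (2 ^ (m0 + i) <= 2 * N)%N ->
    nrm (r * radius_factor (m0 + i)) (2 ^ (m0 + i)) (dtheta (lindstedt (2 ^ (m0 + i))))
      <= 1 / 12 - 1 / 24 * 2^-1 ^+ (m0 + i).
  elim: i => [|i IH] Hi.
    rewrite addn0; have /andP[f1 f2] := radius_factor_bounds (R := R) m0.
    have q : 0 <= (2^-1 : R) ^+ m0 <= 1 by rewrite exprn_ge0 ?exprn_ile1 //; lra.
    have rf : 0 <= r * radius_factor m0 <= 1.
      rewrite mulr_ge0 ?(ltW r0) //=; last by lra.
      by have := ler_pM (ltW r0) (le_trans ler01 f1) r1 f2; lra.
    apply: (@le_trans _ _ (1 / 24)); last by lra.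
    rewrite -[r * _]mulr1; apply: le_trans (nrm_shrink _ rf ler01 _) _.
      by apply: vanishes_fmult; exact: vanishes1_lindstedt.
    rewrite -/X0 expr1.
    have h : r * radius_factor m0 <= 1 / (24 * (X0 + 1)).
      have := ler_pM (ltW r0) (le_trans ler01 f1) r1 f2.
      move=> h; apply: le_trans h _; rewrite -ler_pdivlMr //.
      by apply: le_trans cle2 _; rewrite le_eqVlt; apply/orP; left; apply/eqP; field; lra.
    apply: le_trans (ler_wpM2r X00 h) _.
    by rewrite mulrAC mul1r ler_pdivrMr ?mulr_gt0 //; lra.
  have Hi' : (2 ^ (m0 + i) <= 2 * N)%N.
    by apply: leq_trans Hi; rewrite leq_exp2l // addnS.
  have {}IH := IH Hi'; move: Hi; rewrite addnS; set m := (m0 + i)%N in IH Hi' * => Hi.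
  have m0m : (m0 <= m)%N by exact: leq_addr.
  have E2 : (2 ^ m.+1 = 2 ^ m + 2 ^ m)%N by rewrite expnS mul2n addnn.
  have /andP[f1 f2] := radius_factor_bounds (R := R) m.
  have /andP[g1 g2] := radius_factor_bounds (R := R) m.+1.
  have fr : 0 <= r * radius_factor m <= 1.
    rewrite mulr_ge0 ?(ltW r0) //=; last by lra.
    by have := ler_pM (ltW r0) (le_trans ler01 f1) r1 f2; lra.
  have xE : r * radius_factor m.+1 = shrink_factor m * (r * radius_factor m).
    by rewrite /shrink_factor; field; lra.
  have q : 0 <= (2^-1 : R) ^+ m <= 1 by rewrite exprn_ge0 ?exprn_ile1 //; lra.
  have D := m0P m m0m.
  rewrite E2 xE; apply: le_trans (dyadic_step _ fr (shrink_factor_bounds m) _ _) _.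
  - by rewrite expn_gt0.
  - rewrite -xE -E2; apply: gevrey_radius_divisor => //; [lra|lra|].
    by rewrite expn_gt0.
  - by apply: le_trans IH _; lra.
  apply: le_trans (lerD IH D) _; rewrite exprS; lra.
set m := trunc_log 2 N.
have /andP[mN Nm] : (2 ^ m <= N < 2 ^ m.+1)%N by exact: trunc_log_bounds.
have m0m : (m0 <= m.+1)%N.
  by rewrite -(@leq_exp2l 2) // (leq_trans N0) // ltnW.
have := H (m.+1 - m0)%N; rewrite subnKC // => Hm.
have {}Hm := Hm _; have /Hm {}Hm : (2 ^ m.+1 <= 2 * N)%N by rewrite expnS leq_mul2l mN orbT.
have st : vanishes N.+1 (dtheta (lindstedt N.+1) - dtheta (lindstedt (2 ^ m.+1))).
  rewrite -opprB -dthetaB; apply/vanishesN/vanishes_fmult.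
  exact: lindstedt_stable.
rewrite (eq_nrm _ st); apply: le_trans (nrmWM _ (ltW r0) Nm) _.
have /andP[f1 f2] := radius_factor_bounds (R := R) m.+1.
have rr : r <= r * radius_factor m.+1 by rewrite ler_peMr ?(ltW r0).
apply: le_trans (nrmWr _ _ (ltW r0) rr) _; apply: le_trans Hm _.
have q : 0 <= (2^-1 : R) ^+ m.+1 by rewrite exprn_ge0.
lra.
Qed.

End Gevrey.

(** * Taylor remainder of the complex exponential *)

Section ComplexAnalysis.
Context {R : realType}.
Implicit Types (z w h : R[i]) (g : R[i] -> R[i]).

Lemma complex_normE z : `|z| = (normc z)%:C.
Proof. by rewrite normc_def; case: z. Qed.

Lemma complex_ltE (e : R[i]) z : (0 < e) -> (`|z| < e) = (normc z < complex.Re e).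
Proof.
rewrite complex_normE; case: e => a b; rewrite !ltcE /= => /andP[/eqP -> _].
by rewrite eqxx.
Qed.

Lemma nbhs_complexP (P : R[i] -> Prop) (z : R[i]) :
  (\forall w \near (z : R[i]^o), P w) <->
  exists2 e : R, 0 < e & forall w, normc (w - z) < e -> P w.
Proof.
split=> [/nbhs_normP [e /= e0 zeP]|[e e0 zeP]].
  exists (complex.Re e) => [|w we]; first by move: e0; rewrite ltcE => /andP[].
  by apply: zeP => /=; rewrite distrC complex_ltE.
apply/nbhs_normP; exists e%:C; first by rewrite /= ltcR.
by move=> w /=; rewrite distrC complex_ltE ?ltcR // => /zeP.
Qed.

Lemma cvg_complexP (u : nat -> R[i]) (l : R[i]) :
  ((u : nat -> R[i]^o) @ \oo --> (l : R[i]^o)) <->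
  forall e : R, 0 < e -> exists N0 : nat, forall N, (N0 <= N)%N -> normc (u N - l) < e.
Proof.
split=> [/cvgrPdist_lt H e e0|H].
  have := H e%:C; rewrite ltcR => /(_ e0) [N0 _ HN]; exists N0 => N NN.
  by have := HN N NN; rewrite /= distrC complex_ltE ?ltcR.
apply/cvgrPdist_lt => e e0; have e0' : 0 < complex.Re e by move: e0; rewrite ltcE => /andP[].
have [N0 HN] := H _ e0'; exists N0 => // N /= /HN.
by rewrite distrC complex_ltE.
Qed.

Lemma cderive_eq g z (l : R[i]) (B : R) :
  (forall h, normc h <= 1 -> normc (g (h + z) - g z - h * l) <= B * normc h ^+ 2) ->
  cderive g z = l.
Proof.
move=> H; rewrite /cderive /derive1.
apply: (@cvg_lim (R[i]^o)); first exact: norm_hausdorff.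
apply/cvgrPdist_lt => e e0; rewrite near_withinE; apply/nbhs_complexP.
have e0' : 0 < complex.Re e by move: e0; rewrite ltcE => /andP[].
set B1 := Num.max B 1; have B10 : 0 < B1 by rewrite lt_max ltr01 orbT.
exists (Num.min 1 (complex.Re e / B1)).
  by rewrite lt_min ltr01 divr_gt0.
move=> h; rewrite subr0 lt_min => /andP[h1 he] h0.
have nh : 0 < normc h.
  by rewrite lt_neqAle normc_ge0 eq_sym andbT; apply/eqP => /eq0_normc /eqP; apply/negP.
rewrite complex_ltE //.
have -> : l - h^-1 *: (g (h + z) - g z) = - (h^-1 * (g (h + z) - g z - h * l)).
  by rewrite -[h^-1 *: _]/(h^-1 * _) [in RHS]mulrBr (mulrA _ h) mulVf // mul1r opprB.
rewrite normcN normcM normcV mulrC ltr_pdivrMr //.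
apply: le_lt_trans (H h (ltW h1)) _.
rewrite expr2 mulrA ltr_pM2r //; apply: (@le_lt_trans _ _ (B1 * normc h)).
  by rewrite ler_wpM2r ?normc_ge0 // le_max lexx.
by rewrite mulrC -ltr_pdivlMr.
Qed.

Lemma abs_Re_le z : `|complex.Re z| <= normc z.
Proof.
case: z => a b /=; rewrite -(sqrtr_sqr a) ler_wsqrtr // lerDl sqr_ge0 //.
Qed.

Lemma abs_Im_le z : `|complex.Im z| <= normc z.
Proof.
case: z => a b /=; rewrite -(sqrtr_sqr b) ler_wsqrtr // lerDr sqr_ge0 //.
Qed.

Lemma normc_le_ReIm z : normc z <= `|complex.Re z| + `|complex.Im z|.
Proof.
case: z => a b /=; rewrite -[leRHS]ger0_norm ?addr_ge0 // -sqrtr_sqr ler_wsqrtr //.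
by rewrite sqrrD !real_normK ?num_real // addrAC lerDl mulrn_wge0 // mulr_ge0.
Qed.

(** The Taylor sum of exp at t w, seen through f as a real polynomial in t; f is
    the real or the imaginary part. *)
Definition exp_poly (N : nat) (f : R[i] -> R) w : {poly R} :=
  \poly_(m < N) f (w ^+ m / (m`!)%:R).

Definition exp_sum (N : nat) w : R[i] := \sum_(m < N) w ^+ m / (m`!)%:R.

Lemma exp_polyS N f w : (forall n z, f (z *+ n) = f z *+ n) ->
  deriv (exp_poly N.+1 f w) = exp_poly N (fun z => f (w * z)) w.
Proof.
move=> fn; apply/polyP => m; rewrite coef_deriv !coef_poly ltnS.
case: ltnP => // _; last by rewrite mul0rn.
rewrite -fn; congr f; rewrite factS natrM exprS -mulr_natr.
have h1 : (m.+1%:R : R[i]) != 0 by rewrite pnatr_eq0.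
have h2 : ((m`!)%:R : R[i]) != 0 by rewrite pnatr_eq0 -lt0n fact_gt0.
by field; rewrite h2 nat1r h1.
Qed.

Definition exp_rest N w (t : R) : R[i] := cexp (t%:C * w) - exp_sum N (t%:C * w).

Lemma cexp_real_mul (t : R) w : cexp (t%:C * w) =
  (expR (t * complex.Re w) * cos (t * complex.Im w)) +i*
  (expR (t * complex.Re w) * sin (t * complex.Im w)).
Proof.
case: w => a b; rewrite /cexp /= !mul0r subr0 addr0.
by apply/eqP; rewrite eq_complex /= !mul0r subr0 addr0 !eqxx.
Qed.

Lemma derive_expcos (a b t : R) (q : {poly R}) :
  is_derive t (1 : R) (fun x : R => expR (x * a) * cos (x * b) - q.[x])
    (expR (t * a) * (a * cos (t * b) - b * sin (t * b)) - (deriv q).[t]).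
Proof.
have -> : (fun x : R => expR (x * a) * cos (x * b) - q.[x]) =
  ((expR \o horner (a *: 'X)) * (cos \o horner (b *: 'X)) - horner q : R -> R).
  by apply/funext => x; rewrite !fctE /= !hornerE ![_ * x]mulrC.
apply: is_derive_eq.
rewrite -[LHS]/(expR (a *: 'X).[t] * (- sin (b *: 'X).[t] * (deriv (b *: 'X)).[t]) +
  cos (b *: 'X).[t] * (expR (a *: 'X).[t] * (deriv (a *: 'X)).[t]) - (deriv q).[t]).
by rewrite !(derivZ, derivX, hornerZ, hornerX, hornerC) [a * t]mulrC [b * t]mulrC; ring.
Qed.

Lemma derive_expsin (a b t : R) (q : {poly R}) :
  is_derive t (1 : R) (fun x : R => expR (x * a) * sin (x * b) - q.[x])
    (expR (t * a) * (a * sin (t * b) + b * cos (t * b)) - (deriv q).[t]).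
Proof.
have -> : (fun x : R => expR (x * a) * sin (x * b) - q.[x]) =
  ((expR \o horner (a *: 'X)) * (sin \o horner (b *: 'X)) - horner q : R -> R).
  by apply/funext => x; rewrite !fctE /= !hornerE ![_ * x]mulrC.
apply: is_derive_eq.
rewrite -[LHS]/(expR (a *: 'X).[t] * (cos (b *: 'X).[t] * (deriv (b *: 'X)).[t]) +
  sin (b *: 'X).[t] * (expR (a *: 'X).[t] * (deriv (a *: 'X)).[t]) - (deriv q).[t]).
by rewrite !(derivZ, derivX, hornerZ, hornerX, hornerC) [a * t]mulrC [b * t]mulrC; ring.
Qed.

Lemma exp_poly_horner (f : R[i] -> R) N w (t : R) :
  (forall x y, f (x + y) = f x + f y) -> (forall (x : R) y, f (x%:C * y) = x * f y) ->
  (exp_poly N f w).[t] = f (exp_sum N (t%:C * w)).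
Proof.
move=> fD fZ; have f0 : f 0 = 0 by have := fZ 0 0; rewrite !mul0r.
rewrite horner_poly /exp_sum (big_morph f fD f0); apply: eq_bigr => m _.
by rewrite exprMn -rmorphXn -mulrA fZ mulrC.
Qed.

Lemma ReM_real (x : R) y : complex.Re (x%:C * y) = x * complex.Re y.
Proof. by case: y => a b /=; rewrite mul0r subr0. Qed.

Lemma ImM_real (x : R) y : complex.Im (x%:C * y) = x * complex.Im y.
Proof. by case: y => a b /=; rewrite mul0r addr0. Qed.

Lemma complexReD (x y : R[i]) : complex.Re (x + y) = complex.Re x + complex.Re y.
Proof. by case: x y => a b [c e]. Qed.

Lemma complexReB (x y : R[i]) : complex.Re (x - y) = complex.Re x - complex.Re y.
Proof. by case: x y => a b [c e]. Qed.

Lemma complexImB (x y : R[i]) : complex.Im (x - y) = complex.Im x - complex.Im y.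
Proof. by case: x y => a b [c e]. Qed.

Lemma complexImD (x y : R[i]) : complex.Im (x + y) = complex.Im x + complex.Im y.
Proof. by case: x y => a b [c e]. Qed.

Lemma is_derive_exp_rest_Re N w (t : R) :
  is_derive t (1 : R) (fun x : R => complex.Re (exp_rest N.+1 w x)) (complex.Re (w * exp_rest N w t)).
Proof.
have := derive_expcos (complex.Re w) (complex.Im w) t (exp_poly N.+1 (@complex.Re R) w).
rewrite exp_polyS => [|n [a b]]; last by rewrite -mulr_natl -(rmorph_nat (real_complex R)) ReM_real mulr_natl.
rewrite exp_poly_horner => [|x y|x y]; last 2 first.
- by rewrite mulrDr complexReD.
- by rewrite mulrCA ReM_real.
congr (is_derive _ _ _ _).
  by apply/funext => x; rewrite (exp_poly_horner _ _ _ complexReD ReM_real)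
    /exp_rest cexp_real_mul [in RHS]complexReB.
rewrite /exp_rest [in RHS]mulrBr [in RHS]complexReB; congr (_ - _); rewrite cexp_real_mul.
by case: w => a b /=; ring.
Qed.

Lemma is_derive_exp_rest_Im N w (t : R) :
  is_derive t (1 : R) (fun x : R => complex.Im (exp_rest N.+1 w x)) (complex.Im (w * exp_rest N w t)).
Proof.
have := derive_expsin (complex.Re w) (complex.Im w) t (exp_poly N.+1 (@complex.Im R) w).
rewrite exp_polyS => [|n [a b]]; last by rewrite -mulr_natl -(rmorph_nat (real_complex R)) ImM_real mulr_natl.
rewrite exp_poly_horner => [|x y|x y]; last 2 first.
- by rewrite mulrDr complexImD.
- by rewrite mulrCA ImM_real.
congr (is_derive _ _ _ _).
  by apply/funext => x; rewrite (exp_poly_horner _ _ _ complexImD ImM_real)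
    /exp_rest cexp_real_mul [in RHS]complexImB.
rewrite /exp_rest [in RHS]mulrBr [in RHS]complexImB; congr (_ - _); rewrite cexp_real_mul.
by case: w => a b /=; ring.
Qed.

Lemma exp_rest0 N w : exp_rest N.+1 w 0 = 0.
Proof.
rewrite /exp_rest mul0r cexp0 /exp_sum big_ord_recl expr0 divr1 big1 ?addr0 ?subrr //.
by move=> i _; rewrite expr0n mul0r.
Qed.

(** The derivative in t of the remainder of order N + 1 is w times the
    remainder of order N. The mean value theorem holds for real-valued functions, so
    it is applied to the real and the imaginary part, which costs a factor 2 at each
    order. *)
Lemma exp_rest_bound N w (t : R) : 0 <= t <= 1 ->
  normc (exp_rest N w t) <= (2 * normc w) ^+ N * expR (normc w).
Proof.
elim: N t => [|N IH] t /andP[t0 t1].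
  rewrite /exp_rest /exp_sum big_ord0 subr0 expr0 mul1r normc_cexp ler_expR ReM_real.
  apply: le_trans (ler_norm _) _; rewrite normrM (ger0_norm t0).
  by rewrite -[leRHS]mul1r ler_pM ?normr_ge0 ?abs_Re_le.
have key (f : R[i] -> R) : (forall z, `|f z| <= normc z) -> f 0 = 0 ->
    (forall x : R, is_derive x (1 : R) (fun x => f (exp_rest N.+1 w x)) (f (w * exp_rest N w x))) ->
    `|f (exp_rest N.+1 w t)| <= normc w * ((2 * normc w) ^+ N * expR (normc w)).
  move=> fle f0 fd.
  have [|c] := @MVT_segment R (fun x => f (exp_rest N.+1 w x))
    (fun x => f (w * exp_rest N w x)) 0 t t0 (fun x _ => fd x).
    apply/continuous_subspaceT => x.
    apply/differentiable_continuous/derivable1_diffP.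
    by case: (fd x).
  rewrite in_itv /= exp_rest0 f0 !subr0 => /andP[c0 ct] ->.
  rewrite normrM (ger0_norm t0); apply: (@le_trans _ _ (`|f (w * exp_rest N w c)| * 1)).
    by rewrite ler_wpM2l.
  rewrite mulr1; apply: le_trans (fle _) _; rewrite normcM ler_wpM2l ?normc_ge0 //.
  by apply: IH; rewrite c0 (le_trans ct).
have kRe := key _ abs_Re_le erefl (is_derive_exp_rest_Re N w).
have kIm := key _ abs_Im_le erefl (is_derive_exp_rest_Im N w).
apply: le_trans (normc_le_ReIm _) _; apply: le_trans (lerD kRe kIm) _.
by rewrite exprS le_eqVlt; apply/orP; left; apply/eqP; ring.
Qed.

Lemma cexp_taylor N w :
  normc (cexp w - exp_sum N w) <= (2 * normc w) ^+ N * expR (normc w).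
Proof.
have := @exp_rest_bound N w 1; rewrite /exp_rest mul1r; apply.
by rewrite ler01 lexx.
Qed.

End ComplexAnalysis.

(** * Trigonometric polynomials as entire functions *)

Section TrigonometricSums.
Context {R : realType}.
Implicit Types (z w h : R[i]) (g : R[i] -> R[i]) (l : seq (int * R[i])).

Definition trigsum l z : R[i] := \sum_(p <- l) p.2 * fourier p.1 z.

Definition dtrig l : seq (int * R[i]) := [seq (p.1, p.2 * wavenumber p.1) | p <- l].

Definition trig_size l : R := \sum_(p <- l) normc (wavenumber p.1 : R[i]).

Lemma le_trig_size l p : p \in l -> normc (wavenumber p.1 : R[i]) <= trig_size l.
Proof.
move=> pl; rewrite /trig_size (big_rem p) // lerDl; apply: sumr_ge0 => q _.
exact: normc_ge0.
Qed.

Lemma trig_size_ge0 l : 0 <= trig_size l.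
Proof. by rewrite sumr_ge0 // => p _; exact: normc_ge0. Qed.

Definition trig_mass l z : R := \sum_(p <- l) normc (p.2 * fourier p.1 z).

(** The frequencies of l are bounded by [trig_size], so the remainders of the
    exponentials of all the modes have a common geometric bound. *)
Lemma trigsum_taylor l z N h : normc h <= 1 ->
  normc (trigsum l (z + h) - \sum_(p <- l) p.2 * fourier p.1 z * exp_sum N (wavenumber p.1 * h))
    <= trig_mass l z * expR (trig_size l) * (2 * trig_size l * normc h) ^+ N.
Proof.
move=> h1; rewrite /trigsum -sumrB /trig_mass !mulr_suml.
apply: le_trans (normc_sum _ _ _) _; rewrite big_seq [leRHS]big_seq.
apply: ler_sum => p pl; rewrite fourierDr mulrA -mulrBr normcM -mulrA.
rewrite ler_wpM2l ?normc_ge0 //; apply: le_trans (cexp_taylor _ _) _.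
have ps := le_trig_size pl.
rewrite mulrC normcM ler_pM ?expR_ge0 ?exprn_ge0 ?mulr_ge0 ?normc_ge0 //.
  by rewrite ler_expR -[leRHS]mulr1 ler_pM ?normc_ge0.
apply: lerXn2r; rewrite ?nnegrE ?mulr_ge0 ?normc_ge0 ?trig_size_ge0 //.
by rewrite mulrA ler_wpM2r ?normc_ge0 // ler_wpM2l.
Qed.

Lemma exp_sum2 w : exp_sum 2 w = 1 + w.
Proof. by rewrite /exp_sum !big_ord_recr big_ord0 /= add0r expr0 expr1 !divr1. Qed.

Lemma exp_sum1 w : exp_sum 1 w = 1.
Proof. by rewrite /exp_sum !big_ord_recr big_ord0 /= add0r expr0 divr1. Qed.

Lemma trigsum_quadratic l z : exists B : R, forall h, normc h <= 1 ->
  normc (trigsum l (h + z) - trigsum l z - h * trigsum (dtrig l) z) <= B * normc h ^+ 2.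
Proof.
exists (trig_mass l z * expR (trig_size l) * (2 * trig_size l) ^+ 2) => h h1.
rewrite -[leRHS]mulrA -exprMn; apply: le_trans (trigsum_taylor l z 2 h1).
rewrite le_eqVlt; apply/orP; left; apply/eqP; congr normc.
rewrite (addrC h) -addrA -opprD; congr (_ - _).
rewrite /trigsum /dtrig big_map mulr_sumr -big_split /=.
by apply: eq_bigr => p _; rewrite exp_sum2; ring.
Qed.

Lemma cderive_trigsum l : cderive (trigsum l) = trigsum (dtrig l).
Proof.
apply/funext => z; have [B HB] := trigsum_quadratic l z; exact: cderive_eq HB.
Qed.

Lemma iter_cderive_trigsum l m z : iter m cderive (trigsum l) z =
  \sum_(p <- l) p.2 * wavenumber p.1 ^+ m * fourier p.1 z.
Proof.
have -> : iter m cderive (trigsum l) = trigsum (iter m dtrig l).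
  by elim: m => //= m ->; rewrite cderive_trigsum.
rewrite /trigsum; have -> : iter m dtrig l = [seq (p.1, p.2 * wavenumber p.1 ^+ m) | p <- l].
  elim: m => [|m IH] /=.
    by rewrite -[LHS]map_id; apply: eq_map => -[k c]; rewrite expr0 mulr1.
  by rewrite IH /dtrig -map_comp; apply: eq_map => p /=; rewrite exprSr mulrA.
by rewrite big_map.
Qed.

Lemma trigsum_lipschitz l z : exists2 B : R, 0 < B & forall h, normc h <= 1 ->
  normc (trigsum l (z + h) - trigsum l z) <= B * normc h.
Proof.
exists (trig_mass l z * expR (trig_size l) * (2 * trig_size l) + 1) => [|h h1].
  rewrite ltr_wpDl // !mulr_ge0 ?expR_ge0 ?trig_size_ge0 // sumr_ge0 // => p _.
  exact: normc_ge0.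
rewrite mulrDl mul1r ler_wpDr ?normc_ge0 //.
rewrite -[leRHS]mulrA -[2 * _ * _]expr1; apply: le_trans (trigsum_taylor l z 1 h1).
rewrite le_eqVlt; apply/orP; left; apply/eqP; congr (normc (_ - _)).
by apply: eq_bigr => p _; rewrite exp_sum1 mulr1.
Qed.

Lemma analytic_trigsum l z : analytic_at (trigsum l) z.
Proof.
exists (fun n => \sum_(p <- l) p.2 * fourier p.1 z * (wavenumber p.1 ^+ n / (n`!)%:R)).
apply/nbhs_complexP; set K := trig_size l; have K0 : 0 <= K by exact: trig_size_ge0.
exists (1 / (4 * (K + 1))) => [|w wz]; first by rewrite divr_gt0 // mulr_gt0 //; lra.
set h := w - z in wz *.
have h4 : normc h * (4 * (K + 1)) < 1 by rewrite -ltr_pdivlMr // mulr_gt0 //; lra.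
have h1 : normc h <= 1 by have := normc_ge0 h; nra.
have h2 : 2 * K * normc h <= 1 / 2 by have := normc_ge0 h; nra.
have h0 : 0 <= 2 * K * normc h by rewrite !mulr_ge0 ?normc_ge0.
set A := trig_mass l z * expR K.
have A0 : 0 <= A.
  by rewrite mulr_ge0 ?expR_ge0 // sumr_ge0 // => p _; exact: normc_ge0.
apply/cvg_complexP => e e0; have [N0 HN0] := nat_above ((A + 1) / e).
exists N0 => N NN.
have -> : \sum_(0 <= n < N) (\sum_(p <- l) p.2 * fourier p.1 z *
    (wavenumber p.1 ^+ n / (n`!)%:R)) * h ^+ n =
   \sum_(p <- l) p.2 * fourier p.1 z * exp_sum N (wavenumber p.1 * h).
  rewrite big_mkord (eq_bigr _ (fun i _ => mulr_suml _ _ _ _)) exchange_big /=.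
  apply: eq_bigr => p _; rewrite /exp_sum mulr_sumr; apply: eq_bigr => i _.
  by rewrite exprMn; move: (_^-1) => x; ring.
rewrite -normcN opprB; have := trigsum_taylor l z N h1.
have -> : z + h = w by rewrite /h addrC subrK.
move/le_lt_trans; apply; rewrite -/K -/A.
apply: (@le_lt_trans _ _ (A * (1 / 2) ^+ N)).
  by rewrite ler_wpM2l //; apply: lerXn2r; rewrite ?nnegrE.
have e2 : (A + 1) / e <= 2 ^+ N.
  apply: le_trans HN0 _; apply: le_trans (le_2expn N0) _; rewrite ler_eXn2l // ltr1n //.
rewrite expr_div_n expr1n mulrA mulr1 ltr_pdivrMr ?exprn_gt0 //.
by rewrite ler_pdivrMr // mulrC in e2; lra.
Qed.

Lemma continuous_trigsum l : continuous (trigsum l : R[i]^o -> R[i]^o).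
Proof.
move=> z; apply/(@cvgrPdist_lt _ R[i]^o _ _ (nbhs_filter (z : R[i]^o))) => e e0; apply/nbhs_complexP.
have e0' : 0 < complex.Re e by move: e0; rewrite ltcE => /andP[].
have [B B0 HB] := trigsum_lipschitz l z.
exists (Num.min 1 (complex.Re e / B)); first by rewrite lt_min ltr01 divr_gt0.
move=> w; rewrite lt_min => /andP[w1 we]; rewrite distrC complex_ltE //.
have := HB (w - z) (ltW w1); rewrite (_ : z + (w - z) = w); last by rewrite addrC subrK.
move/le_lt_trans; apply.
by rewrite mulrC -ltr_pdivlMr.
Qed.

Lemma fourier_nat n z : fourier n%:Z z = fourier 1 z ^+ n.
Proof.
elim: n => [|n IH]; first by rewrite fourier0.
by rewrite -addn1 PoszD fourierDl IH addn1 exprSr.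
Qed.

Lemma fourier_period k z : fourier k (z + 1) = fourier k z.
Proof.
have f11 : fourier 1 (1 : R[i]) = 1.
  rewrite fourierE mulr1 /cexp /= (_ : 2 * pi * 1 = pi *+ 2); last by rewrite mulr1 mulr_natl.
  by rewrite expR0 cos2pi sin2pi mul1r.
have fn n : fourier n%:Z (1 : R[i]) = 1 by rewrite fourier_nat f11 expr1n.
rewrite fourierDr; suff -> : fourier k (1 : R[i]) = 1 by rewrite mulr1.
case: k => n; first exact: fn.
by have := fourierN n.+1%:Z (1 : R[i]); rewrite fn mulr1 NegzE.
Qed.

Lemma trigsum_period l z : trigsum l (z + 1) = trigsum l z.
Proof. by apply: eq_bigr => p _; rewrite fourier_period. Qed.

Lemma analytic_strip_trigsum rho l : analytic_strip rho (trigsum l).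
Proof.
split=> [z _|z _|]; [exact: trigsum_period | exact: analytic_trigsum|].
exact/continuous_subspaceT/continuous_trigsum.
Qed.

Lemma is_derive_quadratic (f : R -> R) (t l B : R) :
  (forall h : R, `|h| <= 1 -> `|f (h + t) - f t - h * l| <= B * h ^+ 2) ->
  is_derive t (1 : R) f l.
Proof.
move=> H.
have C : (fun h : R => h^-1 *: ((f \o shift t) (h *: (1 : R)) - f t)) @ 0^' --> l.
  apply/cvgrPdist_lt => e e0; rewrite near_withinE; apply/nbhs_normP.
  set B1 := Num.max B 1; have B10 : 0 < B1 by rewrite lt_max ltr01 orbT.
  exists (Num.min 1 (e / B1)); first by rewrite /= lt_min ltr01 divr_gt0.
  move=> h /=; rewrite sub0r normrN lt_min => /andP[h1 he] h0.
  have nh : 0 < `|h| by rewrite normr_gt0.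
  have -> : l - h^-1 *: (f (h *: 1 + t) - f t) = - (h^-1 * (f (h + t) - f t - h * l)).
    rewrite -[h *: 1]/(h * 1) mulr1 -[h^-1 *: _]/(h^-1 * _) [in RHS]mulrBr (mulrA _ h).
    by rewrite mulVf // mul1r opprB.
  rewrite normrN normrM normfV mulrC ltr_pdivrMr //.
  apply: le_lt_trans (H h (ltW h1)) _.
  rewrite -(real_normK (num_real h)) expr2 mulrA ltr_pM2r //.
  apply: (@le_lt_trans _ _ (B1 * `|h|)).
    by rewrite ler_wpM2r // le_max lexx.
  by rewrite mulrC -ltr_pdivlMr.
split; first by apply/cvg_ex; exists l.
by apply: cvg_lim C; exact: norm_hausdorff.
Qed.

Lemma is_derive_trigsum (f : R[i] -> R) l (t : R) :
  (forall x y, f (x + y) = f x + f y) -> (forall (x : R) y, f (x%:C * y) = x * f y) ->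
  (forall z, `|f z| <= normc z) ->
  is_derive t (1 : R) (fun x : R => f (trigsum l x%:C)) (f (trigsum (dtrig l) t%:C)).
Proof.
move=> fD fZ fle; have [B HB] := trigsum_quadratic l t%:C.
have fN x : f (- x) = - f x by have := fZ (-1) x; rewrite rmorphN1 !mulN1r.
apply: (@is_derive_quadratic _ _ _ B) => h h1.
have nh : normc h%:C = `|h| by rewrite /= expr0n addr0 sqrtr_sqr.
have := HB h%:C; rewrite nh => /(_ h1); rewrite real_normK ?num_real // => {}HB.
apply: le_trans HB; rewrite -fZ -!fN -!fD rmorphD; exact: fle.
Qed.

(** Without a zero mode, a trigonometric sum has a primitive of the same
    kind, which is periodic. *)
Lemma Rintegral_trigsum (f : R[i] -> R) l :
  (forall x y, f (x + y) = f x + f y) -> (forall (x : R) y, f (x%:C * y) = x * f y) ->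
  (forall z, `|f z| <= normc z) -> all (fun p => p.1 != 0) l ->
  \int[lebesgue_measure]_(t in `[0, 1]) f (trigsum l t%:C) = 0.
Proof.
move=> fD fZ fle l0; set l' := [seq (p.1, p.2 / wavenumber p.1) | p <- l].
have l'E : dtrig l' = l.
  rewrite /dtrig /l' -map_comp -[RHS]map_id; apply/eq_in_map => -[k c] /(allP l0) /= k0.
  rewrite divfK //; apply/eqP => K0; have := @normc_wavenumber R k; rewrite K0 normc0.
  by move/esym/eqP; rewrite mulf_eq0 gt_eqF ?mulr_gt0 ?pi_gt0 //= pnatr_eq0 absz_eq0 (negbTE k0).
have dF t := is_derive_trigsum l' t fD fZ fle.
have cts m (t : R) : {for t, continuous (fun x : R => f (trigsum m x%:C))}.
  apply/differentiable_continuous/derivable1_diffP.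
  by case: (is_derive_trigsum m t fD fZ fle).
rewrite /Rintegral (@continuous_FTC2 _ _ (fun x : R => f (trigsum l' x%:C))) //.
- rewrite -EFinB /= (_ : 1%:C = 0%:C + 1) ?trigsum_period ?subrr //.
  by rewrite add0r.
- exact/continuous_subspaceT/cts.
- split=> [t _||]; first by case: (dF t).
  + by apply: cvg_at_right_filter; exact: cts.
  + by apply: cvg_at_left_filter; exact: cts.
- by move=> t _; rewrite derive1E; case: (dF t) => _ ->; rewrite l'E.
Qed.

Lemma circle_integral_trigsum l : all (fun p => p.1 != 0) l ->
  circle_integral (trigsum l) = 0.
Proof.
move=> l0; rewrite /circle_integral.
rewrite (Rintegral_trigsum (@complexReD R) (@ReM_real R) (@abs_Re_le R) l0).
by rewrite (Rintegral_trigsum (@complexImD R) (@ImM_real R) (@abs_Im_le R) l0).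
Qed.

End TrigonometricSums.

(** * Products of formal power series *)

Section FormalPowerSeries.
Context {R : realType}.
Implicit Types (a b : nat -> R[i]).

Lemma eq_fps_mul a b a' b' n : (forall i, (i <= n)%N -> a i = a' i) ->
  (forall i, (i <= n)%N -> b i = b' i) -> fps_mul a b n = fps_mul a' b' n.
Proof.
by move=> ea eb; apply: eq_bigr => i _; rewrite ea ?eb ?leq_subr // -ltnS.
Qed.

Lemma eq_fps_pow a b m n : (forall i, (i <= n)%N -> a i = b i) ->
  fps_pow a m n = fps_pow b m n.
Proof.
elim: m n => //= m IH n ab; apply: eq_fps_mul => // i ni.
by apply: IH => j ji; rewrite ab // (leq_trans ji).
Qed.

Lemma fps_mul_delta (c : R[i]) k b n :
  fps_mul (fun i => c * (i == k)%:R) b n = if (k <= n)%N then c * b (n - k)%N else 0.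
Proof.
rewrite /fps_mul; case: leqP => kn.
  rewrite (bigD1 (Ordinal (kn : (k < n.+1)%N))) //= eqxx mulr1 big1 ?addr0 // => i ik.
  by rewrite -[(i : nat) == k]/(i == Ordinal (kn : (k < n.+1)%N)) (negbTE ik) mulr0 mul0r.
rewrite big1 // => i _; rewrite ltn_eqF ?mulr0 ?mul0r //.
by rewrite (leq_ltn_trans (leq_ord i)).
Qed.

Lemma fps_mul_eps b n : fps_mul (@fps_eps R) b n = if n is n'.+1 then b n' else 0.
Proof.
have := fps_mul_delta 1 1 b n; rewrite (@eq_fps_mul _ _ (@fps_eps R) b) => [->|i _|//].
  by case: n => [|n] //=; rewrite subSS subn0 mul1r.
by rewrite mul1r.
Qed.

Lemma fps_mul_lambda alpha b n :
  fps_mul (@fps_lambda R alpha) b n = b n - (if (alpha <= n)%N then b (n - alpha)%N else 0).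
Proof.
have := fps_mul_delta 1 0 b n; have := fps_mul_delta 1 alpha b n.
rewrite leq0n subn0 !mul1r => <- <-.
by rewrite /fps_mul -sumrB; apply: eq_bigr => i _; rewrite !mul1r -mulrBl.
Qed.

End FormalPowerSeries.

(* Simplification would expose the real and imaginary parts of the characters. *)
#[local] Opaque fourier cexp.

(** * From formal Fourier series to functions of the angle *)

Section Evaluation.
Context {R : realType} (d : nat).
Local Notation bpoly := {poly {poly R[i]}}.
Implicit Types (a b u : bpoly) (z : R[i]).

(** The value at z of the coefficient of eps^n. In this form, evaluation is
    multiplicative because evaluation of polynomials is. *)
Definition evalc n a z : R[i] := (a`_n).[fourier 1 z] * fourier (- (d * n)%:Z) z.

Definition modes n a : seq (int * R[i]) :=
  [seq (freq d n j, a`_n`_j) | j <- iota 0 (size a`_n)].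

Lemma fourier_freq n j z :
  fourier (freq d n j) z = fourier 1 z ^+ j * fourier (- (d * n)%:Z) z.
Proof. by rewrite /freq fourierDl fourier_nat. Qed.

Lemma evalcE n a z : evalc n a z = \sum_(j < size a`_n) a`_n`_j * fourier (freq d n j) z.
Proof.
rewrite /evalc horner_coef mulr_suml; apply: eq_bigr => j _.
by rewrite fourier_freq; ring.
Qed.

Lemma evalc_trigsum n a z : evalc n a z = trigsum (modes n a) z.
Proof.
rewrite evalcE /trigsum /modes big_map -[in RHS](subn0 (size _)) big_mkord.
by apply: eq_bigr.
Qed.

Lemma evalcD n a b z : evalc n (a + b) z = evalc n a z + evalc n b z.
Proof. by rewrite /evalc coefD hornerD mulrDl. Qed.

Lemma evalcN n a z : evalc n (- a) z = - evalc n a z.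
Proof. by rewrite /evalc coefN hornerN mulNr. Qed.

Lemma evalcB n a b z : evalc n (a - b) z = evalc n a z - evalc n b z.
Proof. by rewrite evalcD evalcN. Qed.

Lemma evalc_eq n a b z : a`_n = b`_n -> evalc n a z = evalc n b z.
Proof. by rewrite /evalc => ->. Qed.

Lemma evalc0 n z : evalc n 0 z = 0.
Proof. by rewrite /evalc coef0 horner0 mul0r. Qed.

Lemma evalc_sum n (I : Type) (r : seq I) (P : pred I) (F : I -> bpoly) z :
  evalc n (\sum_(i <- r | P i) F i) z = \sum_(i <- r | P i) evalc n (F i) z.
Proof. exact: (big_morph _ (fun a b => evalcD n a b z) (evalc0 n z)). Qed.

Lemma evalcM n a b z :
  evalc n (a * b) z = fps_mul (fun i => evalc i a z) (fun i => evalc i b z) n.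
Proof.
rewrite /evalc coefM horner_sum mulr_suml; apply: eq_bigr => i _.
rewrite hornerM; have -> : fourier (- (d * n)%:Z) z =
    fourier (- (d * i)%:Z) z * fourier (- (d * (n - i))%:Z) z.
  by rewrite -fourierDl -opprD -PoszD -mulnDr subnKC // -ltnS.
by ring.
Qed.

Lemma evalc_bcst n c z : evalc n (bcst c) z = c * (n == 0)%:R.
Proof.
rewrite /evalc /bcst coefC; case: n => [|n]; last by rewrite horner0 mul0r mulr0.
by rewrite hornerC muln0 oppr0 fourier0.
Qed.

Lemma evalc_bcstM n c a z : evalc n (bcst c * a) z = c * evalc n a z.
Proof. by rewrite /evalc coefCM hornerM hornerC; ring. Qed.

Lemma evalcX n a m z : evalc n (a ^+ m) z = fps_pow (fun i => evalc i a z) m n.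
Proof.
elim: m n => [|m IH] n.
  by rewrite expr0 -[1]/(bcst 1) evalc_bcst mul1r.
rewrite exprS evalcM; apply: eq_fps_mul => // i _; exact: IH.
Qed.

Lemma evalc_monoM n k j a z : evalc n (mono k j * a) z =
  if (k <= n)%N then fourier (freq d k j) z * evalc (n - k) a z else 0.
Proof.
rewrite /evalc /mono -mulrA coefCM coefXnM; case: ltnP => kn.
  by rewrite mulr0 horner0 mul0r.
rewrite hornerM hornerXn fourier_freq.
have -> : fourier (- (d * n)%:Z) z =
    fourier (- (d * k)%:Z) z * fourier (- (d * (n - k))%:Z) z.
  by rewrite -fourierDl -opprD -PoszD -mulnDr subnKC.
by ring.
Qed.

Lemma evalc_fmult_shift n (t : int -> R[i]) a z w :
  (forall k, fourier k w = t k * fourier k z) ->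
  evalc n (fmult d t a) z = evalc n a w.
Proof.
move=> tw; rewrite !evalcE.
have sz : (size ((fmult d t a)`_n)%R <= size (a`_n)%R)%N.
  by apply/leq_sizeP => j aj; rewrite coef_fmult nth_default ?mulr0.
rewrite (big_ord_widen _ (fun j => (fmult d t a)`_n`_j * fourier (freq d n j) z) sz).
rewrite big_mkcond; apply: eq_bigr => j _.
case: ltnP => [_|nj]; first by rewrite coef_fmult tw; ring.
by have := nth_default 0 nj; rewrite coef_fmult tw mulrCA mulrA => ->; rewrite mul0r.
Qed.

Lemma evalc_advance n omega a z : evalc n (advance d omega a) z = evalc n a (z + omega%:C).
Proof. by apply: evalc_fmult_shift => k; rewrite fourierDr mulrC. Qed.

Lemma evalc_retreat n omega a z : evalc n (retreat d omega a) z = evalc n a (z - omega%:C).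
Proof.
by apply: evalc_fmult_shift => k; rewrite fourierDr fourier_oppr mulrC.
Qed.

Lemma evalc_texp n m c u z : evalc n (texp m c u) z =
  \sum_(i < m) c ^+ i / (i`!)%:R * fps_pow (fun j => evalc j u z) i n.
Proof. by rewrite evalc_sum; apply: eq_bigr => i _; rewrite evalc_bcstM evalcX. Qed.

Lemma evalc_epspow n alpha a z : evalc n (epspow d alpha * a) z =
  if (alpha <= n)%N then evalc (n - alpha) a z else 0.
Proof.
by rewrite evalc_monoM freq_epspow fourier0 mul1r.
Qed.

(** On the strip a mode k with |k| <= d n is at most exp(2 pi rho d n), so the
    width of the strip only affects the geometric part of the bounds. *)
Lemma normc_evalc (rho : R) n a z : cone d a -> 0 <= rho -> `|complex.Im z| <= rho ->
  normc (evalc n a z) <= pnrm a`_n * expR (2 * pi * rho * d%:R) ^+ n.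
Proof.
move=> ca rho0 zrho; rewrite evalcE; apply: le_trans (normc_sum _ _ _) _.
rewrite /pnrm mulr_suml; apply: ler_sum => j _; rewrite normcM.
have [->|aN0] := eqVneq a`_n`_j 0; first by rewrite normc0 !mul0r.
rewrite ler_wpM2l ?normc_ge0 // normc_fourier -expRM_natl ler_expR.
have jn : (j <= 2 * d * n)%N.
  by rewrite leqNgt; apply: contra aN0 => /ca ->.
have fb := freq_bound jn (leqnn n).
apply: le_trans (ler_norm _) _; rewrite normrN !normrM.
rewrite (ger0_norm (pi_ge0 _)) (ger0_norm (_ : 0 <= 2)) // -intr_norm -abszE.
have -> : n%:R * (2 * pi * rho * d%:R) = 2 * pi * (d * n)%:R * rho :> R.
  by rewrite natrM; ring.
apply: ler_pM => //; first by rewrite !mulr_ge0 ?pi_ge0.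
by rewrite ler_wpM2l ?mulr_ge0 ?pi_ge0 // ler_nat.
Qed.

Lemma circle_integral_evalc n a : avg d a = 0 -> circle_integral (evalc n a) = 0.
Proof.
move=> a0; set l := [seq p <- modes n a | p.1 != 0].
have -> : evalc n a = trigsum l.
  apply/funext => z; rewrite evalc_trigsum /trigsum big_filter [LHS](bigID (fun p => p.1 != 0)) /=.
  rewrite [X in _ + X]big1_seq ?addr0 // => p /andP[/negPn/eqP p0 /mapP[j _ pE]].
  rewrite pE in p0 *; rewrite /= in p0 *.
  by move/bpolyP: a0 => /(_ n j); rewrite coef_fmult p0 eqxx !coef0 mul1r => ->; rewrite mul0r.
by apply: circle_integral_trigsum; exact: filter_all.
Qed.

End Evaluation.

(** * Suprema over the strip *)

Section StripNorm.
Context {R : realType}.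
Implicit Types (z : R[i]).

Lemma strip_norm_ge rho (g : R[i] -> R[i]) z : strip rho z ->
  ((normc (g z))%:E <= strip_norm rho g)%E.
Proof. by move=> zr; apply: ereal_sup_ubound; exists z. Qed.

Lemma strip0 rho : 0 <= rho -> strip rho (0 : R[i]).
Proof. by rewrite /strip /= normr0. Qed.

Lemma strip_norm_fin rho (g : R[i] -> R[i]) (B : R) : 0 <= rho ->
  (forall z, strip rho z -> normc (g z) <= B) ->
  exists2 b : R, 0 <= b <= B & strip_norm rho g = b%:E.
Proof.
move=> rho0 gB.
have le1 : (strip_norm rho g <= B%:E)%E.
  by apply: ge_ereal_sup => _ [z zr <-]; rewrite lee_fin gB.
have ge0 : (0 <= strip_norm rho g)%E.
  apply: le_trans (strip_norm_ge g (strip0 rho0)).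
  by rewrite lee_fin normc_ge0.
case: (strip_norm rho g) le1 ge0 => [b| |] //.
by rewrite !lee_fin => b1 b0; exists b; rewrite ?b0.
Qed.

Lemma strip_norm2_le rho (g : R[i] -> 'cV[R[i]]_2) (B0 B1 : R) : 0 <= rho ->
  (forall z, strip rho z -> normc (g z 0 0) <= B0) ->
  (forall z, strip rho z -> normc (g z 1 0) <= B1) ->
  (strip_norm2 rho g <= (B0 + B1)%:E)%E.
Proof.
move=> rho0 H0 H1; rewrite /strip_norm2.
have [b0 /andP[b00 b0B] ->] := strip_norm_fin rho0 H0.
have [b1 /andP[b10 b1B] ->] := strip_norm_fin rho0 H1.
rewrite /= lee_fin -[leRHS]ger0_norm; last by lra.
rewrite -sqrtr_sqr ler_wsqrtr //; nra.
Qed.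

Lemma ord2P (i : 'I_2) : i = 0 \/ i = 1.
Proof. by case: i => [[|[|//]] ?]; [left|right]; exact: val_inj. Qed.

Lemma le_strip_norm2 rho (g : R[i] -> 'cV[R[i]]_2) (B : R) z i : strip rho z ->
  (strip_norm2 rho g <= B%:E)%E -> normc (g z i 0) <= B.
Proof.
move=> zr; rewrite /strip_norm2.
have h0 := strip_norm_ge (fun z => g z 0 0) zr.
have h1 := strip_norm_ge (fun z => g z 1 0) zr.
move: h0 h1; case: (strip_norm _ _) => [b0| |] //; case: (strip_norm _ _) => [b1| |] //.
rewrite /= !lee_fin => h0 h1 H.
have n0 := normc_ge0 (g z 0 0); have n1 := normc_ge0 (g z 1 0).
apply: le_trans H; rewrite -[leLHS]ger0_norm ?normc_ge0 // -sqrtr_sqr ler_wsqrtr //.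
by case: (ord2P i) => ->; nra.
Qed.

End StripNorm.

(** * The normalization matrix is the identity *)

Section Normalization.
Context {R : realType} (omega : R).
Implicit Types (theta : R[i]).

Lemma vec2_0 (x y : R[i]) : vec2 x y 0 0 = x.
Proof. by rewrite /vec2 mxE. Qed.

Lemma vec2_1 (x y : R[i]) : vec2 x y 1 0 = y.
Proof. by rewrite /vec2 mxE. Qed.

Lemma DK0E theta : DK0 omega theta = vec2 1 0.
Proof.
apply/matrixP => i j; rewrite !mxE; case: (ord2P i) => -> /=.
  apply: (@cderive_eq _ _ _ _ 0) => h _; rewrite mul0r.
  by rewrite /K0 !vec2_0 addrK mulr1 subrr normc0.
apply: (@cderive_eq _ _ _ _ 0) => h _; rewrite mul0r.
by rewrite /K0 !vec2_1 subrr mulr0 subrr normc0.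
Qed.

(** K_0 parametrizes a horizontal circle at unit speed, so its tangent and its
    normal are the two vectors of the standard basis. *)
Lemma M0E theta : M0 omega theta = 1%:M.
Proof.
have DD : (DK0 omega theta)^T *m DK0 omega theta = 1%:M.
  rewrite DK0E; apply/matrixP => i j; rewrite !ord1 !mxE !big_ord_recl big_ord0 !mxE /=.
  by rewrite mulr1 mul0r !addr0.
have JJ : (J : 'M[R[i]]_2) *m J^T = 1%:M.
  apply/matrixP => i j; case: (ord2P i) => ->; case: (ord2P j) => ->;
    rewrite !mxE !big_ord_recl big_ord0 !mxE /=; ring.
have [Ju _] := mulmx1_unit JJ.
have Je : (J : 'M[R[i]]_2) *m vec2 0 1 = vec2 1 0.
  apply/matrixP => i j; rewrite ord1; case: (ord2P i) => ->;
    rewrite !mxE !big_ord_recl big_ord0 !mxE /=; ring.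
rewrite /M0 /calN0 DD invmx1 mulmx1 DK0E -Je mulKmx // Je.
apply/matrixP => i j; rewrite mxE; case: splitP => k jk; rewrite ord1 in jk *;
  rewrite !mxE; case: (ord2P i) => ->; case: (ord2P j) jk => -> //.
Qed.

Lemma normalized_comp0 (K : nat -> R[i] -> 'cV[R[i]]_2) n :
  (fun theta => (invmx (M0 omega theta) *m K n theta) 0 0) = (fun theta => K n theta 0 0).
Proof. by apply/funext => theta; rewrite M0E invmx1 mul1mx. Qed.

End Normalization.

(** * The normalized expansion and its Gevrey bounds *)

Section Existence.
Context {R : realType} (d alpha : nat) (omega nu tau : R) (s : seq (int * R[i])).
Local Notation bpoly := {poly {poly R[i]}}.
Implicit Types (z : R[i]).

Hypothesis s_le_d : all (fun p => (`|p.1| <= d)%N) s.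
Hypothesis d_gt0 : (0 < d)%N.
Hypothesis alpha_gt0 : (0 < alpha)%N.
Hypothesis nu_gt0 : 0 < nu.
Hypothesis tau_gt0 : 0 < tau.
Hypothesis omega_dioph : diophantine nu tau omega.

Local Notation inveq := (inveq d alpha omega s).
Local Notation lindstedt := (lindstedt d alpha omega s).

Let irr := diophantine_irrational nu_gt0 omega_dioph.

Definition ucoef n z : R[i] := evalc d n (lindstedt n.+1) z.

(** At the orders n >= 1, x = theta + u and y = x - x(. - omega) have the coefficients
    below; the shift by omega in theta only affects the order 0 of y. *)
Definition Kser n z : 'cV[R[i]]_2 :=
  if n is 0%N then K0 omega z else vec2 (ucoef n z) (ucoef n z - ucoef n (z - omega%:C)).

(** The mean of order n of the equation; the index d n is the frequency 0. *)
Definition muser n : R[i] := (inveq n.+1 (lindstedt n.+1))`_n`_(d * n).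

Lemma evalc_lindstedt n N z : (n < N)%N -> evalc d n (lindstedt N) z = ucoef n z.
Proof.
move=> nN; apply: evalc_eq; apply/eqP; rewrite -subr_eq0 -coefB.
by rewrite lindstedt_stable.
Qed.

Lemma ucoef0 z : ucoef 0 z = 0.
Proof.
rewrite /ucoef (@evalc_eq _ _ _ _ 0) ?evalc0 // coef0.
exact: vanishes1_lindstedt.
Qed.

Lemma muser0 : muser 0 = 0.
Proof.
rewrite /muser (vanishes_inveq _ _ _ _ _ _) ?coef0 //.
exact: vanishes1_lindstedt.
Qed.

Lemma evalc_inveq n z : evalc d n (inveq n.+1 (lindstedt n.+1)) z = muser n.
Proof.
set a := inveq _ _.
have o : (osc d a)`_n = 0 by apply: lindstedt_solves.
have -> : evalc d n a z = evalc d n (avg d a) z.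
  by apply: evalc_eq; rewrite [in LHS](avg_osc d a) coefD o addr0.
have -> : evalc d n (avg d a) z = evalc d n (bcst (muser n) * mono n (d * n)) z.
  apply: evalc_eq; apply/polyP => j.
  rewrite coef_fmult coef_bcstM -[mono _ _]mulr1 coef_monoM leqnn /= subnn.
  rewrite /freq subr_eq0 eqz_nat; case: eqP => [->|jn].
    by rewrite leqnn subnn (coef_bcst 1) mul1r mulr1.
  case: leqP => [dj|_]; last by rewrite mul0r mulr0.
  rewrite (coef_bcst 1) /= subn_eq0 leqNgt ltn_neqAle dj eq_sym /=.
  by move/eqP: jn => ->; rewrite mul0r mulr0.
rewrite evalc_bcstM -[mono _ _]mulr1 evalc_monoM leqnn subnn.
by rewrite /freq subrr fourier0 mul1r (evalc_bcst _ _ 1) !mulr1.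
Qed.

Lemma is_expansion_Kser rho : is_expansion omega rho Kser muser.
Proof.
split=> [//||[//|n] _ i]; first exact: muser0.
have -> : (fun z => Kser n.+1 z i 0) =
    trigsum (modes d n.+1 (if i == 0 then lindstedt n.+2 else
      lindstedt n.+2 - retreat d omega (lindstedt n.+2))).
  apply/funext => z; rewrite -evalc_trigsum /Kser /ucoef /vec2 mxE.
  move: (lindstedt n.+2) => U.
  by case: (ord2P i) => -> /=; rewrite ?evalcB ?evalc_retreat.
exact: analytic_strip_trigsum.
Qed.

Lemma normalized_Kser : normalized omega Kser.
Proof.
move=> [//|n] _; rewrite normalized_comp0.
have -> : (fun theta => Kser n.+1 theta 0 0) = evalc d n.+1 (lindstedt n.+2).
  by apply/funext => z; rewrite /Kser /vec2 mxE.
by apply: circle_integral_evalc; exact: avg_lindstedt.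
Qed.

(** Both sides expand V'(theta + u) in powers of u. The left-hand side uses
    the derivatives of V' at theta, the right-hand side the exponential series of each
    mode. The shift from n to n + 1 is the factor eps of the forcing. *)
Lemma fps_comp_evalc (V : R[i] -> R[i]) (a : nat -> R[i]) n z N (u : bpoly) :
  V = trigsum s -> a 0%N = z -> evalc d 0 u z = 0 ->
  (forall j, (0 < j <= n)%N -> a j = evalc d j u z) -> (n < N)%N -> vanishes 1 u ->
  fps_comp (cderive V) a n = evalc d n.+1 (forcing d s 1 N u) z.
Proof.
move=> -> a0 u0 au nN uv.
have -> : evalc d n.+1 (forcing d s 1 N u) z = evalc d n.+1 (forcing d s 1 n.+1 u) z.
  apply: evalc_eq; apply/eqP; rewrite -subr_eq0 -coefB.
  by rewrite (@forcing_trunc _ d s 1 n.+1 N u nN uv n.+1 (ltnSn _)).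
rewrite /forcing evalc_sum.
rewrite (eq_big_seq (fun p => \sum_(m < n.+1) p.2 * wavenumber p.1 ^+ 1 * fourier p.1 z *
   (wavenumber p.1 ^+ m / (m`!)%:R * fps_pow (fun j => evalc d j u z) m n))); last first.
  move=> p ps; rewrite evalc_monoM /= subSS subn0 evalc_bcstM (freq_forcing s_le_d ps).
  by rewrite evalc_texp mulrA [fourier _ _ * _]mulrC mulr_sumr.
rewrite exchange_big /=; apply: eq_bigr => m _.
rewrite cderive_trigsum a0 iter_cderive_trigsum /dtrig big_map !mulr_suml.
apply: eq_bigr => p _; rewrite /= expr1.
rewrite (@eq_fps_pow _ _ (fun j => evalc d j u z)) => [|[|j] jn]; last 2 first.
- by rewrite u0.
- by rewrite au.
by move: (_^-1) => x; ring.
Qed.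

(** The second component is the scalar equation of [evalc_inveq]. The first
    one follows from it, as the first component of the map is x plus its second
    component, and x(. + omega) = x + y(. + omega). *)
Lemma formal_solution_Kser (V : R[i] -> R[i]) rho : V = trigsum s ->
  formal_solution alpha V omega rho Kser muser.
Proof.
move=> VE n z zr.
have K0E w : Kser 0 w = vec2 w omega%:C by [].
have KE m w : Kser m.+1 w = vec2 (ucoef m.+1 w) (ucoef m.+1 w - ucoef m.+1 (w - omega%:C)) by [].
rewrite /fps_dissipative_map fps_mul_lambda fps_mul_eps.
have yE m w : Kser m w 1 0 = ucoef m w - ucoef m (w - omega%:C) + (m == 0)%:R * omega%:C.
  case: m => [|m]; first by rewrite K0E vec2_1 !ucoef0 subrr mul1r add0r.
  by rewrite KE vec2_1 mul0r addr0.
case: n => [|n].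
  rewrite leqNgt alpha_gt0 /= muser0 /= !vec2_0 !vec2_1 !subr0 !addr0; congr vec2.
have E := evalc_inveq n.+1 z.
have F : fps_comp (cderive V) (fun j => Kser j z 0 0) n =
    evalc d n.+1 (forcing d s 1 n.+2 (lindstedt n.+2)) z.
  apply: fps_comp_evalc => //.
  - by rewrite /= vec2_0.
  - by rewrite evalc_lindstedt // ucoef0.
  - move=> [//|j] /andP[_ jn]; rewrite KE vec2_0 evalc_lindstedt //.
    by rewrite ltnS ltnW.
  - exact: vanishes1_lindstedt.
have lamM a : evalc d n.+1 (lam d alpha * a) z =
    evalc d n.+1 a z - (if (alpha <= n.+1)%N then evalc d (n.+1 - alpha) a z else 0).
  by rewrite lamE mulrBl mul1r evalcB evalc_epspow.
have key : Kser n.+1 z 1 0 - (if (alpha <= n.+1)%N then Kser (n.+1 - alpha) z 1 0 else 0)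
    + muser n.+1 - fps_comp (cderive V) (fun j => Kser j z 0 0) n = Kser n.+1 (z + omega%:C) 1 0.
  rewrite F -E; set U := lindstedt n.+2.
  have -> : inveq n.+2 U = advance d omega U - U - lam d alpha * U
      + lam d alpha * retreat d omega U + bcst omega%:C * (epspow d alpha * 1)
      + forcing d s 1 n.+2 U by rewrite !inveqE; ring.
  rewrite 3!evalcD 2!evalcB !lamM evalc_bcstM evalc_epspow (evalc_bcst _ _ 1) mul1r.
  rewrite evalc_advance !evalc_retreat.
  rewrite !evalc_lindstedt ?ltnS ?leq_subr // !yE addrK.
  by case: ifP => _; ring.
rewrite [RHS]KE addrK; congr vec2; last by rewrite key KE vec2_1 addrK.
transitivity (Kser n.+1 z 0 0 + Kser n.+1 (z + omega%:C) 1 0).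
  by rewrite -key; ring.
by rewrite !KE vec2_0 vec2_1 addrK addrC subrK.
Qed.

Lemma Kser_bounded (rho : R) j : 0 <= rho -> exists B : R, forall z, strip rho z ->
  normc (Kser j z 1 0) <= B /\ normc (if j is 0%N then 0 else Kser j z 0 0) <= B.
Proof.
move=> rho0; case: j => [|j].
  exists `|omega| => z _; rewrite normc0 /Kser /K0 vec2_1 /= expr0n addr0 sqrtr_sqr.
  by rewrite lexx normr_ge0.
set b := pnrm (lindstedt j.+2)`_j.+1 * expR (2 * pi * rho * d%:R) ^+ j.+1.
have ub z : strip rho z -> normc (ucoef j.+1 z) <= b.
  by move=> zr; apply: (normc_evalc _ _ rho0 zr); exact: cone_lindstedt.
have b0 : 0 <= b by rewrite mulr_ge0 ?pnrm_ge0 ?exprn_ge0 ?expR_ge0.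
exists (b + b) => z zr.
have zr' : strip rho (z - omega%:C) by rewrite /strip /= complexImB subr0.
rewrite /Kser vec2_0 vec2_1; split.
  by apply: le_trans (le_normcD _ _) _; rewrite normcN lerD ?ub.
by apply: le_trans (ub z zr) _; rewrite lerDl.
Qed.

(** By [lindstedt_jacobian] with N = n, the norm of u up to order n is at most 1
    at the radius r = kappa n^(- 2 tau / alpha), so its coefficient of order n is
    at most r^(-n). The equation itself bounds mu in the same way. *)
Lemma Kser_gevrey (rho : R) : 0 < rho -> gevrey_bounds rho (2 * tau / alpha%:R) Kser muser.
Proof.
move=> rho0.
have [kappa [N0 [/andP[c0 c1] H]]] := lindstedt_jacobian s_le_d d_gt0 alpha_gt0 nu_gt0 tau_gt0 omega_dioph.
set sg := 2 * tau / alpha%:R.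
pose e := expR (2 * pi * rho * d%:R) : R.
have e1 : 1 <= e by rewrite -[leLHS]expR0 ler_expR !mulr_ge0 ?pi_ge0 // ltW.
pose L := 3 + inveq_bound omega s.
have b0 := inveq_bound_ge0 omega s.
exists L, (kappa^-1 * e), N0 => n nN; have [n0 Hn] := H n (ltnW nN).
have /andP[r0 r1] := @gevrey_radius_bounds R alpha tau tau_gt0 kappa n c0 n0.
set r := gevrey_radius _ _ _ _ in Hn r0 r1.
have r01 : 0 <= r <= 1 by rewrite (ltW r0) (le_trans r1).
have rE : (r ^+ n)^-1 = kappa^-1 ^+ n * n%:R `^ (sg * n%:R).
  rewrite /r /gevrey_radius -/sg exprMn invfM exprVn powRN exprVn invrK; congr (_ * _).
  by rewrite powRrM powR_mulrn ?powR_ge0.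
set U := lindstedt n.+1 in Hn.
have aU : avg d U = 0 by exact: avg_lindstedt.
have u1 : pnrm U`_n <= (r ^+ n)^-1.
  rewrite -[leRHS]mul1r ler_pdivlMr ?exprn_gt0 //.
  apply: le_trans (nrm_coef _ (ltW r0) (ltnSn n)) _.
  by apply: le_trans (nrm_le_dtheta _ (ltW r0) aU) _; lra.
have mu1 : normc (muser n) <= inveq_bound omega s * (r ^+ n)^-1.
  rewrite ler_pdivlMr ?exprn_gt0 //.
  apply: le_trans (_ : pnrm (inveq n.+1 U)`_n * r ^+ n <= _).
    by rewrite ler_wpM2r ?exprn_ge0 ?(ltW r0) // normc_coef_le.
  apply: le_trans (nrm_coef _ (ltW r0) (ltnSn n)) _.
  by apply: nrm_inveq => //; lra.
have q0 : 0 <= (r ^+ n)^-1 by rewrite invr_ge0 exprn_ge0 ?ltW.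
have en : 1 <= e ^+ n by rewrite exprn_ege1.
have -> : L * (kappa^-1 * e) ^+ n * n%:R `^ (sg * n%:R) = L * ((r ^+ n)^-1 * e ^+ n).
  by rewrite rE exprMn; ring.
split.
  have uz z : strip rho z -> normc (ucoef n z) <= (r ^+ n)^-1 * e ^+ n.
    move=> zr; apply: le_trans (normc_evalc _ _ (ltW rho0) zr) _.
      exact: cone_lindstedt.
    by rewrite ler_wpM2r // exprn_ge0 // expR_ge0.
  have P0 : 0 <= (r ^+ n)^-1 * e ^+ n by rewrite mulr_ge0 // (le_trans ler01).
  have zr' z : strip rho z -> strip rho (z - omega%:C).
    by rewrite /strip /= complexImB subr0.
  have L3 : 3 * ((r ^+ n)^-1 * e ^+ n) <= L * ((r ^+ n)^-1 * e ^+ n).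
    by rewrite ler_wpM2r // /L; lra.
  apply: (@le_trans _ _ ((r ^+ n)^-1 * e ^+ n + 2 * ((r ^+ n)^-1 * e ^+ n))%:E); last first.
    by rewrite lee_fin; lra.
  have -> : Kser n = (fun z => vec2 (ucoef n z) (ucoef n z - ucoef n (z - omega%:C))).
    by case: (n) n0.
  apply: strip_norm2_le; first exact: ltW.
    by move=> z zr; rewrite vec2_0; exact: uz.
  move=> z zr; rewrite vec2_1; apply: le_trans (le_normcD _ _) _; rewrite normcN.
  by have := uz _ zr; have := uz _ (zr' z zr); lra.
apply: le_trans mu1 _; apply: (@le_trans _ _ (L * (r ^+ n)^-1)).
  by rewrite ler_wpM2r // /L; lra.
rewrite ler_wpM2l //; first by rewrite /L; lra.
by rewrite ler_peMr.
Qed.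

End Existence.

(** * Polynomials that are small at the origin *)

Section PolynomialOrder.
Context {R : realType}.
Implicit Types (p q : {poly R[i]}) (e : R[i]).

Lemma normc_horner_le p e N : normc e <= 1 -> (forall n, (n < N)%N -> p`_n = 0) ->
  normc p.[e] <= pnrm p * normc e ^+ N.
Proof.
move=> e1 p0; rewrite horner_coef; apply: le_trans (normc_sum _ _ _) _.
rewrite /pnrm mulr_suml; apply: ler_sum => n _; rewrite normcM normcX.
case: (ltnP n N) => [nN|Nn]; first by rewrite p0 // normc0 !mul0r.
rewrite ler_wpM2l ?normc_ge0 // -(subnKC Nn) exprD.
by rewrite ler_piMr ?exprn_ge0 ?exprn_ile1 ?normc_ge0.
Qed.

(** By induction the coefficients before n vanish. Divided by t^n, the bound
    then shows that the coefficient of order n is O(t). *)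
Lemma poly_order p N (C delta : R) : 0 < delta ->
  (forall t : R, 0 < t -> t < delta -> normc p.[t%:C] <= C * t ^+ N.+1) ->
  forall n, (n <= N)%N -> p`_n = 0.
Proof.
move=> delta0 H n; elim/ltn_ind: n => n IH nN.
set q := p - p`_n *: 'X^n.
have q0 k : (k < n.+1)%N -> q`_k = 0.
  rewrite ltnS leq_eqVlt => /orP[/eqP ->|kn].
    by rewrite coefB coefZ coefXn eqxx mulr1 subrr.
  by rewrite coefB coefZ coefXn ltn_eqF // mulr0 subr0 IH // (leq_trans (ltnW kn)).
have key (t : R) : 0 < t -> t <= 1 -> t < delta -> normc p`_n <= (`|C| + pnrm q) * t.
  move=> t0 t1 td; set e := t%:C.
  have ne : normc e = t by rewrite /e /= expr0n addr0 sqrtr_sqr gtr0_norm.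
  have h1 : normc p.[e] <= C * t ^+ N.+1 by exact: H.
  have h2 : normc q.[e] <= pnrm q * t ^+ n.+1.
    by have := @normc_horner_le q e n.+1; rewrite ne; apply.
  have h3 : normc p`_n * t ^+ n <= normc p.[e] + normc q.[e].
    rewrite -ne -normcX -normcM -(normcN q.[e]).
    have -> : p`_n * e ^+ n = p.[e] + - q.[e].
      by rewrite /q hornerD hornerN hornerZ hornerXn opprD opprK addrA subrr add0r.
    exact: le_normcD.
  have h4 : C * t ^+ N.+1 <= `|C| * t ^+ n.+1.
    apply: (@le_trans _ _ (`|C| * t ^+ N.+1)).
      by rewrite ler_wpM2r ?exprn_ge0 ?(ltW t0) ?ler_norm.
    by rewrite ler_wpM2l // ler_wiXn2l ?(ltW t0).
  rewrite -(@ler_pM2r _ (t ^+ n)) ?exprn_gt0 // -mulrA -exprS mulrDl.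
  by lra.
apply: eq0_normc; apply/eqP; rewrite eq_le normc_ge0 andbT.
set A := `|C| + pnrm q in key *.
have A0 : 0 <= A by rewrite addr_ge0 ?pnrm_ge0.
rewrite leNgt; apply/negP => P0.
set t := Num.min (Num.min 1 (delta / 2)) (normc p`_n / (2 * (A + 1))).
have t0 : 0 < t by rewrite !lt_min ltr01 !divr_gt0 // mulr_gt0 //; lra.
have t1 : t <= 1 by rewrite !ge_min lexx.
have t2 : t <= delta / 2 by rewrite !ge_min lexx orbT.
have t3 : t * (2 * (A + 1)) <= normc p`_n.
  by rewrite -ler_pdivlMr ?ge_min ?lexx ?orbT // mulr_gt0 //; lra.
have k := key t t0 t1 _; have {}k := k (_ : t < delta).
have {}k : normc p`_n <= A * t by apply: k; lra.
nra.
Qed.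

End PolynomialOrder.

(** * Formal solutions and asymptotic solutions *)

Section Asymptotics.
Context {R : realType} (alpha : nat) (omega : R) (s : seq (int * R[i])).
Implicit Types (K : nat -> R[i] -> 'cV[R[i]]_2) (mu : nat -> R[i]) (z e : R[i]).
Local Notation V := (trigsum s).

Definition partial_sum N (a : nat -> R[i]) : {poly R[i]} := \poly_(j < N.+1) a j.

(** The coefficients of u = x - theta, when x has the leading term theta. *)
Definition deviation (x : nat -> R[i]) (j : nat) : R[i] := if j is 0%N then 0 else x j.

(** V'(z + u), with u replaced by its partial sum and each exponential by its
    Taylor sum: this makes it a polynomial in eps. *)
Definition force_poly N z (x : nat -> R[i]) : {poly R[i]} :=
  \sum_(p <- dtrig s) (p.2 * fourier p.1 z) *:
    \sum_(m < N.+1) (wavenumber p.1 ^+ m / (m`!)%:R) *: partial_sum N (deviation x) ^+ m.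

Lemma partial_sumE N a e : (partial_sum N a).[e] = \sum_(j < N.+1) e ^+ j * a j.
Proof. by rewrite horner_poly; apply: eq_bigr => j _; rewrite mulrC. Qed.

Lemma coef_partial_sum N a n : (n <= N)%N -> (partial_sum N a)`_n = a n.
Proof. by move=> nN; rewrite coef_poly ltnS nN. Qed.

Lemma coef_partial_sumX N a m n : (n <= N)%N ->
  (partial_sum N a ^+ m)`_n = fps_pow a m n.
Proof.
elim: m n => [|m IH] n nN; first by rewrite expr0 coef1.
rewrite exprS coefM; apply: eq_bigr => i _.
by rewrite IH ?(leq_trans (leq_subr _ _)) // coef_partial_sum // (leq_trans (leq_ord i)).
Qed.

Lemma fps_pow_small (a : nat -> R[i]) m n : a 0%N = 0 -> (n < m)%N -> fps_pow a m n = 0.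
Proof.
move=> a0; elim: m n => // m IH n nm; rewrite /= /fps_mul big1 // => -[[|i] /= ni] _.
  by rewrite a0 mul0r.
by rewrite IH ?mulr0 // subnSK // (leq_trans (leq_subr _ _)).
Qed.

Lemma coef_force_poly N x z n : (n <= N)%N -> x 0%N = z ->
  (force_poly N z x)`_n = fps_comp (cderive V) x n.
Proof.
move=> nN x0; rewrite /force_poly /fps_comp coef_sum.
rewrite (eq_bigr (fun p => \sum_(m < n.+1) p.2 * fourier p.1 z *
   (wavenumber p.1 ^+ m / (m`!)%:R * fps_pow (deviation x) m n))) => [|p _]; last first.
  rewrite coefZ coef_sum mulr_sumr.
  rewrite (big_ord_widen N.+1 (fun m => p.2 * fourier p.1 z *
     (wavenumber p.1 ^+ m / (m`!)%:R * fps_pow (deviation x) m n))) // big_mkcond.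
  rewrite [RHS]big_mkcond; apply: eq_bigr => m _; rewrite coefZ coef_partial_sumX //.
  by case: ltnP => // nm; rewrite fps_pow_small ?mulr0.
rewrite exchange_big; apply: eq_bigr => m _.
rewrite cderive_trigsum iter_cderive_trigsum x0 !mulr_suml.
by apply: eq_bigr => p _; move: (_^-1) (fps_pow _ _ _) => a b; ring.
Qed.

Lemma force_poly_rest N x z e (S : R) : x 0%N = z -> normc e <= 1 ->
  pnrm (partial_sum N (deviation x)) <= S -> S * normc e <= 1 ->
  normc (cderive V (\sum_(j < N.+1) e ^+ j * x j) - (force_poly N z x).[e]) <=
    trig_mass (dtrig s) z * expR (trig_size (dtrig s)) * (2 * trig_size (dtrig s) * S) ^+ N.+1
     * normc e ^+ N.+1.
Proof.
move=> x0 e1 uS Se; set U := partial_sum N (deviation x) in uS.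
have S0 : 0 <= S by apply: le_trans uS; exact: pnrm_ge0.
have -> : \sum_(j < N.+1) e ^+ j * x j = z + U.[e].
  by rewrite /U partial_sumE !big_ord_recl /= mulr0 add0r expr0 mul1r x0.
have Ue : normc U.[e] <= S * normc e.
  rewrite -[normc e]expr1; apply: le_trans (normc_horner_le (N := 1) e1 _) _.
    by move=> [|//] _; rewrite coef_partial_sum.
  by rewrite ler_wpM2r ?exprn_ge0 ?normc_ge0.
rewrite cderive_trigsum.
have -> : (force_poly N z x).[e] =
  \sum_(p <- dtrig s) p.2 * fourier p.1 z * exp_sum N.+1 (wavenumber p.1 * U.[e]).
  rewrite /force_poly horner_sum; apply: eq_bigr => p _; rewrite hornerZ horner_sum.
  congr (_ * _); apply: eq_bigr => m _.
  by rewrite hornerZ horner_exp exprMn mulrAC.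
apply: le_trans (trigsum_taylor _ _ _ (le_trans Ue Se)) _.
rewrite -[leRHS]mulrA -exprMn ler_wpM2l //.
  by rewrite mulr_ge0 ?expR_ge0 // sumr_ge0 // => p _; exact: normc_ge0.
by apply: lerXn2r; rewrite ?nnegrE ?mulr_ge0 ?trig_size_ge0 ?normc_ge0 //
  -?mulrA ler_wpM2l // ler_wpM2l ?trig_size_ge0.
Qed.

Definition error_poly1 N K mu z : {poly R[i]} :=
  (1 - 'X^alpha) * partial_sum N (fun j => K j z 1 0) + partial_sum N mu
  - 'X * force_poly N z (fun j => K j z 0 0) - partial_sum N (fun j => K j (z + omega%:C) 1 0).

Definition error_poly0 N K mu z : {poly R[i]} :=
  partial_sum N (fun j => K j z 0 0)
  + (1 - 'X^alpha) * partial_sum N (fun j => K j z 1 0) + partial_sum N mu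
  - 'X * force_poly N z (fun j => K j z 0 0) - partial_sum N (fun j => K j (z + omega%:C) 0 0).

Lemma trunc_KE K N e z i : trunc_K K N e z i 0 = \sum_(j < N.+1) e ^+ j * K j z i 0.
Proof. by rewrite /trunc_K summxE; apply: eq_bigr => j _; rewrite mxE. Qed.

Lemma trunc_muE mu N e : trunc_mu mu N e = (partial_sum N mu).[e].
Proof. by rewrite partial_sumE; apply: eq_bigr => j _; rewrite mulrC. Qed.

Lemma invariance_error1 K mu N e z :
  invariance_error alpha V omega K mu N e z 1 0 = (error_poly1 N K mu z).[e]
    - e * (cderive V (\sum_(j < N.+1) e ^+ j * K j z 0 0)
           - (force_poly N z (fun j => K j z 0 0)).[e]).
Proof.
rewrite /invariance_error mxE [X in _ + X]mxE /dissipative_map vec2_1 !trunc_KE trunc_muE.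
rewrite /error_poly1 !(hornerD, hornerN, hornerM, hornerC, hornerX, hornerXn).
by rewrite !partial_sumE /lambda; ring.
Qed.

Lemma invariance_error0 K mu N e z :
  invariance_error alpha V omega K mu N e z 0 0 = (error_poly0 N K mu z).[e]
    - e * (cderive V (\sum_(j < N.+1) e ^+ j * K j z 0 0)
           - (force_poly N z (fun j => K j z 0 0)).[e]).
Proof.
rewrite /invariance_error mxE [X in _ + X]mxE /dissipative_map vec2_0 !trunc_KE trunc_muE.
rewrite /error_poly0 !(hornerD, hornerN, hornerM, hornerC, hornerX, hornerXn).
by rewrite !partial_sumE /lambda; ring.
Qed.

Lemma coef_lambda N a n : (n <= N)%N ->
  ((1 - 'X^alpha) * partial_sum N a)`_n = fps_mul (fps_lambda alpha) a n.
Proof.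
move=> nN; rewrite mulrBl mul1r coefB coefXnM fps_mul_lambda coef_partial_sum //.
rewrite ltnNge; case: leqP => //= an; rewrite coef_partial_sum //.
by rewrite (leq_trans (leq_subr _ _)).
Qed.

Lemma coef_Xforce N K z n : (n <= N)%N -> K 0%N = K0 omega ->
  ('X * force_poly N z (fun j => K j z 0 0))`_n =
  fps_mul fps_eps (fps_comp (cderive V) (fun j => K j z 0 0)) n.
Proof.
move=> nN k0; rewrite coefXM fps_mul_eps; case: n nN => [|n] nN //=.
by rewrite coef_force_poly ?(ltnW nN) // k0 /K0 vec2_0.
Qed.

Lemma coef_error_poly1 N K mu z n : (n <= N)%N -> K 0%N = K0 omega ->
  (error_poly1 N K mu z)`_n = fps_dissipative_map alpha V mu (fun j => K j z) n 1 0
     - K n (z + omega%:C) 1 0.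
Proof.
move=> nN k0; rewrite /error_poly1 /fps_dissipative_map vec2_1 !coefB coefD.
by rewrite coef_lambda // coef_Xforce // !coef_partial_sum.
Qed.

Lemma coef_error_poly0 N K mu z n : (n <= N)%N -> K 0%N = K0 omega ->
  (error_poly0 N K mu z)`_n = fps_dissipative_map alpha V mu (fun j => K j z) n 0 0
     - K n (z + omega%:C) 0 0.
Proof.
move=> nN k0; rewrite /error_poly0 /fps_dissipative_map vec2_0 !coefB 2!coefD.
by rewrite coef_lambda // coef_Xforce // !coef_partial_sum.
Qed.

(** At a fixed z, the error differs from the polynomial [error_poly0] or
    [error_poly1] by a term O(eps^(n+1)). So the polynomial is O(eps^(n+1)), and
    its coefficient of order n, which is the formal equation at order n,
    vanishes. *)
Lemma asymptotic_formal rho K mu : K 0%N = K0 omega ->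
  asymptotic_solution alpha V omega rho K mu -> formal_solution alpha V omega rho K mu.
Proof.
move=> k0 H n z zr; have [C C0 /nbhs_complexP[delta delta0 HC]] := H n.
set x := fun j => K j z 0 0.
set S := pnrm (partial_sum n (deviation x)).
have S0 : 0 <= S by exact: pnrm_ge0.
have x0 : x 0%N = z by rewrite /x k0 /K0 vec2_0.
set W := trig_mass (dtrig s) z * expR (trig_size (dtrig s)) *
  (2 * trig_size (dtrig s) * S) ^+ n.+1.
have W0 : 0 <= W.
  rewrite !mulr_ge0 ?expR_ge0 ?exprn_ge0 ?mulr_ge0 ?trig_size_ge0 //.
  by rewrite sumr_ge0 // => p _; exact: normc_ge0.
set d1 := Num.min delta (1 / (S + 1)).
have d10 : 0 < d1 by rewrite lt_min delta0 divr_gt0 //; lra.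
have small e i (p : {poly R[i]}) : normc e < d1 ->
    invariance_error alpha V omega K mu n e z i 0 = p.[e]
    - e * (cderive V (\sum_(j < n.+1) e ^+ j * K j z 0 0)
           - (force_poly n z (fun j => K j z 0 0)).[e]) ->
    normc p.[e] <= (C + W) * normc e ^+ n.+1.
  rewrite lt_min => /andP[ed eS] E.
  have eS1 : normc e * (S + 1) < 1 by rewrite -ltr_pdivlMr //; lra.
  have en := normc_ge0 e.
  have e1 : normc e <= 1 by nra.
  have Se : S * normc e <= 1 by nra.
  have h1 := @force_poly_rest n x z e S x0 e1 (lexx _) Se.
  have h2 : normc (invariance_error alpha V omega K mu n e z i 0) <= C * normc e ^+ n.+1.
    by apply: (le_strip_norm2 (rho := rho)) => //; apply: HC; rewrite subr0.
  have -> : p.[e] = invariance_error alpha V omega K mu n e z i 0 +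
     e * (cderive V (\sum_(j < n.+1) e ^+ j * K j z 0 0)
           - (force_poly n z (fun j => K j z 0 0)).[e]) by rewrite E subrK.
  apply: le_trans (le_normcD _ _) _; rewrite mulrDl lerD // normcM.
  by apply: le_trans h1; rewrite ler_piMl ?normc_ge0.
have nt (t : R) : 0 < t -> normc t%:C = t.
  by move=> t0; rewrite /= expr0n addr0 sqrtr_sqr gtr0_norm.
have Q i p : (forall e, invariance_error alpha V omega K mu n e z i 0 = p.[e]
    - e * (cderive V (\sum_(j < n.+1) e ^+ j * K j z 0 0)
           - (force_poly n z (fun j => K j z 0 0)).[e])) -> p`_n = 0.
  move=> E; apply: (@poly_order _ p n (C + W) d1 d10 _ n (leqnn n)) => t t0 td.
  by rewrite -[X in X ^+ _](nt t t0); apply: small (E _); rewrite nt.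
have Q0 := Q 0 _ (fun e => invariance_error0 K mu n e z).
have Q1 := Q 1 _ (fun e => invariance_error1 K mu n e z).
rewrite coef_error_poly0 // in Q0; rewrite coef_error_poly1 // in Q1.
apply/matrixP => i j; rewrite ord1; apply/eqP; rewrite -subr_eq0; apply/eqP.
by case: (ord2P i) => ->.
Qed.

Lemma pnrm_partial_sum N a (B : R) : (forall j, (j <= N)%N -> normc (a j) <= B) ->
  pnrm (partial_sum N a) <= N.+1%:R * B.
Proof.
move=> aB; rewrite -(pnrmE (size_poly _ _ : (size (partial_sum N a) <= N.+1)%N)).
rewrite mulr_natl -[X in _ *+ X]card_ord -sumr_const; apply: ler_sum => j _.
by rewrite coef_partial_sum ?aB // -ltnS.
Qed.

Lemma pnrmXn k : pnrm ('X^k : {poly R[i]}) = 1.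
Proof.
rewrite /pnrm size_polyXn big_ord_recr /= coefXn eqxx big1 ?add0r.
  by rewrite -[LHS]/(normc 1) normc1.
by move=> i _; rewrite coefXn ltn_eqF // normc0.
Qed.

Lemma normc_fourier_strip rho k z : strip rho z ->
  normc (fourier k z) <= expR (normc (wavenumber k : R[i]) * rho).
Proof.
move=> zr; rewrite normc_fourier ler_expR normc_wavenumber.
apply: le_trans (ler_norm _) _; rewrite normrN !normrM.
rewrite (ger0_norm (pi_ge0 _)) (ger0_norm (_ : 0 <= 2)) // -intr_norm -abszE.
by rewrite ler_wpM2l // !mulr_ge0 ?pi_ge0.
Qed.

Lemma pnrmZ c (p : {poly R[i]}) : pnrm (c *: p) <= normc c * pnrm p.
Proof. by apply: le_pnrm => j; rewrite coefZ normcM. Qed.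

Lemma pnrmX (p : {poly R[i]}) m : pnrm (p ^+ m) <= pnrm p ^+ m.
Proof.
elim: m => [|m IH]; first by rewrite !expr0 pnrmC normc1.
by rewrite !exprS (le_trans (pnrmM _ _)) // ler_wpM2l ?pnrm_ge0.
Qed.

Definition force_bound (rho S : R) N : R :=
  \sum_(p <- dtrig s) normc p.2 * expR (normc (wavenumber p.1 : R[i]) * rho) *
    \sum_(m < N.+1) normc (wavenumber p.1 ^+ m / (m`!)%:R : R[i]) * S ^+ m.

Lemma pnrm_force_poly rho S N z x : strip rho z ->
  pnrm (partial_sum N (deviation x)) <= S ->
  pnrm (force_poly N z x) <= force_bound rho S N.
Proof.
move=> zr xS; have S0 : 0 <= S by apply: le_trans xS; exact: pnrm_ge0.
apply: le_trans (pnrm_sum _ _ _) _; apply: ler_sum => p _.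
apply: le_trans (pnrmZ _ _) _; apply: ler_pM; rewrite ?normc_ge0 ?pnrm_ge0 //.
  by rewrite normcM ler_wpM2l ?normc_ge0 // normc_fourier_strip.
apply: le_trans (pnrm_sum _ _ _) _; apply: ler_sum => m _.
apply: le_trans (pnrmZ _ _) _; rewrite ler_wpM2l ?normc_ge0 //.
apply: le_trans (pnrmX _ _) _; apply: lerXn2r; rewrite ?nnegrE ?pnrm_ge0 //.
Qed.

Lemma uniform_bound (T : Type) (D : T -> Prop) (f g : nat -> T -> R) N :
  (forall j, exists B : R, forall t, D t -> f j t <= B /\ g j t <= B) ->
  exists2 B : R, 0 <= B & forall j t, (j <= N)%N -> D t -> f j t <= B /\ g j t <= B.
Proof.
move=> H; elim: N => [|N [B B0 HB]].
  have [B HB] := H 0%N; exists `|B| => // j z; rewrite leqn0 => /eqP -> /HB[h1 h2].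
  by rewrite !(le_trans _ (ler_norm B)).
have [B' HB'] := H N.+1; exists (B + `|B'|) => [|j z]; first by rewrite addr_ge0.
rewrite leq_eqVlt => /orP[/eqP -> /HB'[h1 h2]|jN zD].
  by have := ler_norm B'; lra.
by have [h1 h2] := HB j z jN zD; have := normr_ge0 B'; lra.
Qed.

(** For a formal solution both components of the map are linked by
    x(. + omega) = x + y(. + omega) at all orders. Thus the first component of the
    error, which contains theta itself, needs no estimate of its own; theta is
    unbounded on the strip lifted to the plane. *)
Lemma formal_error0 rho K mu N e z : K 0%N = K0 omega -> strip rho z ->
  formal_solution alpha V omega rho K mu ->
  invariance_error alpha V omega K mu N e z 0 0 = invariance_error alpha V omega K mu N e z 1 0.
Proof.
move=> k0 zr F; rewrite invariance_error0 invariance_error1; congr (_.[e] - _).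
apply/eqP; rewrite -subr_eq0; apply/eqP.
rewrite (_ : _ - _ = partial_sum N (fun j => K j z 0 0)
  + partial_sum N (fun j => K j (z + omega%:C) 1 0)
  - partial_sum N (fun j => K j (z + omega%:C) 0 0)); last first.
  by rewrite /error_poly0 /error_poly1; ring.
apply/polyP => n; rewrite coefB coefD !coef_poly coef0; case: ltnP => _; last by rewrite addr0 subr0.
by rewrite -(F n z zr) /fps_dissipative_map vec2_0 vec2_1; ring.
Qed.

(** The coefficients of the error polynomial vanish up to order N by the
    formal equation. The others, and the Taylor remainder of V', are bounded
    uniformly on the strip because the coefficients of the expansion are. *)
Lemma formal_asymptotic rho K mu : 0 <= rho -> K 0%N = K0 omega ->
  (forall j, exists B : R, forall z, strip rho z ->
      normc (K j z 1 0) <= B /\ normc (deviation (fun j => K j z 0 0) j) <= B) ->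
  formal_solution alpha V omega rho K mu -> asymptotic_solution alpha V omega rho K mu.
Proof.
move=> rho0 k0 KB F N.
have [B B0 HB] := uniform_bound N KB.
set S := N.+1%:R * B; have S0 : 0 <= S by rewrite mulr_ge0.
set M := \sum_(p <- dtrig s) normc p.2 * expR (normc (wavenumber p.1 : R[i]) * rho).
have M0 : 0 <= M.
  by rewrite sumr_ge0 // => p _; rewrite mulr_ge0 ?normc_ge0 ?expR_ge0.
set W := M * expR (trig_size (dtrig s)) * (2 * trig_size (dtrig s) * S) ^+ N.+1.
have W0 : 0 <= W by rewrite !mulr_ge0 ?expR_ge0 ?exprn_ge0 ?mulr_ge0 ?trig_size_ge0.
set T := 2 * S + pnrm (partial_sum N mu) + force_bound rho S N + S.
have T0 : 0 <= T.
  rewrite !addr_ge0 ?mulr_ge0 ?pnrm_ge0 // sumr_ge0 // => p _.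
  rewrite !mulr_ge0 ?normc_ge0 ?expR_ge0 // sumr_ge0 // => m _.
  by rewrite mulr_ge0 ?normc_ge0 ?exprn_ge0.
exists (2 * (T + W) + 1); first by lra.
apply/nbhs_complexP; exists (1 / (S + 1)); first by rewrite divr_gt0 //; lra.
move=> e; rewrite subr0 => eS.
have eS1 : normc e * (S + 1) < 1 by rewrite -ltr_pdivlMr //; lra.
have en := normc_ge0 e.
have e1 : normc e <= 1 by nra.
have Se : S * normc e <= 1 by nra.
have E1 z : strip rho z ->
    normc (invariance_error alpha V omega K mu N e z 1 0) <= (T + W) * normc e ^+ N.+1.
  move=> zr; have zr' : strip rho (z + omega%:C) by rewrite /strip /= complexImD addr0.
  have uS : pnrm (partial_sum N (deviation (fun j => K j z 0 0))) <= S.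
    by apply: pnrm_partial_sum => j jN; have [] := HB j z jN zr.
  have x0 : K 0%N z 0 0 = z by rewrite k0 /K0 vec2_0.
  rewrite invariance_error1; apply: le_trans (le_normcD _ _) _.
  rewrite normcN mulrDl; apply: lerD.
    apply: le_trans (normc_horner_le (N := N.+1) e1 _) _.
      move=> n nN; rewrite coef_error_poly1 // F // subrr //.
    rewrite ler_wpM2r ?exprn_ge0 //.
    have pB a b : pnrm (a - b : {poly R[i]}) <= pnrm a + pnrm b.
      apply: le_trans (pnrmD _ _) _; rewrite lerD2l -scaleN1r.
      by apply: le_trans (pnrmZ _ _) _; rewrite normcN normc1 mul1r.
    rewrite /T /error_poly1; apply: le_trans (pB _ _) _; apply: lerD; last first.
      by apply: pnrm_partial_sum => j jN; have [] := HB j _ jN zr'.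
    apply: le_trans (pB _ _) _; apply: lerD; last first.
      apply: le_trans (pnrmM _ _) _; rewrite -['X]expr1 pnrmXn mul1r.
      exact: pnrm_force_poly.
    apply: le_trans (pnrmD _ _) _; rewrite lerD2r.
    apply: le_trans (pnrmM _ _) _; apply: ler_pM; rewrite ?pnrm_ge0 //.
      by apply: le_trans (pB _ _) _; rewrite pnrmXn pnrmC normc1.
    by apply: pnrm_partial_sum => j jN; have [] := HB j z jN zr.
  rewrite normcM; apply: le_trans (ler_piMl _ e1) _; first exact: normc_ge0.
  apply: le_trans (force_poly_rest x0 e1 uS Se) _.
  rewrite ler_wpM2r ?exprn_ge0 // ler_wpM2r ?exprn_ge0 ?mulr_ge0 ?trig_size_ge0 //.
  rewrite ler_wpM2r ?expR_ge0 //; apply: ler_sum => p _.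
  by rewrite normcM ler_wpM2l ?normc_ge0 // normc_fourier_strip.
have E0 z : strip rho z ->
    normc (invariance_error alpha V omega K mu N e z 0 0) <= (T + W) * normc e ^+ N.+1.
  by move=> zr; rewrite (formal_error0 _ _ k0 zr F); exact: E1.
apply: le_trans (strip_norm2_le rho0 E0 E1) _.
by rewrite lee_fin; have := exprn_ge0 N.+1 en; nra.
Qed.

End Asymptotics.

(** * Continuous functions under an irrational rotation *)

Section Rotation.
Context {R : realType} (omega : R).
Implicit Types (phi : R -> R[i]).

(** Dirichlet's approximation theorem, by the pigeonhole principle applied to
    the fractional parts of the multiples of omega. *)
Lemma dirichlet (delta : R) : 0 < delta ->
  exists (k : nat) (j : int), (0 < k)%N /\ `|k%:R * omega - j%:~R| < delta.
Proof.
move=> d0; have [N0 N0P] := nat_above delta^-1; set N := N0.+1.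
have Nd : delta^-1 < N%:R by rewrite (le_lt_trans N0P) // ltr_nat.
have N_gt0 : 0 < N%:R :> R by rewrite ltr0n.
pose frac (k : nat) : R := k%:R * omega - (Num.floor (k%:R * omega))%:~R.
have fr k : 0 <= frac k < 1.
  by rewrite /frac subr_ge0 ltrBlDl; have /andP[-> ->] := mem_rg1_floor (k%:R * omega).
pose g (k : nat) := Num.floor (N%:R * frac k).
have gP k : (g k)%:~R <= N%:R * frac k < (g k)%:~R + 1.
  exact: (mem_rg1_floor (N%:R * frac k)).
have gb k : (absz (g k) < N)%N.
  have /andP[f0 f1] := fr k; have /andP[g0 g1] := gP k.
  have gge0 : 0 <= g k by rewrite floor_ge0 mulr_ge0.
  rewrite -ltz_nat gez0_abs // -(ltr_int R); apply: le_lt_trans g0 _.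
  by rewrite -[ltRHS]mulr1 ltr_pM2l.
have gabs k : ((absz (g k))%:R : R) = (g k)%:~R.
  by rewrite -[in RHS](gez0_abs (_ : 0 <= g k)) // floor_ge0 mulr_ge0 //; case/andP: (fr k).
pose h (k : 'I_N.+1) : 'I_N := Ordinal (gb k).
have : ~~ injectiveb h.
  apply/negP => /injectiveP hi; have := leq_card h hi; rewrite !card_ord.
  by rewrite ltnn.
case/injectivePn => k1 [k2 k12 hk].
wlog lt12 : k1 k2 k12 hk / (k1 < k2)%N.
  move=> W; have := k12; rewrite -(inj_eq val_inj) neq_ltn => /orP[|] lt; first exact: (W k1 k2).
  by apply: (W k2 k1) => //; rewrite eq_sym.
have ge : (g k1)%:~R = (g k2)%:~R :> R.
  by rewrite -!gabs; congr (_%:R); move/(congr1 val): hk.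
exists (k2 - k1)%N, (Num.floor (k2%:R * omega) - Num.floor (k1%:R * omega)).
split; first by rewrite subn_gt0.
rewrite natrB ?(ltnW lt12) // intrB.
have -> : (k2%:R - k1%:R) * omega - ((Num.floor (k2%:R * omega))%:~R -
  (Num.floor (k1%:R * omega))%:~R) = frac k2 - frac k1 by rewrite /frac; ring.
have /andP[a1 a2] := gP k1; have /andP[b1 b2] := gP k2.
have : `|N%:R * (frac k2 - frac k1)| < 1.
  by rewrite mulrBr ltr_norml; lra.
rewrite normrM gtr0_norm // mulrC -ltr_pdivlMr // => /lt_trans; apply.
by rewrite mul1r invf_plt ?posrE.
Qed.

Definition line_continuous phi := forall (t e : R), 0 < e ->
  exists2 delta : R, 0 < delta & forall t', `|t' - t| < delta -> normc (phi t' - phi t) < e.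

Lemma orbit_value phi (c : R[i]) (k : nat) (j : int) t :
  (forall t, phi (t + 1) = phi t) -> (forall t, phi (t + omega) = phi t + c) ->
  phi (t + (k%:R * omega - j%:~R)) = phi t + c *+ k.
Proof.
move=> p1 pw.
have pn (n : nat) u : phi (u + n%:R) = phi u.
  elim: n u => [|n IH] u; first by rewrite addr0.
  by rewrite -natr1 addrA p1 IH.
have pj u : phi (u - j%:~R) = phi u.
  case: j => n; first by rewrite -[in RHS](subrK (n%:R : R) u) pn.
  by rewrite NegzE intrN opprK pn.
rewrite addrA pj; elim: k t => [|k IH] t; first by rewrite mul0r mulr0n !addr0.
by rewrite -natr1 mulrDl mul1r addrA pw IH mulrSr addrA.
Qed.

(** Along return times k omega - j that are arbitrarily small, phi changes
    by k c, of modulus at least |c|; continuity excludes this unless c = 0. *)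
Lemma rotation_no_drift phi (c : R[i]) : line_continuous phi ->
  (forall t, phi (t + 1) = phi t) -> (forall t, phi (t + omega) = phi t + c) -> c = 0.
Proof.
move=> cts p1 pw; apply: eq0_normc; apply/eqP; rewrite eq_le normc_ge0 andbT leNgt.
apply/negP => c0; have [delta d0 H] := cts 0 _ c0.
have [k [j [k0 kj]]] := dirichlet d0.
have := H (0 + (k%:R * omega - j%:~R)); rewrite subr0 add0r => /(_ kj).
rewrite -[X in phi X]add0r (orbit_value _ _ _ p1 pw) addrC addKr normcMn.
by rewrite -mulr_natl ltNge ler_peMl ?normc_ge0 // ler1n.
Qed.

(** By irrationality phi has arbitrarily small nonzero periods
    k omega - j, so each t is equivalent to a point arbitrarily close to 0. *)
Lemma rotation_invariant_cst phi : (forall k : int, k != 0 -> fourier k omega%:C != 1) ->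
  line_continuous phi -> (forall t, phi (t + 1) = phi t) ->
  (forall t, phi (t + omega) = phi t) -> forall t, phi t = phi 0.
Proof.
move=> irr cts p1 pw t; apply/eqP; rewrite -subr_eq0; apply/eqP/eq0_normc.
apply/eqP; rewrite eq_le normc_ge0 andbT leNgt; apply/negP => c0.
have [delta d0 H] := cts 0 _ c0.
have [k [j [k0 kj]]] := dirichlet d0.
set a := k%:R * omega - j%:~R in kj.
have a0 : a != 0.
  apply/eqP => a0; have kw : omega%:C * k%:R = j%:~R.
    rewrite -(rmorph_nat (real_complex R)) -rmorphM /= -(rmorph_int (real_complex R)).
    by congr (_%:C); move/eqP: a0; rewrite subr_eq0 mulrC => /eqP.
  have kz : k%:Z != 0 by rewrite eqz_nat -lt0n.
  apply/negP: (irr _ kz); rewrite negbK; apply/eqP.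
  have -> : fourier k%:Z omega%:C = fourier j (1 : R[i]).
    have wE (l : int) (x : R) : wavenumber l * x%:C = 0 +i* (2 * pi * (l%:~R * x)).
      by apply/eqP; rewrite eq_complex /=; apply/andP; split; apply/eqP; ring.
    rewrite !fourierE -[1 : R[i]]/(1%:C) !wE mulr1; congr (cexp (_ +i* (_ * _))).
    by apply/eqP; rewrite -subr_eq0; apply/eqP.
  by have := fourier_period j (0 : R[i]); rewrite add0r => ->; rewrite fourierE mulr0 cexp0.
have pa u : phi (u + a) = phi u.
  rewrite (@orbit_value phi 0 k j u p1) ?mul0rn ?addr0 // => v.
  by rewrite pw addr0.
have pan (n : nat) u : phi (u + n%:R * a) = phi u.
  elim: n u => [|n IH] u; first by rewrite mul0r addr0.
  by rewrite -natr1 mulrDl mul1r addrA pa IH.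
have paz (n : int) u : phi (u - n%:~R * a) = phi u.
  case: n => n; first by rewrite -[in RHS](subrK (n%:R * a) u) pan.
  by rewrite NegzE intrN mulNr opprK pan.
set q := Num.floor (t / a).
have qa : `|t - q%:~R * a| < delta.
  apply: lt_trans kj; have /andP[q1 q2] : q%:~R <= t / a < q%:~R + 1.
    exact: (mem_rg1_floor (t / a)).
  have -> : t - q%:~R * a = (t / a - q%:~R) * a by rewrite mulrBl divfK.
  rewrite normrM -[ltRHS]mul1r ltr_pM2r ?normr_gt0 // ltr_norml; lra.
have := H (t - q%:~R * a); rewrite subr0 => /(_ qa).
by rewrite paz ltxx.
Qed.

End Rotation.

(** * Analytic functions that are constant on horizontal lines *)

Section Rigidity.
Context {R : realType} (rho : R).
Implicit Types (g : R[i] -> R[i]) (z w : R[i]).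

(** An identity principle: the values on a short real segment starting at z
    determine the coefficients of the power series, by [poly_order] applied to its
    partial sums. *)
Lemma analytic_near g z c : analytic_at g z ->
  (exists2 delta : R, 0 < delta & forall t : R, 0 < t -> t < delta -> g (z + t%:C) = c) ->
  exists2 delta : R, 0 < delta & forall w, normc (w - z) < delta -> g w = c.
Proof.
move=> [a /nbhs_complexP[d0 d00 Ha]] [d1 d10 Hc].
set h0 := Num.min d0 d1 / 2.
have m0 : 0 < Num.min d0 d1 by rewrite lt_min d00 d10.
have h00 : 0 < h0 by rewrite divr_gt0.
have h0d : h0 < d0 /\ h0 < d1.
  have : Num.min d0 d1 <= d0 by rewrite ge_min lexx.
  have : Num.min d0 d1 <= d1 by rewrite ge_min lexx orbT.
  by rewrite /h0; split; lra.
clearbody h0.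
have nt (t : R) : 0 < t -> normc t%:C = t.
  by move=> t0; rewrite /= expr0n addr0 sqrtr_sqr gtr0_norm.
pose S N (e : R[i]) := \sum_(0 <= n < N) a n * e ^+ n.
have conv w : normc (w - z) < d0 -> forall e : R, 0 < e ->
    exists N0 : nat, forall N, (N0 <= N)%N -> normc (S N (w - z) - g w) < e.
  by move=> wz; apply/cvg_complexP; exact: Ha.
have convt (t : R) : 0 < t -> t <= h0 -> forall e : R, 0 < e ->
    exists N0 : nat, forall N, (N0 <= N)%N -> normc (S N t%:C - c) < e.
  move=> t0 th e e0; have E : z + t%:C - z = t%:C by rewrite addrC addKr.
  have [] := conv (z + t%:C) _ e e0; first by rewrite E nt //; lra.
  by rewrite E Hc //; [move=> N0 HN; exists N0 | lra].
(* the terms of the series are bounded at h0, so tails are geometric on [0, h0 / 2] *)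
have [B B0 HB] : exists2 B : R, 0 <= B & forall n, normc (a n) * h0 ^+ n <= B.
  have [N0 HN] := convt h0 h00 (lexx _) 1 ltr01.
  exists (2 + \sum_(n < N0) normc (a n) * h0 ^+ n) => [|n].
    by rewrite addr_ge0 // sumr_ge0 // => k _; rewrite mulr_ge0 ?normc_ge0 ?exprn_ge0 ?ltW.
  case: (ltnP n N0) => nN.
    rewrite (bigD1 (Ordinal nN)) //= addrCA lerDl addr_ge0 // sumr_ge0 // => k _.
    by rewrite mulr_ge0 ?normc_ge0 ?exprn_ge0 ?ltW.
  apply: (@le_trans _ _ 2); last first.
    by rewrite lerDl sumr_ge0 // => k _; rewrite mulr_ge0 ?normc_ge0 ?exprn_ge0 ?ltW.
  have h1 := HN n nN; have h2 := HN n.+1 (leqW nN).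
  have E : a n * h0%:C ^+ n = (S n.+1 h0%:C - c) + - (S n h0%:C - c).
    by rewrite /S big_nat_recr //=; ring.
  have : normc (a n * h0%:C ^+ n) <= 2.
    by rewrite E; apply: le_trans (le_normcD _ _) _; rewrite normcN; lra.
  by rewrite normcM normcX nt.
have coef n : a n = if n is 0%N then c else 0.
  pose p := (\poly_(k < n.+1) a k) - c%:P.
  have pn : p`_n = a n - (if n is 0%N then c else 0).
    by rewrite coefB coef_poly ltnSn coefC; case: (n).
  apply/eqP; rewrite -subr_eq0 -pn; apply/eqP.
  apply: (@poly_order _ p n (2 * B / h0 ^+ n.+1) (h0 / 2)) => // [|t t0 th].
    by rewrite divr_gt0.
  have pt : p.[t%:C] = S n.+1 t%:C - c.
    by rewrite hornerD hornerN hornerC horner_poly /S big_mkord.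
  rewrite pt; apply/ler_addgt0Pr => e e0.
  have th0 : t <= h0 by lra.
  have [N0 HN] := convt t t0 th0 e e0.
  have {}HN := HN (n.+1 + N0)%N (leq_addl _ _).
  rewrite (_ : S n.+1 t%:C - c = (S (n.+1 + N0)%N t%:C - c) +
     - (S (n.+1 + N0)%N t%:C - S n.+1 t%:C)); last by ring.
  apply: le_trans (le_normcD _ _) _; rewrite normcN addrC lerD // ?(ltW HN) //.
  have -> : S (n.+1 + N0)%N t%:C - S n.+1 t%:C = \sum_(k < N0) a (n.+1 + k)%N * t%:C ^+ (n.+1 + k).
    rewrite /S (@big_cat_nat _ _ _ n.+1) ?leq_addr //= addrAC subrr add0r.
    rewrite -[X in \sum_(X <= _ < _) _]add0n big_addn addKn big_mkord;
    by apply: eq_bigr => k _; rewrite addnC.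
  apply: le_trans (normc_sum _ _ _) _.
  apply: (@le_trans _ _ (\sum_(k < N0) B * (t / h0) ^+ n.+1 * (1 / 2) ^+ k)).
    apply: ler_sum => k _; rewrite normcM normcX nt //.
    have -> : t ^+ (n.+1 + k) = h0 ^+ (n.+1 + k) * ((t / h0) ^+ n.+1 * (t / h0) ^+ k).
      by rewrite -exprD -exprMn mulrCA mulfV ?mulr1 // gt_eqF.
    rewrite mulrA -[leRHS]mulrA; apply: ler_pM; rewrite ?HB ?mulr_ge0 ?normc_ge0 ?exprn_ge0 ?divr_ge0 ?(ltW t0) ?(ltW h00) //.
    rewrite ler_wpM2l ?exprn_ge0 ?divr_ge0 ?(ltW t0) ?(ltW h00) //.
    apply: lerXn2r; rewrite ?nnegrE ?divr_ge0 ?(ltW t0) ?(ltW h00) //.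
    by rewrite ler_pdivrMr //; lra.
  rewrite -mulr_sumr expr_div_n.
  have G : \sum_(k < N0) (1 / 2 : R) ^+ k <= 2.
    have := subrX1 (1 / 2 : R) N0; have : 0 <= (1 / 2 : R) ^+ N0 by rewrite exprn_ge0.
    lra.
  have Q0 : 0 <= B * (t ^+ n.+1 / h0 ^+ n.+1).
    by rewrite mulr_ge0 ?divr_ge0 ?exprn_ge0 ?(ltW t0) ?(ltW h00).
  by have := ler_wpM2l Q0 G; lra.
exists d0 => // w wz; apply/eqP; rewrite -subr_eq0 -normr_eq0.
have := conv w wz.
have SE N : S N.+1 (w - z) = c.
  rewrite /S big_nat_recl // expr0 mulr1 coef big1 ?addr0 // => k _.
  by rewrite coef mul0r.
move=> H; rewrite normr_eq0 subr_eq0 eq_sym -subr_eq0; apply/eqP/eq0_normc.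
apply/eqP; rewrite eq_le normc_ge0 andbT leNgt; apply/negP => p.
by have [N0 HN] := H _ p; have := HN N0.+1 (leqnSn _); rewrite SE ltxx.
Qed.

Lemma strip_continuousP g :
  {within (strip rho : set R[i]^o), continuous (g : R[i]^o -> R[i]^o)} <->
  forall z, strip rho z -> forall e : R, 0 < e -> exists2 delta : R, 0 < delta &
    forall w, strip rho w -> normc (w - z) < delta -> normc (g w - g z) < e.
Proof.
split=> [/subspace_continuousP cg z zr e e0|H].
  have /cvgrPdist_lt /(_ e%:C) := cg z zr; rewrite ltcR => /(_ e0).
  rewrite near_withinE => /nbhs_complexP [delta d0 H]; exists delta => // w wr wz.
  by have := H w wz wr; rewrite distrC complex_ltE ?ltcR.
apply/subspace_continuousP => z zr; apply/cvgrPdist_lt => e e0.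
have e0' : 0 < complex.Re e by move: e0; rewrite ltcE => /andP[].
rewrite near_withinE; apply/nbhs_complexP.
have [delta d0 Hd] := H z zr _ e0'; exists delta => // w wz wr.
by rewrite distrC complex_ltE // Hd.
Qed.

Lemma strip_continuous g z : analytic_strip rho g -> strip rho z ->
  forall e : R, 0 < e -> exists2 delta : R, 0 < delta &
    forall w, strip rho w -> normc (w - z) < delta -> normc (g w - g z) < e.
Proof. by move=> [_ _ /strip_continuousP cg] zr; exact: cg. Qed.

Lemma locally_constant_segment (f : R -> R) (b : R) :
  (forall t, `|t| < b -> exists2 delta : R, 0 < delta &
     forall t', `|t' - t| < delta -> f t' = f t) ->
  forall t, `|t| < b -> f t = f 0.
Proof.
move=> lc.
have D t : `|t| < b -> is_derive t (1 : R) f 0.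
  move=> tb; have [delta d0 H] := lc t tb.
  apply: (@near_eq_is_derive _ _ _ (cst (f t))).
  apply/nbhs_normP; exists delta => // t' /=; rewrite distrC => /H -> //.
have C u v : `|u| < b -> `|v| < b -> u <= v -> f u = f v.
  move=> ub vb uv.
  have inb x : x \in `[u, v]%R -> `|x| < b.
    by rewrite in_itv /= ltr_norml => /andP[ux xv];
      move: ub vb; rewrite !ltr_norml => /andP[? ?] /andP[? ?]; apply/andP; split; lra.
  have [||c _] := @MVT_segment R f (fun=> 0) u v uv.
  - by move=> x xuv; apply/D/inb; move: xuv; rewrite !in_itv /= => /andP[/ltW -> /ltW ->].
  - by apply: derivable_within_continuous => x /inb/D[].
  by rewrite mul0r => /eqP; rewrite subr_eq0 eq_sym => /eqP.
move=> t tb; have b0 : `|0 : R| < b by rewrite normr0 (le_lt_trans _ tb).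
by have [t0|t0] := leP t 0; [exact: C | symmetry; apply: C => //; exact: ltW].
Qed.

(** By [analytic_near], g is locally constant as a function of the height inside
    the strip, hence constant there; continuity reaches the boundary. *)
Lemma strip_rigid g : 0 < rho -> analytic_strip rho g ->
  (forall z (t : R), strip rho z -> g (z + t%:C) = g z) ->
  forall z, strip rho z -> g z = g 0.
Proof.
move=> rho0 ag gt.
have st0 x : strip rho (0 +i* x) <-> `|x| <= rho by [].
have gline (x y : R) : `|y| <= rho -> g (x +i* y) = g (0 +i* y).
  move=> yr; rewrite -(gt (0 +i* y) x yr); congr g.
  by apply/eqP; rewrite eq_complex /= add0r addr0 !eqxx.
have lc (f : R[i] -> R) t : `|t| < rho ->
    exists2 delta : R, 0 < delta & forall t', `|t' - t| < delta ->
      f (g (0 +i* t')) = f (g (0 +i* t)).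
  move=> tr; have [_ an _] := ag.
  have [|delta d0 H] := analytic_near (c := g (0 +i* t)) (an (0 +i* t) tr).
    by exists 1 => // u _ _; apply: gt; exact: ltW.
  exists delta => // t' tt'; congr f; apply: H.
  by rewrite /= subrr expr0n add0r sqrtr_sqr.
have inner (t : R) : `|t| < rho -> g (0 +i* t) = g 0.
  move=> tr; apply/eqP; rewrite eq_complex -[g 0]/(g (0 +i* 0)); apply/andP; split; apply/eqP.
    exact: (locally_constant_segment (lc (@complex.Re R)) tr).
  exact: (locally_constant_segment (lc (@complex.Im R)) tr).
case=> x y zr; have yr : `|y| <= rho by exact: zr.
rewrite gline //; have [yr'|] := ltP `|y| rho; first exact: inner.
move=> ry; apply/eqP; rewrite -subr_eq0; apply/eqP/eq0_normc.
apply/eqP; rewrite eq_le normc_ge0 andbT leNgt; apply/negP => p.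
have [delta d0 H] := strip_continuous ag (yr : strip rho (0 +i* y)) p.
(* q y is inside the strip and closer than delta to y *)
set q := 1 - Num.min (1 / 2) (delta / (2 * rho)).
have m0 : 0 < Num.min (1 / 2) (delta / (2 * rho)).
  by rewrite lt_min !divr_gt0 ?mulr_gt0.
have m1 : Num.min (1 / 2) (delta / (2 * rho)) <= 1 / 2 by rewrite ge_min lexx.
have m2 : Num.min (1 / 2) (delta / (2 * rho)) * (2 * rho) <= delta.
  by rewrite -ler_pdivlMr ?mulr_gt0 // ge_min lexx orbT.
have yE : `|y| = rho by apply/eqP; rewrite eq_le yr ry.
have qy : `|q * y| < rho.
  rewrite normrM yE ger0_norm; last by rewrite /q; lra.
  by rewrite gtr_pMl // /q; lra.
have := H (0 +i* (q * y)) (ltW qy).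
have -> : normc ((0 +i* (q * y)) - (0 +i* y)) = Num.min (1 / 2) (delta / (2 * rho)) * rho.
  rewrite /= subrr expr0n add0r sqrtr_sqr.
  rewrite (_ : q * y - y = - (Num.min (1 / 2) (delta / (2 * rho)) * y)); last by rewrite /q; ring.
  by rewrite normrN normrM yE gtr0_norm.
rewrite (inner (q * y)) // => h.
have : normc (g 0 - g (0 +i* y)) < normc (g (0 +i* y) - g 0) by apply: h; nra.
by rewrite -normcN opprB ltxx.
Qed.

End Rigidity.

(** * Uniqueness of the normalized expansion *)

Section Uniqueness.
Context {R : realType} (rho omega : R).
Hypothesis rho_gt0 : 0 < rho.
Hypothesis irrational : forall k : int, k != 0 -> fourier k omega%:C != 1.
Implicit Types (g h : R[i] -> R[i]) (z : R[i]).

Lemma analytic_stripB g h : analytic_strip rho g -> analytic_strip rho h ->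
  analytic_strip rho (fun z => g z - h z).
Proof.
move=> [pg ag cg] [ph ah ch]; split=> [z zr|z zr|].
- by rewrite pg ?ph.
- have [a Ha] := ag z zr; have [b Hb] := ah z zr.
  exists (fun n => a n - b n); apply: filterS2 Ha Hb => w ha hb.
  apply/cvg_complexP => e e0; have e2 : 0 < e / 2 by rewrite divr_gt0.
  have [N1 H1] := (cvg_complexP _ _).1 ha _ e2.
  have [N2 H2] := (cvg_complexP _ _).1 hb _ e2.
  exists (N1 + N2)%N => N NN.
  have -> : \sum_(0 <= n < N) (a n - b n) * (w - z) ^+ n =
      \sum_(0 <= n < N) a n * (w - z) ^+ n - \sum_(0 <= n < N) b n * (w - z) ^+ n.
    by rewrite -sumrB; apply: eq_bigr => n _; rewrite mulrBl.
  have := H1 N (leq_trans (leq_addr _ _) NN); have := H2 N (leq_trans (leq_addl _ _) NN).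
  move: (\sum_(_ <= _ < _) _) (\sum_(_ <= _ < _) _) => A B hB hA.
  rewrite (_ : A - B - (g w - h w) = (A - g w) + - (B - h w)); last by ring.
  by apply: le_lt_trans (le_normcD _ _) _; rewrite normcN; lra.
- apply/strip_continuousP => z zr e e0; have e2 : 0 < e / 2 by rewrite divr_gt0.
  have [d1 d10 H1] := (strip_continuousP _ _).1 cg z zr _ e2.
  have [d2 d20 H2] := (strip_continuousP _ _).1 ch z zr _ e2.
  exists (Num.min d1 d2) => [|w wr]; first by rewrite lt_min d10.
  rewrite lt_min => /andP[/(H1 w wr) h1 /(H2 w wr) h2].
  rewrite (_ : g w - h w - (g z - h z) = (g w - g z) + - (h w - h z)); last by ring.
  by apply: le_lt_trans (le_normcD _ _) _; rewrite normcN; lra.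
Qed.

Lemma strip_line g y : analytic_strip rho g -> `|y| <= rho ->
  line_continuous (fun t : R => g (t +i* y)).
Proof.
move=> ag yr t e e0.
have [delta d0 H] := strip_continuous ag (yr : strip rho (t +i* y)) e0.
exists delta => // t' tt'; apply: H => //.
by rewrite /= subrr expr0n addr0 sqrtr_sqr.
Qed.

Lemma real_shift (t u y : R) : (t +i* y) + u%:C = (t + u) +i* y.
Proof. by apply/eqP; rewrite eq_complex /= addr0 !eqxx. Qed.

(** On each horizontal line the two equations are equations over an
    irrational rotation. The first one has no drift, so m = 0, and makes Y constant on
    lines. In the second one this constant is itself a drift of X, so it is 0, and X
    is constant on lines, hence constant. *)
Lemma strip_cohomology X Y (m : R[i]) : analytic_strip rho X -> analytic_strip rho Y ->
  (forall z, strip rho z -> Y (z + omega%:C) = Y z + m) ->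
  (forall z, strip rho z -> X (z + omega%:C) = X z + Y z + m) ->
  [/\ m = 0, forall z, strip rho z -> Y z = 0 & forall z, strip rho z -> X z = X 0].
Proof.
move=> aX aY eY eX.
have per g y : analytic_strip rho g -> `|y| <= rho -> forall t : R, g ((t + 1) +i* y) = g (t +i* y).
  by move=> [pg _ _] yr t; rewrite -real_shift pg.
have m0 : m = 0.
  have y0 : `|0 : R| <= rho by rewrite normr0 ltW.
  apply: (@rotation_no_drift _ omega _ _ (strip_line aY y0) (per _ _ aY y0)) => t.
  by rewrite -real_shift eY.
have lineY y : `|y| <= rho -> forall t : R, Y (t +i* y) = Y (0 +i* y).
  move=> yr; apply: (rotation_invariant_cst irrational (strip_line aY yr) (per _ _ aY yr)) => t.
  by rewrite -real_shift eY // m0 addr0.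
have Y0 y : `|y| <= rho -> Y (0 +i* y) = 0.
  move=> yr; apply: (@rotation_no_drift _ omega _ _ (strip_line aX yr) (per _ _ aX yr)) => t.
  by rewrite -real_shift eX // m0 addr0 lineY.
have lineX y : `|y| <= rho -> forall t : R, X (t +i* y) = X (0 +i* y).
  move=> yr; apply: (rotation_invariant_cst irrational (strip_line aX yr) (per _ _ aX yr)) => t.
  by rewrite -real_shift eX // m0 addr0 lineY // Y0 // addr0.
split=> // [[t y] zr|]; first by rewrite lineY ?Y0.
apply: strip_rigid => // -[t y] u zr; rewrite real_shift.
by rewrite (lineX y zr (t + u)) (lineX y zr t).
Qed.

Lemma circle_integral_addc g h (c : R[i]) : analytic_strip rho h ->
  (forall t : R, g t%:C = h t%:C + c) -> circle_integral g = circle_integral h + c.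
Proof.
move=> ah gh.
have key (f : R[i] -> R) : (forall x y, f (x - y) = f x - f y) ->
    (forall x y, f (x + y) = f x + f y) -> (forall z, `|f z| <= normc z) ->
    \int[lebesgue_measure]_(t in `[0, 1]) f (g t%:C) =
    \int[lebesgue_measure]_(t in `[0, 1]) f (h t%:C) + f c.
  move=> fB fD fle.
  have -> : (fun t : R => f (g t%:C)) = (fun t : R => f (h t%:C) + f c).
    by apply/funext => t; rewrite gh fD.
  have cts : continuous (fun t : R => f (h t%:C)).
    move=> t; apply/cvgrPdist_lt => e e0; apply/nbhs_normP.
    have y0 : `|0 : R| <= rho by rewrite normr0 ltW.
    have [delta d0 H] := strip_line ah y0 t e0; exists delta => // t' /= tt'.
    rewrite distrC -fB; apply: le_lt_trans (fle _) _; apply: H.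
    by rewrite distrC.
  rewrite RintegralD //.
  - congr (_ + _); rewrite Rintegral_cst //= lebesgue_measure_itv /= lte_fin ltr01.
    by rewrite oppr0 adde0 /= mulr1.
  - apply: continuous_compact_integrable; first exact: segment_compact.
    exact: continuous_subspaceT.
  - apply: continuous_compact_integrable; first exact: segment_compact.
    by apply: continuous_subspaceT => t; exact: cvg_cst.
rewrite /circle_integral (key _ (@complexReB R) (@complexReD R) (@abs_Re_le R)).
by rewrite (key _ (@complexImB R) (@complexImD R) (@abs_Im_le R)); case: c {gh key}.
Qed.

Lemma eq_fps_comp g (a b : nat -> R[i]) n : (forall i, (i <= n)%N -> a i = b i) ->
  fps_comp g a n = fps_comp g b n.
Proof.
move=> ab; apply: eq_bigr => m _; rewrite ab //; congr (_ * _).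
by apply: eq_fps_pow => -[|i] // i_n; exact: ab.
Qed.

(** At the first order n + 1 where the solutions might differ, the nonlinear terms
    and the dissipation only involve lower orders, hence cancel. The differences
    satisfy the equations of [strip_cohomology], and the constant that remains is
    fixed by the normalization. *)
Lemma formal_unique (alpha : nat) V (K K' : nat -> R[i] -> 'cV[R[i]]_2)
    (mu mu' : nat -> R[i]) : (0 < alpha)%N ->
  is_expansion omega rho K mu -> formal_solution alpha V omega rho K mu ->
  normalized omega K ->
  is_expansion omega rho K' mu' -> formal_solution alpha V omega rho K' mu' ->
  normalized omega K' -> same_expansion rho K K' mu mu'.
Proof.
move=> alpha_gt0 [k0 m0 aK] fK nK [k0' m0' aK'] fK' nK' n.
elim/ltn_ind: n => -[|n] IH; first by rewrite m0 m0' k0 k0'.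
have lo j z : (j <= n)%N -> strip rho z -> K j z = K' j z.
  by move=> jn zr; have [_] := IH j jn; apply.
pose dX z := K n.+1 z 0 0 - K' n.+1 z 0 0.
pose dY z := K n.+1 z 1 0 - K' n.+1 z 1 0.
pose dm := mu n.+1 - mu' n.+1.
have aX : analytic_strip rho dX by apply: analytic_stripB; [exact: aK | exact: aK'].
have aY : analytic_strip rho dY by apply: analytic_stripB; [exact: aK | exact: aK'].
have E z i : strip rho z -> K n.+1 (z + omega%:C) i 0 - K' n.+1 (z + omega%:C) i 0 =
    (if i == 0 then dX z else 0) + dY z + dm.
  move=> zr; rewrite -(fK n.+1 z zr) -(fK' n.+1 z zr) /fps_dissipative_map.
  rewrite !fps_mul_eps !fps_mul_lambda.
  have -> : fps_comp (cderive V) (fun j => K' j z 0 0) n =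
      fps_comp (cderive V) (fun j => K j z 0 0) n.
    by apply: eq_fps_comp => j jn; rewrite lo.
  have -> : (if (alpha <= n.+1)%N then K' (n.+1 - alpha)%N z 1 0 else 0) =
      (if (alpha <= n.+1)%N then K (n.+1 - alpha)%N z 1 0 else 0).
    case: leqP => // an; rewrite lo //.
    by rewrite leq_subLR -add1n leq_add2r.
  by rewrite /dX /dY /dm; case: (ord2P i) => ->; rewrite ?vec2_0 ?vec2_1 /=; ring.
have eY z : strip rho z -> dY (z + omega%:C) = dY z + dm.
  by move=> zr; rewrite /dY E //= add0r.
have eX z : strip rho z -> dX (z + omega%:C) = dX z + dY z + dm.
  by move=> zr; rewrite /dX E.
have [dm0 Y0 X0] := strip_cohomology aX aY eY eX.
have XC : dX 0 = 0.
  have := nK n.+1 isT; have := nK' n.+1 isT; rewrite !normalized_comp0.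
  rewrite (@circle_integral_addc (fun z => K n.+1 z 0 0) (fun z => K' n.+1 z 0 0) (dX 0)).
  - by move=> ->; rewrite add0r.
  - exact: aK'.
  - move=> t; have tr : strip rho t%:C by rewrite /strip /= normr0 ltW.
    by rewrite -(X0 t%:C tr) /dX addrC subrK.
split; first by apply/eqP; rewrite -subr_eq0; apply/eqP.
move=> z zr; apply/matrixP => i j; rewrite ord1; apply/eqP; rewrite -subr_eq0; apply/eqP.
by case: (ord2P i) => ->; [rewrite -[LHS]/(dX z) X0 | exact: Y0].
Qed.

End Uniqueness.

Theorem theorem18 (R : realType) (nu tau omega : R) (V : R[i] -> R[i])
    (alpha : nat) :
  0 < nu -> 0 < tau -> diophantine nu tau omega ->
  trigonometric_polynomial V -> (1 <= alpha)%N ->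
  exists2 rho0 : R, 0 < rho0 &
    [/\ exists (K : nat -> R[i] -> 'cV[R[i]]_2) (mu : nat -> R[i]),
          [/\ is_expansion omega rho0 K mu,
              formal_solution alpha V omega rho0 K mu &
              asymptotic_solution alpha V omega rho0 K mu],
        forall (K K' : nat -> R[i] -> 'cV[R[i]]_2) (mu mu' : nat -> R[i]),
          is_expansion omega rho0 K mu ->
          formal_solution alpha V omega rho0 K mu ->
          normalized omega K ->
          is_expansion omega rho0 K' mu' ->
          formal_solution alpha V omega rho0 K' mu' ->
          normalized omega K' ->
          same_expansion rho0 K K' mu mu' &
        exists (K : nat -> R[i] -> 'cV[R[i]]_2) (mu : nat -> R[i]),
          [/\ is_expansion omega rho0 K mu,
              formal_solution alpha V omega rho0 K mu,
              asymptotic_solution alpha V omega rho0 K mu,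
              normalized omega K &
              (forall (K' : nat -> R[i] -> 'cV[R[i]]_2) (mu' : nat -> R[i]),
                 is_expansion omega rho0 K' mu' ->
                 asymptotic_solution alpha V omega rho0 K' mu' ->
                 normalized omega K' ->
                 same_expansion rho0 K K' mu mu')
              /\ gevrey_bounds rho0 (2 * tau / alpha%:R) K mu]].
Proof.
move=> nu_gt0 tau_gt0 dioph [s Vs] alpha_gt0.
have VE : V = trigsum s by apply/funext => z; rewrite Vs.
(* the successor makes d positive when V is constant *)
pose d := (\max_(p <- s) `|p.1|%N).+1.
have sd : all (fun p => (`|p.1| <= d)%N) s.
  by apply/allP => p ps; rewrite leqW // (big_rem p ps) leq_maxl.
have rho1 : 0 < 1 :> R by exact: ltr01.
have irr := diophantine_irrational nu_gt0 dioph.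
pose K := Kser d alpha omega s; pose mu := muser d alpha omega s.
have expK : is_expansion omega 1 K mu by exact: is_expansion_Kser.
have formK : formal_solution alpha V omega 1 K mu.
  exact: (formal_solution_Kser sd alpha_gt0 nu_gt0 dioph VE).
have asyK : asymptotic_solution alpha V omega 1 K mu.
  rewrite VE; apply: formal_asymptotic; rewrite -?VE ?ler01 //.
  by move=> j; apply: Kser_bounded; rewrite ?ler01.
have normK : normalized omega K by exact: normalized_Kser.
exists 1 => //; split; [by exists K, mu | |exists K, mu].
  move=> K1 K2 mu1 mu2 e1 f1 n1 e2 f2 n2.
  exact: (formal_unique rho1 irr alpha_gt0 e1 f1 n1 e2 f2 n2).
split=> //; split=> [K' mu' expK' asyK' normK'|].
  have formK' : formal_solution alpha V omega 1 K' mu'.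
    by rewrite VE; apply: asymptotic_formal; rewrite -?VE //; case: expK'.
  exact: (formal_unique rho1 irr alpha_gt0 expK formK normK expK' formK' normK').
exact: (Kser_gevrey sd isT alpha_gt0 nu_gt0 tau_gt0 dioph rho1).
Qed.
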